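(* Apply SSGD (the algorithm described in the context) to the bilevel problem $\min_{x\in\mathbb{R}^p}\Phi(x)$, and suppose Assumptions 1, 2 and 3 (listed in the context) hold. Let $\kappa=L/\mu$, $\eta=\frac{1}{2L}$, $\beta=\frac{3}{2(L+\mu)}=\mathcal{O}(1)$, $\rho_y=\frac{2\beta\mu L}{\mu+L}$, and define $$r_v=\frac{2\mu L}{L^2+\mu^2}=\mathcal{O}(\kappa^{-1}),\qquad r_w=\frac{\eta\mu}{7(2-\eta\mu)},\qquad \rho_2=\mathcal{O}(\kappa^{-4})\ (\rho_2>0),$$ $$C_1=\frac{M\rho}{\mu^2}+\frac{L}{\mu},\quad C_{22}=\Big(1+\frac1{r_w}\Big)\Big(2+\frac{8L^2}{\mu^2}\Big)C_1^2,\quad C_{23}=\Big(1+\frac1{r_w}\Big)(5+r_w)C_1^2,\quad C_{24}=\Big(1+\frac1{r_w}\Big)(9+8r_w)C_1^2,$$ $$\rho_1=\frac{2\rho_2\big((1+r_w)C_{23}+2C_{24}\big)}{\rho_y(1+r_v)-r_v},\qquad \bar C_1=L+\frac{M\tau}{\mu}=\mathcal{O}(\kappa),$$ $$L_{31}=\frac{L_\Phi}{2}+2\Big((\rho_1+C_{24}\rho_2)\frac{2}{r_v}\frac{L^2}{\mu^2}+(1+r_w)C_{22}\rho_2\Big),$$ where $L_\Phi=L+\frac{2L^2+\tau M^2}{\mu}+\frac{\rho LM+L^3+\tau ML}{\mu^2}+\frac{\rho L^2M}{\mu^3}=\mathcal{O}(\kappa^3)$. Let $\|v^0\|\le M/\mu$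 and choose SSGD stepsizes $\eta=\frac{1}{2L}$, $\beta=\frac{3}{2(L+\mu)}$ and $$\alpha=\min\Big\{\frac{1}{2L_{31}},\ \frac{1}{4L^2}\rho_2\eta\mu,\ \big((1+r_w)C_{23}+2C_{24}\big)\frac{\rho_2}{\bar C_1^2}\Big\}.$$ Then for any $T\ge1$ and $J\ge1$, $$\frac1K\sum_{k=0}^{K-1}\mathbb{E}\|\nabla\Phi(x^k)\|^2\le\mathcal{O}\Big(\frac{\kappa^5}{K}+\kappa^2\frac{\sigma_f^2}{D_f}+\kappa^2\frac{\sigma_{g,1}^2}{D_g}+\kappa^8\frac{1}{S}\sigma_g^2+\kappa^4\frac{\sigma_{g,2}^2}{D}\Big).$$ Furthermore, to achieve an $\epsilon$-accurate stationary point, the computational complexity of SSGD is $\mathcal{O}(\kappa^{13}\epsilon^{-2}\max\{T,J\})$.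
   Context: **Problem.** $\xi,\zeta$ are random variables; $F(x,y;\xi)$, $G(x,y;\zeta)$ are real-valued, $x\in\mathbb{R}^p$, $y\in\mathbb{R}^q$; $f(x,y)=\mathbb{E}_\xi[F(x,y;\xi)]$, $g(x,y)=\mathbb{E}_\zeta[G(x,y;\zeta)]$; $y^*(x)=\arg\min_{y\in\mathbb{R}^q}g(x,y)$; $\Phi(x)=f(x,y^*(x))$. The problem is $\min_{x\in\mathbb{R}^p}\Phi(x)$, and $\min_x\Phi(x)$ is finite. **Notation.** $\|\cdot\|$ is the $\ell_2$ norm of vectors and the spectral norm of matrices. $\nabla_x,\nabla_y$ are partial gradients, $\nabla$ the gradient in $(x,y)$, $\nabla_x\nabla_y g$ the ($p\times q$) Jacobian of $\nabla_xg$ with respect to $y$, $\nabla_y^2 g$ the Hessian in $y$. For a finite sample set $\mathcal{D}=\{\xi_1,\dots,\xi_{|\mathcal{D}|}\}$ drawn from the law of the random variable, $\nabla_xF(x,y;\mathcal{D})=\frac1{|\mathcal{D}|}\sum_i\nabla_xF(x,y;\xi_i)$, and similarly for the other derivatives and for $G$. **Assumption 1.** $g(x,y)$ and $G(x,y;\zeta)$ are $\mu$-strongly convex in $y$ for all $x$, $\zeta$; $\Phi$ is nonconvex. **Assumption 2.** With respect to $z=[x;y]$: $f$ is $M$-Lipschitz; $\nabla f$ and $\nabla g$ are $L$-Lipschitz; $\nabla_x\nabla_yg$ is $\tau$-Lipschitz; $\nabla_y^2g$ is $\rho$-Lipschitz. The same holds for $F(\cdot,\cdot;\xi)$ and $G(\cdot,\cdot;\zeta)$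 for every $\xi,\zeta$. **Assumption 3.** $\nabla F(x,y;\xi)$, $\nabla G(x,y;\zeta)$, $\nabla_x\nabla_yG(x,y;\zeta)$, $\nabla_y^2G(x,y;\zeta)$ are unbiased estimates of $\nabla f,\nabla g,\nabla_x\nabla_yg,\nabla_y^2g$ at $(x,y)$, and $\mathbb{E}\|\nabla F-\nabla f\|^2\le\sigma_f^2$, $\mathbb{E}\|\nabla G-\nabla g\|^2\le\sigma_g^2$, $\mathbb{E}\|\nabla_x\nabla_yG-\nabla_x\nabla_yg\|^2\le\sigma_{g,1}^2$, $\mathbb{E}\|\nabla_y^2G-\nabla_y^2g\|^2\le\sigma_{g,2}^2$, with positive constants. **SSGD.** Inputs: integers $K,T,J\ge1$, stepsizes $\alpha,\beta,\eta$, initial points $x^0\in\mathbb{R}^p$, $y^0,v^0\in\mathbb{R}^q$. For $k=0,\dots,K-1$: (1) $x^{k+1}=x^k-\alpha h_f^k$; (2) $y^{k+1,0}=y^k$, and for $t=0,\dots,T-1$, $y^{k+1,t+1}=y^{k+1,t}-\beta\nabla_yG(x^{k+1},y^{k+1,t};\mathcal{S}_t)$; set $y^{k+1}=y^{k+1,T}$; (3) $v^{k+1,0}=v^k$, and for $j=0,\dots,J-1$, $v^{k+1,j+1}=(I-\eta\nabla_y^2G(x^{k+1},y^{k+1};\mathcal{B}_j))v^{k+1,j}+\eta\nabla_yF(x^{k+1},y^{k+1};\mathcal{D}_{F,j})$; set $v^{k+1}=v^{k+1,J}$; (4) compute $h_f^{k+1}$. Here for all $k$, $h_f^k=\nabla_xF(x^k,y^k;\mathcal{D}_F)-\nabla_x\nabla_yG(x^k,y^k;\mathcal{D}_G)v^k$.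 Sample sets are freshly drawn at each use, and the sets $\mathcal{D}_F,\mathcal{D}_G,\mathcal{B}_j,\mathcal{D}_{F,j}$ ($j=0,\dots,J-1$) are mutually independent. Batch sizes: $|\mathcal{S}_t|=S$, $|\mathcal{B}_j|=D$, $|\mathcal{D}_G|=D_g$, $|\mathcal{D}_F|=|\mathcal{D}_{F,j}|=D_f$. **Stationarity and complexity.** $\bar x$ is an $\epsilon$-(accurate) stationary point if $\mathbb{E}\|\nabla\Phi(\bar x)\|^2\le\epsilon$; for SSGD $\bar x$ is drawn uniformly at random from $x^0,\dots,x^{K-1}$. The computational complexity is the total number of partial-gradient evaluations $\nabla_xF,\nabla_yF,\nabla_xG,\nabla_yG$ at single samples, Jacobian-vector products $\nabla_x\nabla_yG(x,y;\zeta)v$ and Hessian-vector products $\nabla_y^2G(x,y;\zeta)v$ at single samples, for a suitable choice of $K$ and the batch sizes. **Order notation.** $\mathcal{O}(\cdot)$ tracks the dependence on the displayed quantities ($\kappa$, $K$, $\epsilon$, $T$, $J$, batch sizes, variances); other problem and initialization quantities are treated as constants. A parameter set equal to $\mathcal{O}(\kappa^a)$ is chosen of order $\kappa^a$. *)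

(* Defs.v *)
(* MathComp / MathComp-Analysis. *)
From HB Require Import structures.
From mathcomp Require Import all_boot all_order all_algebra.
From mathcomp Require Import all_classical all_reals all_analysis.

Set Implicit Arguments.
Unset Strict Implicit.
Unset Printing Implicit Defensive.

Import Order.TTheory GRing.Theory Num.Theory.
Import numFieldNormedType.Exports.

Local Open Scope classical_set_scope.
Local Open Scope ring_scope.

(* The norm of the library on matrices is the max norm, hence the two norms
   below. *)
Definition l2norm (R : realType) (n : nat) (u : 'cV[R]_n) : R :=
  Num.sqrt (\sum_(i < n) u i 0 ^+ 2).

Definition spectral_norm (R : realType) (m n : nat) (A : 'M[R]_(m, n)) : R :=
  sup [set l2norm (A *m u) | u in [set u : 'cV[R]_n | l2norm u <= 1]].

Definition gradient (R : realType) (n : nat) (h : 'cV[R]_n -> R)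
    (x : 'cV[R]_n) : 'cV[R]_n :=
  \col_(i < n) 'D_(delta_mx i 0) h x.

(* Column-vector counterpart of the library's jacobian, which acts on rows and
   is transposed. *)
Definition col_jacobian (R : realType) (m n : nat)
    (h : 'cV[R]_n -> 'cV[R]_m) (x : 'cV[R]_n) : 'M[R]_(m, n) :=
  \matrix_(i < m, j < n) 'D_(delta_mx j 0) (fun u => h u i 0) x.

Definition grad_x (R : realType) (p q : nat) (h : 'cV[R]_p -> 'cV[R]_q -> R)
    (x : 'cV[R]_p) (y : 'cV[R]_q) : 'cV[R]_p :=
  gradient (fun x' => h x' y) x.

Definition grad_y (R : realType) (p q : nat) (h : 'cV[R]_p -> 'cV[R]_q -> R)
    (x : 'cV[R]_p) (y : 'cV[R]_q) : 'cV[R]_q :=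
  gradient (h x) y.

Definition jac_xy (R : realType) (p q : nat) (h : 'cV[R]_p -> 'cV[R]_q -> R)
    (x : 'cV[R]_p) (y : 'cV[R]_q) : 'M[R]_(p, q) :=
  col_jacobian (grad_x h x) y.

Definition hess_y (R : realType) (p q : nat) (h : 'cV[R]_p -> 'cV[R]_q -> R)
    (x : 'cV[R]_p) (y : 'cV[R]_q) : 'M[R]_q :=
  col_jacobian (grad_y h x) y.

(* h as a function of z = [x; y]. *)
Definition joint (R : realType) (p q : nat) (V : Type)
    (h : 'cV[R]_p -> 'cV[R]_q -> V) (z : 'cV[R]_(p + q)) : V :=
  h (usubmx z) (dsubmx z).

Definition grad (R : realType) (p q : nat) (h : 'cV[R]_p -> 'cV[R]_q -> R)
    (x : 'cV[R]_p) (y : 'cV[R]_q) : 'cV[R]_(p + q) :=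
  gradient (joint h) (col_mx x y).

Definition lipschitz_for (R : realType) (n : nat) (V : zmodType)
    (nrm : V -> R) (k : R) (h : 'cV[R]_n -> V) : Prop :=
  forall z z', nrm (h z - h z') <= k * l2norm (z - z').

Definition strongly_convex (R : realType) (n : nat) (mu : R)
    (h : 'cV[R]_n -> R) : Prop :=
  forall (u v : 'cV[R]_n) (t : R), 0 <= t -> t <= 1 ->
    h (t *: u + (1 - t) *: v)
      <= t * h u + (1 - t) * h v - mu / 2 * t * (1 - t) * l2norm (u - v) ^+ 2.

Record bilevel_problem (R : realType) (p q : nat) := BilevelProblem {
  xi_disp : measure_display;
  xi_space : measurableType xi_disp;
  xi_law : probability xi_space R;
  zeta_disp : measure_display;
  zeta_space : measurableType zeta_disp;
  zeta_law : probability zeta_space R;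
  upper_sample : 'cV[R]_p -> 'cV[R]_q -> xi_space -> R;
  lower_sample : 'cV[R]_p -> 'cV[R]_q -> zeta_space -> R }.

(* F(., .; xi) and G(., .; zeta), with the sample as first argument. *)
Definition F_ (R : realType) (p q : nat) (pb : bilevel_problem R p q)
    (xi : xi_space pb) (x : 'cV[R]_p) (y : 'cV[R]_q) : R :=
  upper_sample x y xi.

Definition G_ (R : realType) (p q : nat) (pb : bilevel_problem R p q)
    (zeta : zeta_space pb) (x : 'cV[R]_p) (y : 'cV[R]_q) : R :=
  lower_sample x y zeta.

Definition f_ (R : realType) (p q : nat) (pb : bilevel_problem R p q)
    (x : 'cV[R]_p) (y : 'cV[R]_q) : R :=
  fine 'E_(xi_law pb)[fun xi => F_ xi x y].

Definition g_ (R : realType) (p q : nat) (pb : bilevel_problem R p q)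
    (x : 'cV[R]_p) (y : 'cV[R]_q) : R :=
  fine 'E_(zeta_law pb)[fun zeta => G_ zeta x y].

(* The expectations defining f and g exist; without this hypothesis fine would
   return a junk value. *)
Definition well_defined (R : realType) (p q : nat)
    (pb : bilevel_problem R p q) : Prop :=
  forall x y,
    (xi_law pb).-integrable setT (EFin \o (fun xi => F_ xi x y)) /\
    (zeta_law pb).-integrable setT (EFin \o (fun zeta => G_ zeta x y)).

(* The default value 0 is never used under strong convexity, where the
   minimizer exists and is unique. *)
Definition ystar (R : realType) (p q : nat) (pb : bilevel_problem R p q)
    (x : 'cV[R]_p) : 'cV[R]_q :=
  xget 0 [set y | forall y', g_ pb x y <= g_ pb x y'].

Definition Phi (R : realType) (p q : nat) (pb : bilevel_problem R p q)
    (x : 'cV[R]_p) : R :=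
  f_ pb x (ystar pb x).

Definition assumption1 (R : realType) (p q : nat)
    (pb : bilevel_problem R p q) (mu : R) : Prop :=
  [/\ forall x, strongly_convex mu (g_ pb x),
      forall (zeta : zeta_space pb) x, strongly_convex mu (G_ zeta x) &
      ~ convex_function (setT : set (convex_lmodType 'cV[R]_p)) (Phi pb)].

Definition upper_regular (R : realType) (p q : nat) (L M : R)
    (h : 'cV[R]_p -> 'cV[R]_q -> R) : Prop :=
  [/\ forall z, differentiable (joint h) z,
      lipschitz_for Num.norm M (joint h) &
      lipschitz_for (@l2norm R (p + q)) L (gradient (joint h))].

(* The third clause is the differentiability in y that jac_xy and hess_y
   presuppose. *)
Definition lower_regular (R : realType) (p q : nat) (L tau rho : R)
    (h : 'cV[R]_p -> 'cV[R]_q -> R) : Prop :=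
  [/\ forall z, differentiable (joint h) z,
      lipschitz_for (@l2norm R (p + q)) L (gradient (joint h)),
      forall x y, differentiable (grad_x h x) y /\
                  differentiable (grad_y h x) y,
      lipschitz_for (@spectral_norm R p q) tau (joint (jac_xy h)) &
      lipschitz_for (@spectral_norm R q q) rho (joint (hess_y h))].

Definition assumption2 (R : realType) (p q : nat)
    (pb : bilevel_problem R p q) (L M tau rho : R) : Prop :=
  [/\ upper_regular L M (f_ pb),
      lower_regular L tau rho (g_ pb),
      forall xi : xi_space pb, upper_regular L M (F_ xi) &
      forall zeta : zeta_space pb, lower_regular L tau rho (G_ zeta)].

Definition unbiased (R : realType) (d : measure_display)
    (S : measurableType d) (Q : probability S R) (m n : nat)
    (H : S -> 'M[R]_(m, n)) (H0 : 'M[R]_(m, n)) : Prop :=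
  forall i j, Q.-integrable setT (EFin \o (fun s => H s i j)) /\
              ('E_Q[fun s => H s i j] = (H0 i j)%:E)%E.

Definition mean_square_le (R : realType) (d : measure_display)
    (S : measurableType d) (Q : probability S R) (V : zmodType)
    (nrm : V -> R) (H : S -> V) (H0 : V) (sigma : R) : Prop :=
  ('E_Q[fun s => (nrm (H s - H0) ^+ 2)%R] <= (sigma ^+ 2)%:E)%E.

Definition assumption3 (R : realType) (p q : nat)
    (pb : bilevel_problem R p q) (sf sg sg1 sg2 : R) : Prop :=
  forall x y,
  [/\ unbiased (xi_law pb) (fun xi => grad (F_ xi) x y) (grad (f_ pb) x y),
      unbiased (zeta_law pb) (fun zeta => grad (G_ zeta) x y)
        (grad (g_ pb) x y),
      unbiased (zeta_law pb) (fun zeta => jac_xy (G_ zeta) x y)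
        (jac_xy (g_ pb) x y) &
      unbiased (zeta_law pb) (fun zeta => hess_y (G_ zeta) x y)
        (hess_y (g_ pb) x y)] /\
  [/\ mean_square_le (xi_law pb) (@l2norm R (p + q))
        (fun xi => grad (F_ xi) x y) (grad (f_ pb) x y) sf,
      mean_square_le (zeta_law pb) (@l2norm R (p + q))
        (fun zeta => grad (G_ zeta) x y) (grad (g_ pb) x y) sg,
      mean_square_le (zeta_law pb) (@spectral_norm R p q)
        (fun zeta => jac_xy (G_ zeta) x y) (jac_xy (g_ pb) x y) sg1 &
      mean_square_le (zeta_law pb) (@spectral_norm R q q)
        (fun zeta => hess_y (G_ zeta) x y) (hess_y (g_ pb) x y) sg2].

(* The algorithm, as a deterministic recursion on given sample sets.  The
   indices are: k for the outer iteration, t and j for the inner steps that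
   compute y^{k+1} and v^{k+1}.  DF_set k and DG_set k are used in h_f^k. *)

Record ssgd_config := SsgdConfig {
  cK : nat; cT : nat; cJ : nat;
  cS : nat; cD : nat; cDg : nat; cDf : nat }.

Definition valid_config (c : ssgd_config) : Prop :=
  [/\ (0 < cK c)%N, (0 < cT c)%N & (0 < cJ c)%N] /\
  [/\ (0 < cS c)%N, (0 < cD c)%N, (0 < cDg c)%N & (0 < cDf c)%N].

Record sample_sets (X Z : Type) := SampleSets {
  DF_set : nat -> seq X;
  DG_set : nat -> seq Z;
  S_set : nat -> nat -> seq Z;
  B_set : nat -> nat -> seq Z;
  DFj_set : nat -> nat -> seq X }.

Definition batch_mean (R : realType) (S : Type) (V : lmodType R)
    (s : seq S) (h : S -> V) : V :=
  (size s)%:R^-1 *: \sum_(a <- s) h a.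

Definition hypergrad (R : realType) (p q : nat) (pb : bilevel_problem R p q)
    (DF : seq (xi_space pb)) (DG : seq (zeta_space pb))
    (x : 'cV[R]_p) (y v : 'cV[R]_q) : 'cV[R]_p :=
  batch_mean DF (fun xi => grad_x (F_ xi) x y)
    - batch_mean DG (fun zeta => jac_xy (G_ zeta) x y) *m v.

Fixpoint y_loop (R : realType) (p q : nat) (pb : bilevel_problem R p q)
    (beta : R) (S : nat -> seq (zeta_space pb)) (x : 'cV[R]_p) (y : 'cV[R]_q)
    (t : nat) : 'cV[R]_q :=
  if t is t'.+1 then
    let yt := y_loop beta S x y t' in
    yt - beta *: batch_mean (S t') (fun zeta => grad_y (G_ zeta) x yt)
  else y.

Fixpoint v_loop (R : realType) (p q : nat) (pb : bilevel_problem R p q)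
    (eta : R) (B : nat -> seq (zeta_space pb)) (DF : nat -> seq (xi_space pb))
    (x : 'cV[R]_p) (y v : 'cV[R]_q) (j : nat) : 'cV[R]_q :=
  if j is j'.+1 then
    let vj := v_loop eta B DF x y v j' in
    (1%:M - eta *: batch_mean (B j') (fun zeta => hess_y (G_ zeta) x y)) *m vj
      + eta *: batch_mean (DF j') (fun xi => grad_y (F_ xi) x y)
  else v.

(* The triple (x^k, y^k, v^k). *)
Fixpoint ssgd (R : realType) (p q : nat) (pb : bilevel_problem R p q)
    (alpha beta eta : R) (T J : nat)
    (D : sample_sets (xi_space pb) (zeta_space pb))
    (x0 : 'cV[R]_p) (y0 v0 : 'cV[R]_q) (k : nat)
    : 'cV[R]_p * 'cV[R]_q * 'cV[R]_q :=
  if k is k'.+1 then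
    let: (x, y, v) := ssgd alpha beta eta T J D x0 y0 v0 k' in
    let x1 := x - alpha *: hypergrad (DF_set D k') (DG_set D k') x y v in
    let y1 := y_loop beta (S_set D k') x1 y T in
    let v1 := v_loop eta (B_set D k') (DFj_set D k') x1 y1 v J in
    (x1, y1, v1)
  else (x0, y0, v0).

(* Number of single-sample oracle calls (partial gradients, Jacobian-vector and
   Hessian-vector products).  The estimate h_f^k is computed for k = 0, ..., K
   and uses Df gradients and Dg Jacobian-vector products; the t-th step of the
   y-loop uses S gradients; the j-th step of the v-loop uses D Hessian-vector
   products and Df gradients. *)
Definition ssgd_cost (c : ssgd_config) : nat :=
  (cDf c + cDg c
   + \sum_(k < cK c) (\sum_(t < cT c) cS c
                      + \sum_(j < cJ c) (cD c + cDf c)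
                      + (cDf c + cDg c)))%N.

(* Random sample sets.  DF_rv k i is the i-th element of D_F at iteration k,
   S_rv k t i the i-th element of S_t in the computation of y^{k+1}, etc. *)

Record ssgd_samples (R : realType) (p q : nat) (pb : bilevel_problem R p q)
    (d : measure_display) (Omega : measurableType d)
    (P : probability Omega R) := SsgdSamples {
  DF_rv : nat -> nat -> {RV P >-> xi_space pb};
  DG_rv : nat -> nat -> {RV P >-> zeta_space pb};
  S_rv : nat -> nat -> nat -> {RV P >-> zeta_space pb};
  B_rv : nat -> nat -> nat -> {RV P >-> zeta_space pb};
  DFj_rv : nat -> nat -> nat -> {RV P >-> xi_space pb} }.

Definition realized_sets (R : realType) (p q : nat)
    (pb : bilevel_problem R p q) (d : measure_display)
    (Omega : measurableType d) (P : probability Omega R) (c : ssgd_config)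
    (X : ssgd_samples pb P) (w : Omega)
    : sample_sets (xi_space pb) (zeta_space pb) :=
  SampleSets
    (fun k => [seq DF_rv X k i w | i <- iota 0 (cDf c)])
    (fun k => [seq DG_rv X k i w | i <- iota 0 (cDg c)])
    (fun k t => [seq S_rv X k t i w | i <- iota 0 (cS c)])
    (fun k j => [seq B_rv X k j i w | i <- iota 0 (cD c)])
    (fun k j => [seq DFj_rv X k j i w | i <- iota 0 (cDf c)]).

Definition ssgd_x (R : realType) (p q : nat) (pb : bilevel_problem R p q)
    (d : measure_display) (Omega : measurableType d)
    (P : probability Omega R) (alpha beta eta : R) (c : ssgd_config)
    (X : ssgd_samples pb P) (x0 : 'cV[R]_p) (y0 v0 : 'cV[R]_q)
    (k : nat) (w : Omega) : 'cV[R]_p :=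
  (ssgd alpha beta eta (cT c) (cJ c) (realized_sets c X w) x0 y0 v0 k).1.1.

Inductive draw :=
  | Draw_DF of nat & nat
  | Draw_DG of nat & nat
  | Draw_S of nat & nat & nat
  | Draw_B of nat & nat & nat
  | Draw_DFj of nat & nat & nat.

Definition performed (c : ssgd_config) (a : draw) : Prop :=
  match a with
  | Draw_DF k i => (k <= cK c)%N /\ (i < cDf c)%N
  | Draw_DG k i => (k <= cK c)%N /\ (i < cDg c)%N
  | Draw_S k t i => [/\ (k < cK c)%N, (t < cT c)%N & (i < cS c)%N]
  | Draw_B k j i => [/\ (k < cK c)%N, (j < cJ c)%N & (i < cD c)%N]
  | Draw_DFj k j i => [/\ (k < cK c)%N, (j < cJ c)%N & (i < cDf c)%N]
  end.

Definition events_of (d d' : measure_display) (Omega : measurableType d)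
    (S : measurableType d') (X : Omega -> S) : set (set Omega) :=
  preimage_set_system setT X measurable.

Definition draw_events (R : realType) (p q : nat)
    (pb : bilevel_problem R p q) (d : measure_display)
    (Omega : measurableType d) (P : probability Omega R)
    (X : ssgd_samples pb P) (a : draw) : set (set Omega) :=
  match a with
  | Draw_DF k i => events_of (DF_rv X k i)
  | Draw_DG k i => events_of (DG_rv X k i)
  | Draw_S k t i => events_of (S_rv X k t i)
  | Draw_B k j i => events_of (B_rv X k j i)
  | Draw_DFj k j i => events_of (DFj_rv X k j i)
  end.

Definition has_law (R : realType) (d d' : measure_display)
    (Omega : measurableType d) (S : measurableType d')
    (P : probability Omega R) (X : {RV P >-> S}) (Q : probability S R) : Prop :=
  forall B, measurable B -> distribution P X B = Q B.

Definition draw_law (R : realType) (p q : nat)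
    (pb : bilevel_problem R p q) (d : measure_display)
    (Omega : measurableType d) (P : probability Omega R)
    (X : ssgd_samples pb P) (a : draw) : Prop :=
  match a with
  | Draw_DF k i => has_law (DF_rv X k i) (xi_law pb)
  | Draw_DG k i => has_law (DG_rv X k i) (zeta_law pb)
  | Draw_S k t i => has_law (S_rv X k t i) (zeta_law pb)
  | Draw_B k j i => has_law (B_rv X k j i) (zeta_law pb)
  | Draw_DFj k j i => has_law (DFj_rv X k j i) (xi_law pb)
  end.

Definition mutually_independent (R : realType) (d : measure_display)
    (Omega : measurableType d) (P : probability Omega R) (I : Type)
    (A : set I) (E : I -> set (set Omega)) : Prop :=
  forall (n : nat) (a : 'I_n -> I), injective a -> (forall i, A (a i)) ->
  forall B : 'I_n -> set Omega, (forall i, E (a i) (B i)) ->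
    P (\big[setI/setT]_(i < n) B i) = (\prod_(i < n) P (B i))%E.

Definition fresh_sampling (R : realType) (p q : nat)
    (pb : bilevel_problem R p q) (d : measure_display)
    (Omega : measurableType d) (P : probability Omega R) (c : ssgd_config)
    (X : ssgd_samples pb P) : Prop :=
  (forall a, performed c a -> draw_law X a) /\
  mutually_independent P (performed c) (draw_events X).

Definition uniform_index (R : realType) (p q : nat)
    (pb : bilevel_problem R p q) (d : measure_display)
    (Omega : measurableType d) (P : probability Omega R) (c : ssgd_config)
    (X : ssgd_samples pb P) (out : {RV P >-> nat}) : Prop :=
  (forall k, (k < cK c)%N -> P (out @^-1` [set k]) = ((cK c)%:R^-1)%:E) /\
  (forall A B, <<s \bigcup_(a in performed c) draw_events X a >> A ->
     events_of out B -> P (A `&` B) = (P A * P B)%E).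

Definition stationary (R : realType) (n : nat) (d : measure_display)
    (Omega : measurableType d) (P : probability Omega R) (eps : R)
    (h : 'cV[R]_n -> R) (xbar : Omega -> 'cV[R]_n) : Prop :=
  ('E_P[fun w => (l2norm (gradient h (xbar w)) ^+ 2)%R] <= eps%:E)%E.

Definition kappa (R : realType) (mu L : R) : R := L / mu.
Definition eta_ (R : realType) (L : R) : R := 1 / (2 * L).
Definition beta_ (R : realType) (mu L : R) : R := 3 / (2 * (L + mu)).
Definition rho_y (R : realType) (mu L : R) : R :=
  2 * beta_ mu L * mu * L / (mu + L).
Definition r_v (R : realType) (mu L : R) : R :=
  2 * mu * L / (L ^+ 2 + mu ^+ 2).
Definition r_w (R : realType) (mu L : R) : R :=
  eta_ L * mu / (7 * (2 - eta_ L * mu)).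
Definition C1 (R : realType) (mu L M rho : R) : R :=
  M * rho / mu ^+ 2 + L / mu.
Definition C22 (R : realType) (mu L M rho : R) : R :=
  (1 + 1 / r_w mu L) * (2 + 8 * L ^+ 2 / mu ^+ 2) * C1 mu L M rho ^+ 2.
Definition C23 (R : realType) (mu L M rho : R) : R :=
  (1 + 1 / r_w mu L) * (5 + r_w mu L) * C1 mu L M rho ^+ 2.
Definition C24 (R : realType) (mu L M rho : R) : R :=
  (1 + 1 / r_w mu L) * (9 + 8 * r_w mu L) * C1 mu L M rho ^+ 2.
Definition rho1 (R : realType) (mu L M rho rho2 : R) : R :=
  2 * rho2 * ((1 + r_w mu L) * C23 mu L M rho + 2 * C24 mu L M rho)
    / (rho_y mu L * (1 + r_v mu L) - r_v mu L).
Definition Cbar1 (R : realType) (mu L M tau : R) : R := L + M * tau / mu.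
Definition L_Phi (R : realType) (mu L M tau rho : R) : R :=
  L + (2 * L ^+ 2 + tau * M ^+ 2) / mu
    + (rho * L * M + L ^+ 3 + tau * M * L) / mu ^+ 2
    + rho * L ^+ 2 * M / mu ^+ 3.
Definition L31 (R : realType) (mu L M tau rho rho2 : R) : R :=
  L_Phi mu L M tau rho / 2
    + 2 * ((rho1 mu L M rho rho2 + C24 mu L M rho * rho2)
             * (2 / r_v mu L) * (L ^+ 2 / mu ^+ 2)
           + (1 + r_w mu L) * C22 mu L M rho * rho2).
Definition alpha_ (R : realType) (mu L M tau rho rho2 : R) : R :=
  Num.min (1 / (2 * L31 mu L M tau rho rho2))
    (Num.min (1 / (4 * L ^+ 2) * rho2 * eta_ L * mu)
       (((1 + r_w mu L) * C23 mu L M rho + 2 * C24 mu L M rho)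
          * (rho2 / Cbar1 mu L M tau ^+ 2))).

(* Main.v *)
Require Import Defs.
From HB Require Import structures.
From mathcomp Require Import all_boot all_order all_algebra.
From mathcomp Require Import all_classical all_reals all_analysis.
From mathcomp Require Import measurable_realfun.
From mathcomp Require Import ring lra zify.

Set Implicit Arguments.
Unset Strict Implicit.
Unset Printing Implicit Defensive.

Import Order.TTheory GRing.Theory Num.Theory.
Import numFieldNormedType.Exports.

Local Open Scope classical_set_scope.
Local Open Scope ring_scope.

(** Why the theorem is true.

    Write y_star x for the lower-level solution and v_star x for the solution of
    the linear system (Hessian of g in y) v = (gradient of f in y), both at
    (x, y_star x). Testing the stationarity of y_star against v_star shows that
    Phi has the gradient (gradient of f in x) - (Jacobian of g) v_star, with a
    quadratic error of order kappa^3 (hyper_expansion). The estimate h_f^k is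
    this formula evaluated on a batch at (x^k, y^k, v^k), so its error is
    controlled by the tracking errors D = |y^k - y_star x^k|^2 and
    e = |v^k - v_star x^k|^2 and by the noise of the batch (hypergrad_error).

    The inner loops contract these errors. A gradient step on a smooth strongly
    convex function contracts distances (gradient_step_contraction, by
    cocoercivity), and so does a step on the linear system, since a Hessian is a
    limit of increments of the gradient (hess_y_contraction). Sampled steps
    contract as well; in particular v^k stays in the ball of radius M / mu for
    every realization of the samples (vk_le). The displacement of y_star and
    v_star caused by a step in x costs a multiple of alpha^2 |h_f^k|^2. A
    Lyapunov function Phi + alpha (w_y D + w_v e) therefore decreases up to
    squared noise, once alpha is so small that the quadratic terms are absorbed by
    alpha |h_f^k|^2 / 2 (lyapunov_step, run_bound); the prescribed minimum
    guarantees this (stepsize_condition). Noise is separated from errors by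
    convexity of the square and by Young's inequality, never by the vanishing of
    a cross term, so that all this holds for each realization.

    It remains to average squares of batch noises. A batch is independent of the
    draws that determine the point where it is evaluated: disjoint groups of
    draws generate independent sigma-algebras (draws_independent), so the batch
    may be integrated first, at a fixed point (integral_independent), where the
    mean of n independent samples has the n-th part of the variance of one
    (batch_variance). Integrating over the iterates requires that they be
    measurable functions of the draws, which holds because every sampled
    derivative is measurable in the sample and Lipschitz in the point
    (measurable_caratheodory). Since the output index is independent of all the
    draws, it averages the iterates (mean_at_random_index).

    Finally, 1 / alpha and w_y are of order kappa^5, the noise of the y-loop has a
    weight of order kappa^4 / mu^2, and the other noises have weights of order at
    most kappa^4 (inv_alpha_le, weight_y_le, noise_bound). Choosing K and the batch
    sizes so that each of the five terms of the rate is at most eps / 5 gives the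
    complexity: the dominant cost is that of K max(T, J) batches of size at most
    kappa^8 / eps. *)

(** * Euclidean geometry of column vectors *)

Section Euclidean.
Variable R : realType.
Implicit Types n m : nat.

Definition dot n (u v : 'cV[R]_n) : R := \sum_(i < n) u i 0 * v i 0.

Lemma dotC n (u v : 'cV[R]_n) : dot u v = dot v u.
Proof. by apply: eq_bigr => i _; rewrite mulrC. Qed.

Lemma dotDl n (u v w : 'cV[R]_n) : dot (u + v) w = dot u w + dot v w.
Proof. by rewrite -big_split; apply: eq_bigr => i _; rewrite mxE mulrDl. Qed.

Lemma dotZl n a (u v : 'cV[R]_n) : dot (a *: u) v = a * dot u v.
Proof. by rewrite mulr_sumr; apply: eq_bigr => i _; rewrite mxE mulrA. Qed.

Lemma dotNl n (u v : 'cV[R]_n) : dot (- u) v = - dot u v.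
Proof. by rewrite -scaleN1r dotZl mulN1r. Qed.

Lemma dotBl n (u v w : 'cV[R]_n) : dot (u - v) w = dot u w - dot v w.
Proof. by rewrite dotDl dotNl. Qed.

Lemma dotDr n (u v w : 'cV[R]_n) : dot w (u + v) = dot w u + dot w v.
Proof. by rewrite !(dotC w) dotDl. Qed.

Lemma dotZr n a (u v : 'cV[R]_n) : dot u (a *: v) = a * dot u v.
Proof. by rewrite !(dotC u) dotZl. Qed.

Lemma dotNr n (u v : 'cV[R]_n) : dot u (- v) = - dot u v.
Proof. by rewrite !(dotC u) dotNl. Qed.

Lemma dotBr n (u v w : 'cV[R]_n) : dot w (u - v) = dot w u - dot w v.
Proof. by rewrite !(dotC w) dotBl. Qed.

Lemma dot0l n (u : 'cV[R]_n) : dot 0 u = 0.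
Proof. by rewrite -(scale0r u) dotZl mul0r. Qed.

Lemma dot0r n (u : 'cV[R]_n) : dot u 0 = 0.
Proof. by rewrite dotC dot0l. Qed.

Definition dotE := (dotDl, dotDr, dotBl, dotBr, dotNl, dotNr, dotZl, dotZr).

Lemma dot_ge0 n (u : 'cV[R]_n) : 0 <= dot u u.
Proof. by apply: sumr_ge0 => i _; rewrite -expr2 sqr_ge0. Qed.

Lemma l2norm_ge0 n (u : 'cV[R]_n) : 0 <= l2norm u.
Proof. exact: sqrtr_ge0. Qed.

Lemma l2norm_sqr n (u : 'cV[R]_n) : l2norm u ^+ 2 = dot u u.
Proof.
rewrite sqr_sqrtr; last by apply: sumr_ge0 => i _; exact: sqr_ge0.
by apply: eq_bigr => i _; rewrite expr2.
Qed.

Lemma l2norm_le n (u : 'cV[R]_n) c : 0 <= c -> (l2norm u <= c) = (dot u u <= c ^+ 2).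
Proof. by move=> c0; rewrite -l2norm_sqr ler_sqr ?nnegrE ?l2norm_ge0. Qed.

Lemma l2norm0 n : l2norm (0 : 'cV[R]_n) = 0.
Proof.
by rewrite /l2norm big1 ?sqrtr0// => i _; rewrite mxE expr0n.
Qed.

Lemma l2norm0_eq0 n (u : 'cV[R]_n) : l2norm u = 0 -> u = 0.
Proof.
move=> u0; have := l2norm_sqr u; rewrite u0 expr0n /= => /esym/eqP.
rewrite psumr_eq0 => [/allP u00|i _]; last by rewrite -expr2 sqr_ge0.
apply/matrixP => i j; rewrite ord1 mxE.
by have := u00 i (mem_index_enum _); rewrite -expr2 sqrf_eq0 => /eqP.
Qed.

Lemma l2normZ n a (u : 'cV[R]_n) : l2norm (a *: u) = `|a| * l2norm u.
Proof.
apply/eqP; rewrite -(@eqrXn2 _ 2)// ?mulr_ge0 ?l2norm_ge0//.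
by rewrite exprMn !l2norm_sqr !dotE real_normK ?num_real// mulrA.
Qed.

Lemma l2normN n (u : 'cV[R]_n) : l2norm (- u) = l2norm u.
Proof. by rewrite -scaleN1r l2normZ normrN normr1 mul1r. Qed.

Lemma l2normBC n (u v : 'cV[R]_n) : l2norm (u - v) = l2norm (v - u).
Proof. by rewrite -opprB l2normN. Qed.

Lemma cauchy_schwarz n (u v : 'cV[R]_n) : dot u v <= l2norm u * l2norm v.
Proof.
have [v0|v0] := eqVneq (l2norm v) 0.
  by rewrite v0 (l2norm0_eq0 v0) dot0r mulr0.
have vgt0 : 0 < l2norm v by rewrite lt_def v0 l2norm_ge0.
have [|uv0] := lerP (dot u v) 0.
  by move/le_trans; apply; rewrite mulr_ge0 ?l2norm_ge0.
rewrite -ler_sqr ?nnegrE ?mulr_ge0 ?l2norm_ge0 ?(ltW uv0)// exprMn !l2norm_sqr.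
have := dot_ge0 (dot v v *: u - dot u v *: v); rewrite !dotE (dotC v u).
have : 0 < dot v v by rewrite -l2norm_sqr exprn_gt0.
move: (dot u u) (dot v v) (dot u v) => a b c b0 h.
have : 0 <= b * (a * b - c ^+ 2) by apply: le_trans h _; rewrite le_eqVlt; apply/orP; left; apply/eqP; ring.
by rewrite pmulr_rge0// subr_ge0.
Qed.

Lemma dot_norm_le n (u v : 'cV[R]_n) : `|dot u v| <= l2norm u * l2norm v.
Proof.
rewrite ler_norml cauchy_schwarz andbT lerNl -dotNl.
by rewrite -[l2norm u]l2normN cauchy_schwarz.
Qed.

Lemma l2normD n (u v : 'cV[R]_n) : l2norm (u + v) <= l2norm u + l2norm v.
Proof.
rewrite l2norm_le ?addr_ge0 ?l2norm_ge0// !dotE (dotC v u) sqrrD !l2norm_sqr.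
have := cauchy_schwarz u v; lra.
Qed.

Lemma l2normB n (u v : 'cV[R]_n) : l2norm (u - v) <= l2norm u + l2norm v.
Proof. by rewrite -(l2normN v) l2normD. Qed.

Lemma l2norm_sum n (I : Type) (s : seq I) (h : I -> 'cV[R]_n) :
  l2norm (\sum_(i <- s) h i) <= \sum_(i <- s) l2norm (h i).
Proof.
elim: s => [|a s IH]; first by rewrite !big_nil l2norm0.
by rewrite !big_cons (le_trans (l2normD _ _))// lerD2l.
Qed.

(** Duality: a vector is bounded as soon as it is tested against all directions. *)
Lemma l2norm_dual n (u : 'cV[R]_n) c :
  0 <= c -> (forall k, dot u k <= c * l2norm k) -> l2norm u <= c.
Proof.
move=> c0 /(_ u); rewrite -l2norm_sqr expr2.
have := l2norm_ge0 u; rewrite le_eqVlt => /predU1P[<-//|u0].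
by rewrite ler_pM2r.
Qed.

Lemma coord_le_l2norm n (u : 'cV[R]_n) i : `|u i 0| <= l2norm u.
Proof.
rewrite -ler_sqr ?nnegrE ?l2norm_ge0// real_normK ?num_real// l2norm_sqr.
rewrite /dot (bigD1 i)//= -expr2 lerDl.
by apply: sumr_ge0 => j _; rewrite -expr2 sqr_ge0.
Qed.

Lemma dot_delta n (u : 'cV[R]_n) i : dot u (delta_mx i 0) = u i 0.
Proof.
rewrite /dot (bigD1 i)//= big1 ?addr0 => [|j ji]; last first.
  by rewrite mxE (negPf ji) mulr0.
by rewrite mxE !eqxx mulr1.
Qed.

Lemma l2norm_delta n (i : 'I_n) : l2norm (delta_mx i 0 : 'cV[R]_n) = 1.
Proof.
by apply/eqP; rewrite -(@eqrXn2 _ 2)// ?l2norm_ge0// l2norm_sqr dot_delta mxE !eqxx expr1n.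
Qed.

Lemma l2norm_le_sum n (u : 'cV[R]_n) : l2norm u <= \sum_i `|u i 0|.
Proof.
have {1}-> : u = \sum_i u i 0 *: delta_mx i 0.
  by rewrite {1}(matrix_sum_delta u); apply: eq_bigr => i _; rewrite big_ord1.
rewrite (le_trans (l2norm_sum _ _))// ler_sum// => i _.
by rewrite l2normZ l2norm_delta mulr1.
Qed.

Lemma dot_col_mx n m (u u' : 'cV[R]_n) (v v' : 'cV[R]_m) :
  dot (col_mx u v) (col_mx u' v') = dot u u' + dot v v'.
Proof.
by rewrite /dot big_split_ord; congr (_ + _); apply: eq_bigr => i _;
  rewrite !(col_mxEu, col_mxEd).
Qed.

Lemma l2norm_col_mx_sqr n m (u : 'cV[R]_n) (v : 'cV[R]_m) :
  l2norm (col_mx u v) ^+ 2 = l2norm u ^+ 2 + l2norm v ^+ 2.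
Proof. by rewrite !l2norm_sqr dot_col_mx. Qed.

Lemma l2norm_col_mx0 n m (u : 'cV[R]_n) :
  l2norm (col_mx u (0 : 'cV[R]_m)) = l2norm u.
Proof.
by apply/eqP; rewrite -(@eqrXn2 _ 2)// ?l2norm_ge0// l2norm_col_mx_sqr l2norm0 expr0n addr0.
Qed.

Lemma l2norm_0col_mx n m (v : 'cV[R]_m) :
  l2norm (col_mx (0 : 'cV[R]_n) v) = l2norm v.
Proof.
by apply/eqP; rewrite -(@eqrXn2 _ 2)// ?l2norm_ge0// l2norm_col_mx_sqr l2norm0 expr0n add0r.
Qed.

Lemma l2norm_usubmx n m (u : 'cV[R]_(n + m)) : l2norm (usubmx u) <= l2norm u.
Proof.
rewrite -ler_sqr ?nnegrE ?l2norm_ge0// -{2}(vsubmxK u) l2norm_col_mx_sqr.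
by rewrite lerDl sqr_ge0.
Qed.

Lemma l2norm_dsubmx n m (u : 'cV[R]_(n + m)) : l2norm (dsubmx u) <= l2norm u.
Proof.
rewrite -ler_sqr ?nnegrE ?l2norm_ge0// -{2}(vsubmxK u) l2norm_col_mx_sqr.
by rewrite lerDr sqr_ge0.
Qed.

Lemma mulmx_l2norm_bounded n m (A : 'M[R]_(m, n)) :
  exists2 c, 0 <= c & forall u, l2norm (A *m u) <= c * l2norm u.
Proof.
exists (\sum_i \sum_j `|A i j|) => [|u].
  by apply: sumr_ge0 => i _; apply: sumr_ge0.
rewrite (le_trans (l2norm_le_sum _))// mulr_suml ler_sum// => i _.
rewrite mxE (le_trans (ler_norm_sum _ _ _))// mulr_suml ler_sum// => j _.
by rewrite normrM ler_wpM2l// coord_le_l2norm.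
Qed.

Lemma spectral_norm_le n m (A : 'M[R]_(m, n)) u :
  l2norm (A *m u) <= spectral_norm A * l2norm u.
Proof.
have [c c0 Ac] := mulmx_l2norm_bounded A.
have ub : has_sup [set l2norm (A *m u) | u in [set u : 'cV[R]_n | l2norm u <= 1]].
  split; first by exists (l2norm (A *m 0)); exists 0 => //=; rewrite l2norm0.
  exists c => _ [v /= v1 <-]; rewrite (le_trans (Ac _))//.
  by rewrite -[leRHS]mulr1 ler_wpM2l.
have [u0|u0] := eqVneq (l2norm u) 0.
  by rewrite u0 mulr0 (l2norm0_eq0 u0) mulmx0 l2norm0.
have ugt0 : 0 < l2norm u by rewrite lt_def u0 l2norm_ge0.
rewrite -ler_pdivrMr//.
apply: (@sup_upper_bound _ _ ub); exists ((l2norm u)^-1 *: u) => /=.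
  by rewrite l2normZ ger0_norm ?invr_ge0 ?l2norm_ge0// mulVf.
by rewrite -scalemxAr l2normZ ger0_norm ?invr_ge0 ?l2norm_ge0// mulrC.
Qed.

Lemma spectral_norm_ge0 n m (A : 'M[R]_(m, n)) : 0 <= spectral_norm A.
Proof.
have [c c0 Ac] := mulmx_l2norm_bounded A.
apply: (@sup_upper_bound _ [set l2norm (A *m u) | u in [set u : 'cV[R]_n | l2norm u <= 1]]).
  split; first by exists (l2norm (A *m 0)); exists 0 => //=; rewrite l2norm0.
  exists c => _ [v /= v1 <-]; rewrite (le_trans (Ac _))//.
  by rewrite -[leRHS]mulr1 ler_wpM2l.
by exists 0 => //=; rewrite ?mulmx0 l2norm0.
Qed.

(** The form in which a bound up to a first-order error passes to the limit. *)
Lemma le_of_linear_slack (a b c : R) :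
  (forall t, 0 < t -> t <= 1 -> a <= b + t * c) -> a <= b.
Proof.
move=> h; rewrite leNgt; apply/negP => ba.
have [c0|c0] := lerP c 0.
  have := h 1 ltr01 (lexx _); rewrite mul1r => h1.
  lra.
pose t := Num.min 1 ((a - b) / (2 * c)).
have t0 : 0 < t by rewrite lt_min ltr01 divr_gt0 ?subr_gt0 ?mulr_gt0.
have t1 : t <= 1 by rewrite ge_min lexx.
have := h t t0 t1; apply/negP; rewrite -ltNge.
have : t * c <= (a - b) / 2.
  rewrite -ler_pdivlMr// ge_min; apply/orP; right.
  by rewrite invfM mulrA.
lra.
Qed.

End Euclidean.

Lemma addrKC (V : zmodType) (x y : V) : x + y - x = y.
Proof. by rewrite addrC addKr. Qed.

(** * First-order calculus along segments *)

Section Segments.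
Variable R : realType.

Lemma derive_gradient n (phi : 'cV[R]_n -> R) a v :
  differentiable phi a -> 'D_v phi a = dot (gradient phi a) v.
Proof.
move=> da; rewrite deriveE// {1}(matrix_sum_delta v).
under eq_bigr do rewrite big_ord1.
rewrite linear_sum; apply: eq_bigr => i _.
by rewrite linearZ/= mxE deriveE// mulrC.
Qed.

(** Derivability in all directions with a linear dependence on the direction is
    enough for mean value arguments along segments; unlike Frechet
    differentiability, it passes to partial functions without any continuity
    consideration. *)
Definition has_gradient n (phi : 'cV[R]_n -> R) :=
  forall z v, is_derive z v phi (dot (gradient phi z) v).

Lemma differentiable_has_gradient n (phi : 'cV[R]_n -> R) :
  (forall z, differentiable phi z) -> has_gradient phi.
Proof.
move=> dphi z v; apply: DeriveDef; first exact: diff_derivable.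
exact: derive_gradient.
Qed.

(** A directional derivative only sees the restriction to a line. *)
Lemma is_derive_recenter (V W : normedModType R) (f : V -> R) (g : W -> R)
    (a v : V) (b w : W) l :
  (forall h : R, f (h *: v + a) = g (h *: w + b)) -> f a = g b ->
  is_derive a v f l -> is_derive b w g l.
Proof.
move=> fg fgab [df Df].
have E : (fun h : R => h^-1 *: ((f \o shift a) (h *: v) - f a)) =
         (fun h : R => h^-1 *: ((g \o shift b) (h *: w) - g b)).
  by apply/funext => h /=; rewrite fg fgab.
split; first by move: df; rewrite /derivable E.
by move: Df; rewrite /derive E.
Qed.

Lemma derive_recenter (V W : normedModType R) (f : V -> R) (g : W -> R)
    (a v : V) (b w : W) :
  (forall h : R, f (h *: v + a) = g (h *: w + b)) -> f a = g b ->
  'D_v f a = 'D_w g b.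
Proof.
move=> fg fgab; rewrite /derive.
rewrite (_ : (fun h : R => h^-1 *: ((f \o shift a) (h *: v) - f a)) =
         (fun h : R => h^-1 *: ((g \o shift b) (h *: w) - g b)))//.
by apply/funext => h /=; rewrite fg fgab.
Qed.

Lemma is_derive_line n (phi : 'cV[R]_n -> R) a v (t l : R) :
  is_derive (a + t *: v) v phi l ->
  is_derive t 1 (fun s : R => phi (a + s *: v)) l.
Proof.
apply: is_derive_recenter => // h.
by rewrite [h *: 1]mulr1 scalerDl addrCA addrA.
Qed.

Lemma mvt01 (g g' : R -> R) : (forall t : R, is_derive t 1 g (g' t)) ->
  exists2 t, 0 < t < 1 & g 1 - g 0 = g' t.
Proof.
move=> dg.
have cg : {within `[0, 1], continuous g}.
  by apply: derivable_within_continuous => x _; apply: ex_derive; exact: dg.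
have [t] := @MVT R g g' 0 1 ltr01 (fun x _ => dg x) cg.
by rewrite in_itv/= subr0 mulr1 => t01 ->; exists t.
Qed.

Lemma increment_le (g g' : R -> R) (c b : R) : (forall t : R, is_derive t 1 g (g' t)) ->
  (forall t, 0 < t < 1 -> g' t <= c + b * t) -> g 1 - g 0 <= c + b / 2.
Proof.
move=> dg hg; pose k (t : R) : R := g t - (c * t + b / 2 * t ^+ 2).
have dk (t : R) : is_derive t 1 k (g' t - (c + b * t)).
  apply: is_deriveB; apply: is_derive_eq.
  by rewrite /GRing.scale/=; field.
have [t t01] := mvt01 dk; have := hg t t01; rewrite /k; lra.
Qed.

(** The coefficient is halved with respect to the Lipschitz constant, as in
    Taylor's formula with integral remainder. *)
Lemma taylor_gradient n (phi : 'cV[R]_n -> R) (l : R) :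
  has_gradient phi ->
  lipschitz_for (@l2norm R n) l (gradient phi) ->
  forall u v, `|phi v - phi u - dot (gradient phi u) (v - u)|
              <= l / 2 * l2norm (v - u) ^+ 2.
Proof.
move=> dphi lip u v.
have dl (t : R) := is_derive_line (dphi (u + t *: (v - u)) (v - u)).
have hb t : 0 < t < 1 -> `|dot (gradient phi (u + t *: (v - u)) - gradient phi u) (v - u)|
      <= l * l2norm (v - u) ^+ 2 * t.
  move=> /andP[t0 _]; rewrite (le_trans (dot_norm_le _ _))//.
  have := lip (u + t *: (v - u)) u; rewrite addrKC l2normZ gtr0_norm// => h.
  have := ler_wpM2r (l2norm_ge0 (v - u)) h; lra.
have E1 : u + 1 *: (v - u) = v by rewrite scale1r addrC subrK.
have E0 : u + 0 *: (v - u) = u by rewrite scale0r addr0.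
rewrite ler_norml; apply/andP; split.
- have dN (t : R) := is_deriveN (dl t).
  have := @increment_le _ _ (- dot (gradient phi u) (v - u)) (l * l2norm (v - u) ^+ 2) dN.
  rewrite -![(- _) _]/(- _) E1 E0 => h.
  have {}h := h _; move: h.
  rewrite (_ : - phi v - - phi u = phi u - phi v) => [h|]; last by ring.
  have : phi u - phi v <= - dot (gradient phi u) (v - u) + l * l2norm (v - u) ^+ 2 / 2.
    apply: h => t t01; have := hb t t01; rewrite dotBl ler_norml => /andP[]; lra.
  lra.
- have := @increment_le _ _ (dot (gradient phi u) (v - u)) (l * l2norm (v - u) ^+ 2) dl.
  rewrite E1 E0 => h.
  have : phi v - phi u <= dot (gradient phi u) (v - u) + l * l2norm (v - u) ^+ 2 / 2.
    apply: h => t t01; have := hb t t01; rewrite dotBl ler_norml => /andP[]; lra.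
  lra.
Qed.

End Segments.

(** * Smooth strongly convex functions *)

Section StronglyConvex.
Variables (R : realType) (n : nat) (phi : 'cV[R]_n -> R) (mu l : R).
Hypothesis mu_gt0 : 0 < mu.
Hypothesis dphi : has_gradient phi.
Hypothesis lip : lipschitz_for (@l2norm R n) l (gradient phi).
Hypothesis sc : strongly_convex mu phi.
Let G := gradient phi.

(** Divide the convexity inequality on the segment by its parameter and let the
    parameter vanish. *)
Lemma strongly_convex_tangent u v :
  phi u + dot (G u) (v - u) + mu / 2 * l2norm (v - u) ^+ 2 <= phi v.
Proof.
pose d2 := l2norm (v - u) ^+ 2.
suff : dot (G u) (v - u) <= phi v - phi u - mu / 2 * d2 by rewrite -/d2; lra.
apply: (@le_of_linear_slack R _ _ ((l + mu) / 2 * d2)) => t t0 t1.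
have := sc v u (ltW t0) t1; rewrite -/d2.
rewrite (_ : t *: v + _ = u + t *: (v - u)); last first.
  by rewrite scalerBr scalerBl scale1r [LHS]addrC addrAC -addrA.
have := taylor_gradient dphi lip u (u + t *: (v - u)).
rewrite addrKC dotZr l2normZ exprMn -/d2 -/G real_normK ?num_real// => /ler_normlP[h _] h'.
have : t * dot (G u) (v - u) <= t * (phi v - phi u - mu / 2 * d2 + t * ((l + mu) / 2 * d2)).
  move: h h'; move: (phi (u + _)) (phi u) (phi v) (dot _ _) => X a b D. lra.
by rewrite ler_pM2l.
Qed.

(** Baillon-Haddad for phi - mu/2 |.|^2, which is convex and (l - mu)-smooth:
    comparing the tangent at one point with the quadratic upper model at the
    other one, at the distance s along the difference d of the gradients, gives a
    bound for every s; the best s is 1/(l - mu). *)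
Lemma gradient_cocoercive u v :
  mu * l * l2norm (v - u) ^+ 2 + l2norm (G v - G u) ^+ 2
    <= (mu + l) * dot (v - u) (G v - G u).
Proof.
pose d := G v - G u - mu *: (v - u).
have key (a b : 'cV[R]_n) s : let e := G b - G a - mu *: (b - a) in
    phi a + dot (G a) (b - a) + mu / 2 * l2norm (b - a) ^+ 2
      + s * l2norm e ^+ 2 - (l - mu) / 2 * s ^+ 2 * l2norm e ^+ 2 <= phi b.
  move=> e; have eE : e = G b - G a - mu *: (b - a) by [].
  clearbody e; pose w := b - s *: e.
  have h1 := strongly_convex_tangent a w.
  have /ler_normlP[_ h2] := taylor_gradient dphi lip b w.
  rewrite -/G in h2.
  have E1 : w - a = (b - a) - s *: e by rewrite /w addrAC.
  have E2 : w - b = - (s *: e) by rewrite /w addrC addKr.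
  have GbE : dot (G b) e = dot (G a) e + mu * dot (b - a) e + dot e e.
    have -> : G b = G a + mu *: (b - a) + e by apply/matrixP => i j; rewrite eE !mxE; ring.
    by rewrite dotDl dotDl dotZl.
  move: h1 h2; rewrite E1 E2 !l2norm_sqr !dotE GbE (dotC e b) (dotC e a).
  rewrite !dotE; lra.
have h1 s := key u v s; have h2 s := key v u s.
have dN : G u - G v - mu *: (u - v) = - d by rewrite /d !scalerBr; apply/matrixP => i j; rewrite !mxE; ring.
have {h2} : forall s, (2 * s - (l - mu) * s ^+ 2) * dot d d <= dot (v - u) d.
  move=> s; have := h1 s; have := h2 s; rewrite /= -/d dN l2normN.
  rewrite (l2normBC u v) !l2norm_sqr -!l2norm_sqr.
  have -> : dot (v - u) d = dot (G v) (v - u) - dot (G u) (v - u) - mu * l2norm (v - u) ^+ 2.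
    by rewrite /d 2!dotBr dotZr l2norm_sqr (dotC _ (G v)) (dotC _ (G u)).
  have -> : dot (G v) (u - v) = - dot (G v) (v - u) by rewrite -dotNr opprB.
  lra.
move=> {h1} h.
have {h} : dot d d <= (l - mu) * dot (v - u) d.
  have [lm|lm] := lerP (l - mu) 0.
    have [d0|d0] := eqVneq (dot d d) 0.
      have -> : d = 0 by apply: l2norm0_eq0; apply/eqP; rewrite -sqrf_eq0 l2norm_sqr d0.
      by rewrite !dot0r mulr0.
    have dgt0 : 0 < dot d d by rewrite lt_def d0 dot_ge0.
    pose s := (dot (v - u) d + 1) / (2 * dot d d).
    have P0 : 0 <= dot (v - u) d by have := h 0; rewrite expr0n/= mulr0 mulr0 subrr mul0r.
    have s0 : 0 <= s by rewrite divr_ge0 ?mulr_ge0 ?addr_ge0// ltW.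
    have sE : 2 * s * dot d d = dot (v - u) d + 1.
      by rewrite /s; field.
    have := h s; have : 0 <= - (l - mu) * s ^+ 2 * dot d d.
      by rewrite mulr_ge0 ?dot_ge0// mulr_ge0 ?sqr_ge0// oppr_ge0.
    lra.
  have := h (l - mu)^-1.
  rewrite (_ : 2 * _ - _ = (l - mu)^-1); last first.
    by field; rewrite gt_eqF.
  by rewrite mulrC ler_pdivrMr// mulrC.
rewrite /d; move: (v - u) (G v - G u) => w g.
rewrite !l2norm_sqr !dotE (dotC g w); lra.
Qed.

Lemma strongly_convex_monotone u v :
  mu * l2norm (v - u) ^+ 2 <= dot (v - u) (G v - G u).
Proof.
have := strongly_convex_tangent u v; have := strongly_convex_tangent v u.
rewrite (l2normBC u) -(opprB v u) dotNr dotBr !(dotC (v - u)); lra.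
Qed.

(** The expansion of the square is affine in the inner product, with a negative
    coefficient for such steps, so that cocoercivity and then strong monotonicity
    give a perfect square. *)
Lemma gradient_step_contraction t u v : 0 <= t -> t <= 2 / (mu + l) -> 0 < l -> t * mu <= 1 ->
  l2norm ((v - t *: G v) - (u - t *: G u)) <= (1 - t * mu) * l2norm (v - u).
Proof.
move=> t0 t2 l0 tmu; have ml0 : 0 < mu + l by rewrite addr_gt0.
rewrite -ler_sqr ?nnegrE ?mulr_ge0 ?l2norm_ge0 ?subr_ge0//.
have -> : v - t *: G v - (u - t *: G u) = (v - u) - t *: (G v - G u).
  by apply/matrixP => i j; rewrite !mxE; ring.
have := gradient_cocoercive u v; have := strongly_convex_monotone u v.
rewrite ler_pdivlMr// in t2.
move: (v - u) (G v - G u) => w g; rewrite exprMn !l2norm_sqr !dotE (dotC g w).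
move: (dot w w) (dot w g) (dot g g) => a b c h1 h2.
have k1 : 0 <= t * (2 - t * (mu + l)) * (b - mu * a).
  by rewrite !mulr_ge0// subr_ge0.
have k2 : 0 <= t ^+ 2 * ((mu + l) * b - (mu * l * a + c)).
  by rewrite mulr_ge0 ?sqr_ge0// subr_ge0.
rewrite -subr_ge0.
rewrite (_ : _ - _ = t * (2 - t * (mu + l)) * (b - mu * a)
   + t ^+ 2 * ((mu + l) * b - (mu * l * a + c))); last by ring.
exact: addr_ge0.
Qed.

(** Strong monotonicity and the Lipschitz bound are compared on the increment of
    the gradient along a unit vector. *)
Lemma strong_convexity_le_smoothness : (0 < n)%N -> mu <= l.
Proof.
move=> n0; pose d := delta_mx (Ordinal n0) 0 : 'cV[R]_n.
have := strongly_convex_monotone 0 d; rewrite subr0 l2norm_delta expr1n mulr1.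
move=> /le_trans; apply; rewrite (le_trans (cauchy_schwarz _ _))//.
have := lip d 0; rewrite subr0 l2norm_delta mulr1 mul1r; exact.
Qed.

(** Gradient descent is a contraction, hence converges to a zero of the
    gradient, which strong convexity turns into a minimizer. *)
Lemma strongly_convex_minimizer : 0 < l -> mu <= l ->
  exists y, G y = 0 /\ forall y', phi y <= phi y'.
Proof.
move=> l0 mul.
pose t := (mu + l)^-1; have ml0 : 0 < mu + l by rewrite addr_gt0.
have t0 : 0 < t by rewrite invr_gt0.
have tmu0 : 0 < t * mu by rewrite mulr_gt0.
have tmu1 : t * mu < 1 by rewrite mulrC ltr_pdivrMr// mul1r ltrDl.
pose S y := y - t *: G y; pose z k := iter k S (0 : 'cV[R]_n).
have zS k : l2norm (z k.+1 - z k) <= (1 - t * mu) ^+ k * l2norm (z 1%N - z 0%N).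
  elim: k => [|k IH]; first by rewrite mul1r.
  rewrite exprS -mulrA (le_trans _ (ler_wpM2l _ IH)) ?subr_ge0 ?(ltW tmu1)//.
  apply: gradient_step_contraction; rewrite ?(ltW t0) ?(ltW tmu1)//.
  by rewrite ler_peMl ?invr_ge0 ?(ltW ml0)// ler1n.
have cz i : cvgn (fun k => z k i 0).
  pose dz k := z k.+1 i 0 - z k i 0.
  have : cvgn (series dz).
    apply: normed_cvg.
    apply: (@series_le_cvg _ _ (geometric (l2norm (z 1%N - z 0%N)) (1 - t * mu))).
    - by move=> k; exact: normr_ge0.
    - by move=> k; rewrite /geometric/= mulr_ge0 ?l2norm_ge0 ?exprn_ge0// subr_ge0 ltW.
    - move=> k; rewrite /geometric/= mulrC (le_trans _ (zS k))//.
      by rewrite /dz -[_ - _](_ : (z k.+1 - z k) i 0 = _) ?coord_le_l2norm// !mxE.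
    - apply: is_cvg_geometric_series.
      by rewrite ger0_norm ?subr_ge0 ?(ltW tmu1)// ltrBlDr ltrDl.
  have E : series dz = (fun k => z k i 0 - z 0%N i 0).
    by apply/funext => k; rewrite /series/= telescope_sumr.
  rewrite E => cs.
  rewrite (_ : (fun k => z k i 0) = (fun k => z k i 0 - z 0%N i 0) + cst (z 0%N i 0)).
    by apply: is_cvgD => //; exact: is_cvg_cst.
  by apply/funext => k; rewrite fctE subrK.
pose y : 'cV[R]_n := \col_i limn (fun k => z k i 0).
exists y.
have zy : (fun k => l2norm (z k - y)) @ \oo --> (0 : R).
  have h : (fun k => \sum_i `|z k i 0 - y i 0|) @ \oo --> (\sum_(i < n) 0 : R).
    apply: cvg_big => [|i _]; first exact: add_continuous.
    rewrite mxE.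
    apply/norm_cvg0P/subr_cvg0.
    exact: cz.
  rewrite big1// in h.
  apply: squeeze_cvgr h; [|exact: cvg_cst].
  near=> k; rewrite l2norm_ge0 (le_trans (l2norm_le_sum _))//.
  by apply: ler_sum => i _; rewrite !mxE.
have G0 : G y = 0.
  apply: l2norm0_eq0; apply/eqP; rewrite eq_le l2norm_ge0 andbT.
  have h : (fun k => l2norm (z k.+1 - y) + (1 + t * l) * l2norm (z k - y)) @ \oo
      --> (0 + (1 + t * l) * 0 : R).
    have zy' := zy; rewrite -cvg_shiftS in zy'.
    by apply: cvgD zy' _; apply: cvgM zy; exact: cvg_cst.
  rewrite mulr0 addr0 in h.
  rewrite -(pmulr_rle0 _ t0).
  apply: ler_cvg_to (cvg_cst _) h _.
  near=> k.
  have -> : t * l2norm (G y) = l2norm (t *: G y) by rewrite l2normZ gtr0_norm.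
  have -> : t *: G y = (z k - y) - (z k.+1 - y) - t *: (G (z k) - G y).
    by rewrite [z k.+1]/= -/(z k) /S; apply/matrixP => i j; rewrite !mxE; ring.
  rewrite (le_trans (l2normB _ _))// mulrDl mul1r addrA.
  apply: lerD; first by rewrite (le_trans (l2normB _ _))// addrC.
  by rewrite l2normZ gtr0_norm// -mulrA ler_wpM2l ?(ltW t0)//; exact: lip.
split=> // y'.
have := strongly_convex_tangent y y'; rewrite G0 dot0l addr0.
by apply: le_trans; rewrite lerDl mulr_ge0 ?sqr_ge0// divr_ge0 ?(ltW mu_gt0).
Unshelve. all: by end_near.
Qed.

End StronglyConvex.

(** * Second differences *)

Section SecondDifference.
Variable R : realType.

Lemma derivative_le_of_bound (F : R -> R) (l c d : R) :
  is_derive (0 : R) 1 F l -> (forall t, 0 < t -> t <= 1 -> F t - F 0 <= t * (c + t * d)) ->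
  l <= c.
Proof.
move=> [dF <-] hF.
have h1 : h^-1 *: ((F \o shift 0) (h *: 1) - F 0) @[h --> (0 : R)^'+] --> 'D_1 F 0.
  by apply: cvg_dnbhs_at_right; exact: dF.
have h2 : c + h * d @[h --> (0 : R)^'+] --> c + 0 * d.
  apply: cvgD; first exact: cvg_cst.
  by apply: cvgM; [apply: cvg_at_right_filter; exact: cvg_id|exact: cvg_cst].
rewrite mul0r addr0 in h2.
apply: ler_cvg_to h1 h2 _.
near=> h; rewrite /= addr0 [h *: 1]mulr1 /GRing.scale/= mulrC ler_pdivrMr; last first.
  by near: h; exact: nbhs_right_gt.
rewrite [leRHS]mulrC; apply: hF.
  by near: h; exact: nbhs_right_gt.
by near: h; exact: nbhs_right_le.
Unshelve. all: by end_near.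
Qed.

(** The mixed second difference over the rectangle of sides 1 and t is t times a
    value of the iterated derivative B; dividing by t and letting it vanish
    recovers the increment of the other partial derivative D.  This is the form
    of the symmetry of second derivatives that needs a single iterated
    derivative to exist. *)
Lemma second_difference (psi A B : R -> R -> R) (D0 D1 b c d : R) :
  (forall s t : R, is_derive s 1 (psi^~ t) (A s t)) ->
  (forall s t : R, is_derive t 1 (A s) (B s t)) ->
  is_derive (0 : R) 1 (psi 0) D0 -> is_derive (0 : R) 1 (psi 1) D1 ->
  (forall s t, 0 < s < 1 -> 0 < t <= 1 -> `|B s t - b| <= c + t * d) ->
  0 <= d -> `|D1 - D0 - b| <= c.
Proof.
move=> dpsi dA dD0 dD1 hB d0.
have key t : 0 < t -> t <= 1 ->
    `|(psi 1 t - psi 0 t - b * t) - (psi 1 0 - psi 0 0 - b * 0)| <= t * (c + t * d).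
  move=> t0 t1.
  have dk (s : R) : is_derive s 1 (fun s => psi s t - psi s 0) (A s t - A s 0).
    exact: is_deriveB.
  have [s s01 E] := mvt01 dk.
  have cA : {within `[0, t], continuous (A s)}.
    by apply: derivable_within_continuous => r _; apply: ex_derive; exact: dA.
  have [r] := @MVT R (A s) (B s) 0 t t0 (fun r _ => dA s r) cA.
  rewrite in_itv/= subr0 => /andP[r0 rt] Er.
  have -> : psi 1 t - psi 0 t - b * t - (psi 1 0 - psi 0 0 - b * 0) =
     t * (B s r - b).
    have -> : psi 1 t - psi 0 t = (psi 1 0 - psi 0 0) + (A s t - A s 0).
      by rewrite -E; ring.
    by rewrite Er; ring.
  rewrite normrM gtr0_norm// ler_pM2l//.
  have rt1 : 0 < r <= 1 by rewrite r0 (le_trans (ltW rt)).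
  by rewrite (le_trans (hB _ _ s01 rt1))// lerD2l ler_wpM2r// ltW.
have dF : is_derive (0 : R) 1 (fun t : R => psi 1 t - psi 0 t - b * t) (D1 - D0 - b).
  apply: is_derive_eq; by rewrite [b *: 1]mulr1.
rewrite ler_norml; apply/andP; split.
- rewrite lerNl; apply: (derivative_le_of_bound (d := d) (is_deriveN dF)) => t t0 t1.
  have := key t t0 t1; rewrite ler_norml => /andP[h _].
  by rewrite -opprD lerNl.
- apply: (derivative_le_of_bound (d := d) dF) => t t0 t1.
  by have := key t t0 t1; rewrite ler_norml => /andP[_].
Qed.

End SecondDifference.

(** * Functions of two vector variables *)

Section TwoVariables.
Variables (R : realType) (p q : nat).
Implicit Types (h : 'cV[R]_p -> 'cV[R]_q -> R) (x : 'cV[R]_p) (y : 'cV[R]_q).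

Lemma jointE (V : Type) (k : 'cV[R]_p -> 'cV[R]_q -> V) x y : joint k (col_mx x y) = k x y.
Proof. by rewrite /joint col_mxKu col_mxKd. Qed.

Lemma gradE h x y : grad h x y = col_mx (grad_x h x y) (grad_y h x y).
Proof.
apply/matrixP => i j; rewrite ord1 !mxE.
case: splitP => k ik; rewrite /grad_x /grad_y mxE; apply: derive_recenter; rewrite ?jointE// => s.
- have -> : i = lshift q k by apply: val_inj.
  by rewrite delta_mx_ushift scale_col_mx add_col_mx scaler0 add0r jointE.
- have -> : i = rshift p k by apply: val_inj.
  by rewrite delta_mx_dshift scale_col_mx add_col_mx scaler0 add0r jointE.
Qed.

Lemma joint_has_gradient_x h y : has_gradient (joint h) -> has_gradient (h^~ y).
Proof.
move=> dh x v; have := dh (col_mx x y) (col_mx v 0).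
rewrite -/(grad h x y) gradE dot_col_mx dot0r addr0.
move=> D; apply: (is_derive_recenter _ _ D) => [s|]; last by rewrite jointE.
by rewrite scale_col_mx add_col_mx scaler0 add0r jointE.
Qed.

Lemma joint_has_gradient_y h x : has_gradient (joint h) -> has_gradient (h x).
Proof.
move=> dh y v; have := dh (col_mx x y) (col_mx 0 v).
rewrite -/(grad h x y) gradE dot_col_mx dot0r add0r.
move=> D; apply: (is_derive_recenter _ _ D) => [s|]; last by rewrite jointE.
by rewrite scale_col_mx add_col_mx scaler0 add0r jointE.
Qed.

Lemma grad_lipschitz h l x y x' y' :
  lipschitz_for (@l2norm R (p + q)) l (gradient (joint h)) ->
  l2norm (grad h x y - grad h x' y') <= l * l2norm (col_mx (x - x') (y - y')).
Proof.
by move=> /(_ (col_mx x y) (col_mx x' y')); rewrite opp_col_mx add_col_mx.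
Qed.

Lemma grad_x_lipschitz h l x y x' y' :
  lipschitz_for (@l2norm R (p + q)) l (gradient (joint h)) ->
  l2norm (grad_x h x y - grad_x h x' y') <= l * l2norm (col_mx (x - x') (y - y')).
Proof.
move=> /(grad_lipschitz x y x' y'); apply: le_trans.
rewrite !gradE opp_col_mx add_col_mx.
by rewrite -[X in l2norm X <= _](col_mxKu _ (grad_y h x y - grad_y h x' y')) l2norm_usubmx.
Qed.

Lemma grad_y_lipschitz h l x y x' y' :
  lipschitz_for (@l2norm R (p + q)) l (gradient (joint h)) ->
  l2norm (grad_y h x y - grad_y h x' y') <= l * l2norm (col_mx (x - x') (y - y')).
Proof.
move=> /(grad_lipschitz x y x' y'); apply: le_trans.
rewrite !gradE opp_col_mx add_col_mx.
by rewrite -[X in l2norm X <= _](col_mxKd (grad_x h x y - grad_x h x' y')) l2norm_dsubmx.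
Qed.

Lemma gradient_y_lipschitz h l x :
  lipschitz_for (@l2norm R (p + q)) l (gradient (joint h)) ->
  lipschitz_for (@l2norm R q) l (gradient (h x)).
Proof.
by move=> hl y y'; have := grad_y_lipschitz x y x y' hl; rewrite (subrr x) l2norm_0col_mx.
Qed.

Lemma lipschitz_gradient_le h m x y : has_gradient (joint h) ->
  0 <= m -> lipschitz_for Num.norm m (joint h) -> l2norm (grad h x y) <= m.
Proof.
move=> dh m0 hm; apply: l2norm_dual => // k; set z := col_mx x y.
have dF := is_derive_line (v := k) (a := z) (t := 0) (phi := joint h) (l := dot (grad h x y) k).
rewrite scale0r addr0 in dF.
apply: (derivative_le_of_bound (d := 0) (dF (dh z k))) => t t0 t1.
rewrite mulr0 addr0 scale0r addr0 (le_trans (ler_norm _))// (le_trans (hm _ _))//.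
by rewrite addrKC l2normZ gtr0_norm// mulrCA.
Qed.

Lemma is_derive_jacobian n m (Gf : 'cV[R]_n -> 'cV[R]_m) z v k :
  differentiable Gf z ->
  is_derive z v (fun z => dot (Gf z) k) (dot (col_jacobian Gf z *m v) k).
Proof.
move=> dG.
have dc i : differentiable (fun u => Gf u i 0) z.
  by apply: (@differentiable_comp _ _ _ _ Gf (fun N : 'cV[R]_m => N i 0 : R)) => //;
    exact: differentiable_coord.
have di i : is_derive z v (fun u => Gf u i 0) ((col_jacobian Gf z *m v) i 0).
  apply: DeriveDef; first exact: diff_derivable.
  rewrite derive_gradient// mxE; apply: eq_bigr => j _.
  by rewrite !mxE.
have -> : (fun u => dot (Gf u) k) = \sum_i (fun u => k i 0 * Gf u i 0).
  by apply/funext => u; rewrite fct_sumE; apply: eq_bigr => i _; rewrite mulrC.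
rewrite dotC; apply: is_derive_sum => i.
Qed.

Section LowerRegular.
Variables (h : 'cV[R]_p -> 'cV[R]_q -> R) (L tau rho : R).
Hypothesis hreg : lower_regular L tau rho h.

Let dh : has_gradient (joint h).
Proof. by case: hreg => /differentiable_has_gradient. Qed.

Let lh : lipschitz_for (@l2norm R (p + q)) L (gradient (joint h)).
Proof. by case: hreg. Qed.

Lemma jac_xy_lipschitz x y x' y' v :
  l2norm ((jac_xy h x y - jac_xy h x' y') *m v)
    <= tau * l2norm (col_mx (x - x') (y - y')) * l2norm v.
Proof.
rewrite (le_trans (spectral_norm_le _ _))// ler_wpM2r ?l2norm_ge0//.
case: hreg => _ _ _ /(_ (col_mx x y) (col_mx x' y')) + _.
by rewrite !jointE opp_col_mx add_col_mx.
Qed.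

Lemma hess_y_lipschitz x y x' y' v :
  l2norm ((hess_y h x y - hess_y h x' y') *m v)
    <= rho * l2norm (col_mx (x - x') (y - y')) * l2norm v.
Proof.
rewrite (le_trans (spectral_norm_le _ _))// ler_wpM2r ?l2norm_ge0//.
case: hreg => _ _ _ _ /(_ (col_mx x y) (col_mx x' y')).
by rewrite !jointE opp_col_mx add_col_mx.
Qed.

Lemma is_derive_grad_x_line x y k v (t : R) :
  is_derive t 1 (fun t : R => dot (grad_x h x (y + t *: v)) k)
    (dot (jac_xy h x (y + t *: v) *m v) k).
Proof.
apply: (is_derive_line (phi := fun y => dot (grad_x h x y) k)).
apply: is_derive_jacobian.
by case: hreg => _ _ /(_ x (y + t *: v))[].
Qed.

Lemma is_derive_grad_y_line x y k v (t : R) :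
  is_derive t 1 (fun t : R => dot (grad_y h x (y + t *: v)) k)
    (dot (hess_y h x (y + t *: v) *m v) k).
Proof.
apply: (is_derive_line (phi := fun y => dot (grad_y h x y) k)).
apply: is_derive_jacobian.
by case: hreg => _ _ /(_ x (y + t *: v))[].
Qed.

(** Symmetry of the second derivatives up to second-order terms: the increment
    of grad_y along x is given by the transpose of jac_xy, which is the derivative
    of grad_x along y. *)
Lemma grad_y_increment_x x y dx k : 0 <= tau ->
  `|dot (grad_y h (x + dx) y - grad_y h x y) k - dot (jac_xy h x y *m k) dx|
    <= tau * l2norm dx ^+ 2 * l2norm k.
Proof.
move=> tau0.
pose psi (s t : R) := h (x + s *: dx) (y + t *: k).
have -> : dot (grad_y h (x + dx) y - grad_y h x y) k =
   dot (grad_y h (x + dx) y) k - dot (grad_y h x y) k by rewrite dotBl.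
apply: (@second_difference _ psi
   (fun s t => dot (grad_x h (x + s *: dx) (y + t *: k)) dx)
   (fun s t => dot (jac_xy h (x + s *: dx) (y + t *: k) *m k) dx) _ _ _ _
   (tau * l2norm k ^+ 2 * l2norm dx)).
- move=> s t; apply: (is_derive_line (phi := h^~ (y + t *: k))).
  exact: joint_has_gradient_x.
- by move=> s t; exact: is_derive_grad_x_line.
- apply: (is_derive_line (phi := h (x + 0 *: dx))).
  by rewrite !scale0r !addr0; exact: joint_has_gradient_y.
- apply: (is_derive_line (phi := h (x + 1 *: dx))).
  by rewrite scale0r scale1r !addr0; exact: joint_has_gradient_y.
- move=> s t /andP[s0 s1] /andP[t0 t1].
  rewrite -dotBl -mulmxBl (le_trans (dot_norm_le _ _))//.
  have := jac_xy_lipschitz (x + s *: dx) (y + t *: k) x y k.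
  rewrite !addrKC => h1.
  have h2 : l2norm (col_mx (s *: dx) (t *: k)) <= l2norm dx + t * l2norm k.
    rewrite (_ : col_mx _ _ = col_mx (s *: dx) 0 + col_mx 0 (t *: k)); last first.
      by rewrite add_col_mx addr0 add0r.
    rewrite (le_trans (l2normD _ _))// l2norm_col_mx0 l2norm_0col_mx !l2normZ.
    by rewrite !gtr0_norm// lerD2r ler_piMl ?l2norm_ge0// ltW.
  rewrite (le_trans (ler_wpM2r (l2norm_ge0 _) h1))//.
  have h3 := ler_wpM2l tau0 h2.
  have h4 := ler_wpM2r (mulr_ge0 (l2norm_ge0 k) (l2norm_ge0 dx)) h3.
  by move: h4; congr (_ <= _); ring.
- by rewrite !mulr_ge0 ?sqr_ge0 ?l2norm_ge0.
Qed.

Lemma grad_y_increment_y x y dy k : 0 <= rho ->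
  `|dot (grad_y h x (y + dy) - grad_y h x y) k - dot (hess_y h x y *m k) dy|
    <= rho * l2norm dy ^+ 2 * l2norm k.
Proof.
move=> rho0.
pose psi (s t : R) := h x (y + s *: dy + t *: k).
have -> : dot (grad_y h x (y + dy) - grad_y h x y) k =
   dot (grad_y h x (y + dy)) k - dot (grad_y h x y) k by rewrite dotBl.
apply: (@second_difference _ psi
   (fun s t => dot (grad_y h x (y + s *: dy + t *: k)) dy)
   (fun s t => dot (hess_y h x (y + s *: dy + t *: k) *m k) dy) _ _ _ _
   (rho * l2norm k ^+ 2 * l2norm dy)).
- move=> s t; rewrite [X in is_derive _ _ X](_ : _ = (fun s : R => h x ((y + t *: k) + s *: dy))).
    rewrite [y + _ + _]addrAC; apply: (is_derive_line (phi := h x)).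
    exact: joint_has_gradient_y.
  by apply/funext => z; rewrite /psi addrAC.
- by move=> s t; exact: is_derive_grad_y_line.
- apply: (is_derive_line (phi := h x)).
  by rewrite !scale0r !addr0; exact: joint_has_gradient_y.
- apply: (is_derive_line (phi := h x)).
  by rewrite scale0r scale1r !addr0; exact: joint_has_gradient_y.
- move=> s t /andP[s0 s1] /andP[t0 t1].
  rewrite -dotBl -mulmxBl (le_trans (dot_norm_le _ _))//.
  have := hess_y_lipschitz x (y + s *: dy + t *: k) x y k.
  have -> : y + s *: dy + t *: k - y = s *: dy + t *: k by rewrite -(addrA y) addrKC.
  rewrite (subrr x) l2norm_0col_mx => h1.
  have h2 : l2norm (s *: dy + t *: k) <= l2norm dy + t * l2norm k.
    rewrite (le_trans (l2normD _ _))// !l2normZ.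
    by rewrite !gtr0_norm// lerD2r ler_piMl ?l2norm_ge0// ltW.
  rewrite (le_trans (ler_wpM2r (l2norm_ge0 _) h1))//.
  have h3 := ler_wpM2l rho0 h2.
  have h4 := ler_wpM2r (mulr_ge0 (l2norm_ge0 k) (l2norm_ge0 dy)) h3.
  by move: h4; congr (_ <= _); ring.
- by rewrite !mulr_ge0 ?sqr_ge0 ?l2norm_ge0.
Qed.

(** By symmetry the Jacobian is tested through increments of grad_y in x, and
    grad_y is L-Lipschitz. *)
Lemma jac_xy_le x y v : 0 <= tau -> 0 <= L -> l2norm (jac_xy h x y *m v) <= L * l2norm v.
Proof.
move=> tau0 L0; apply: l2norm_dual => [|k]; first by rewrite mulr_ge0 ?l2norm_ge0.
have dF := is_derive_grad_x_line x y k v 0; rewrite scale0r addr0 in dF.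
apply: (derivative_le_of_bound (d := 0) dF) => t t0 t1.
rewrite mulr0 addr0 scale0r addr0 -dotBl (le_trans (cauchy_schwarz _ _))//.
have := grad_x_lipschitz x (y + t *: v) x y lh.
rewrite (subrr x) addrKC l2norm_0col_mx l2normZ gtr0_norm// => h1.
have := ler_wpM2r (l2norm_ge0 k) h1.
by congr (_ <= _); ring.
Qed.

Variable mu : R.
Hypothesis mu_gt0 : 0 < mu.
Hypothesis L_gt0 : 0 < L.
Hypothesis hsc : forall x, strongly_convex mu (h x).

(** The map y - t grad_y h is a contraction and its derivative is the identity
    minus t times the Hessian. *)
Lemma hess_y_contraction t x y v : 0 <= t -> t <= 2 / (mu + L) -> t * mu <= 1 ->
  l2norm (v - t *: (hess_y h x y *m v)) <= (1 - t * mu) * l2norm v.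
Proof.
move=> t0 t2 tmu1; apply: l2norm_dual => [|k].
  by rewrite mulr_ge0 ?l2norm_ge0// subr_ge0.
have dF : is_derive (0 : R) 1 (fun s : R => dot (s *: v) k - t * dot (grad_y h x (y + s *: v)) k)
   (dot (v - t *: (hess_y h x y *m v)) k).
  have d1 := is_derive_grad_y_line x y k v 0; rewrite scale0r addr0 in d1.
  have d2 : is_derive (0 : R) 1 (fun s : R => dot (s *: v) k) (dot v k).
    have -> : (fun s : R => dot (s *: v) k) = (fun s : R => dot v k * s).
      by apply/funext => s; rewrite dotZl mulrC.
    by apply: is_derive_eq; rewrite [_ *: 1]mulr1.
  by rewrite dotBl dotZl; exact: (is_deriveB d2 (is_deriveZ t d1)).
apply: (derivative_le_of_bound (d := 0) dF) => s s0 s1.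
rewrite mulr0 addr0 !scale0r dot0l addr0 sub0r opprK.
have := gradient_step_contraction mu_gt0 (joint_has_gradient_y x dh)
  (gradient_y_lipschitz x lh) (hsc x) y (y + s *: v) t0 t2 L_gt0 tmu1.
rewrite addrKC l2normZ (gtr0_norm s0) -/(grad_y h x _) -/(grad_y h x y) => h1.
have := le_trans (cauchy_schwarz _ k) (ler_wpM2r (l2norm_ge0 k) h1).
congr (_ <= _); last by ring.
by rewrite !dotE -/(grad_y h x (y + s *: v)) -/(grad_y h x y); ring.
Qed.

Lemma hess_y_ge x y v : mu <= L -> mu * l2norm v <= l2norm (hess_y h x y *m v).
Proof.
move=> muL; pose t := (mu + L)^-1.
have mL : 0 < mu + L by rewrite addr_gt0.
have t0 : 0 < t by rewrite invr_gt0.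
have tmu : t * mu <= 1 by rewrite mulrC ler_pdivrMr// mul1r lerDl ltW.
have t2 : t <= 2 / (mu + L) by rewrite ler_peMl ?ltW// ltr1n.
have := hess_y_contraction x y v (ltW t0) t2 tmu.
have := l2normD (v - t *: (hess_y h x y *m v)) (t *: (hess_y h x y *m v)).
rewrite subrK l2normZ gtr0_norm// => h1 h2.
by rewrite -(ler_pM2l t0); lra.
Qed.

Lemma hess_y_unitmx x y : mu <= L -> hess_y h x y \in unitmx.
Proof.
move=> muL; rewrite -unitmx_tr -row_free_unit -kermx_eq0.
apply/eqP/row_matrixP => i; rewrite row0.
set r := row i _.
have : r *m (hess_y h x y)^T = 0.
  by apply/sub_kermxP; exact: row_sub.
move=> /(congr1 trmx); rewrite trmx_mul trmxK trmx0 => Hr.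
have := hess_y_ge x y r^T muL; rewrite Hr l2norm0 pmulr_rle0// => r0.
have : r^T = 0 by apply: l2norm0_eq0; apply/eqP; rewrite eq_le r0 l2norm_ge0.
by move=> /(congr1 trmx); rewrite trmxK trmx0.
Qed.

End LowerRegular.

End TwoVariables.

(** * The hypergradient *)

Lemma gradient_of_quadratic_bound (R : realType) n (phi : 'cV[R]_n -> R) x d c :
  (forall dx, `|phi (x + dx) - phi x - dot d dx| <= c * l2norm dx ^+ 2) ->
  gradient phi x = d.
Proof.
move=> hphi; apply/matrixP => i j; rewrite ord1 !mxE; set e := delta_mx i 0.
have e1 : l2norm e = 1 by rewrite l2norm_delta.
have c0 : 0 <= c.
  have := hphi e; rewrite e1 expr1n mulr1; exact: le_trans.
apply/cvg_lim => //; apply/subr_cvg0; apply/norm_cvg0P.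
have h2 : c * `|h| @[h --> (0 : R)^'] --> c * `|0 : R|.
  apply: cvgM; first exact: cvg_cst.
  by apply: cvg_norm; apply: cvg_within_filter; exact: cvg_id.
rewrite normr0 mulr0 in h2.
apply: squeeze_cvgr (cvg_cst (0 : R)) h2.
near=> h; rewrite normr_ge0/=.
have h0 : h != 0 by near: h; exact: nbhs_dnbhs_neq.
have := hphi (h *: e); rewrite l2normZ e1 mulr1 dotZr dot_delta real_normK ?num_real// => hh.
rewrite [h *: e + x]addrC.
rewrite -[X in `|_ - X|](mulKf h0) /GRing.scale/= -mulrBr normrM normfV.
rewrite ler_pdivrMl ?normr_gt0// mulrCA -expr2 real_normK ?num_real//.
Unshelve. all: by end_near.
Qed.

Lemma mulmx_residual (R : realType) m n (A B : 'M[R]_(m, n)) (u : 'cV[R]_n) a b : B *m u = b ->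
  a - A *m u = (a - b) - (A - B) *m u.
Proof. by move=> <-; rewrite mulmxBl opprB addrA subrK. Qed.

Lemma mulmx_solution_sub (R : realType) m n (A : 'M[R]_(m, n)) (u w : 'cV[R]_n) a :
  A *m u = a -> a - A *m w = A *m (u - w).
Proof. by move=> <-; rewrite mulmxBr. Qed.

Lemma affine_sub (R : realType) m n (A B : 'M[R]_(m, n)) (u w : 'cV[R]_n) a b :
  (a - A *m u) - (b - B *m w) = (a - b) - (A - B) *m w - A *m (u - w).
Proof.
rewrite mulmxBr mulmxBl; move: (A *m u) (A *m w) (B *m w) => x y z.
by apply/matrixP => i j; rewrite !mxE; ring.
Qed.

Lemma telescope4_le (R : realType) (F X Y Z W V a b c d : R) :
  `|F - (X + Y)| <= a -> `|Z - Y| <= b -> `|- Z - W| <= c -> `|W - V| <= d ->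
  `|F - (X - V)| <= a + b + c + d.
Proof.
move=> ha hb hc hd.
have -> : F - (X - V) = (F - (X + Y)) - (Z - Y) - (- Z - W) - (W - V) by ring.
by do 3!(rewrite (le_trans (ler_normB _ _))//; apply: lerD => //).
Qed.

Section Hypergradient.
Variables (R : realType) (p q : nat).
Variables (f g : 'cV[R]_p -> 'cV[R]_q -> R) (L M tau rho mu : R).
Variable ys : 'cV[R]_p -> 'cV[R]_q.
Hypotheses (L_gt0 : 0 < L) (M_ge0 : 0 <= M) (tau_ge0 : 0 <= tau) (rho_ge0 : 0 <= rho).
Hypotheses (mu_gt0 : 0 < mu) (mu_le_L : mu <= L).
Hypothesis freg : upper_regular L M f.
Hypothesis greg : lower_regular L tau rho g.
Hypothesis gsc : forall x, strongly_convex mu (g x).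
Hypothesis ys_stationary : forall x, grad_y g x (ys x) = 0.

Local Notation kap := (L / mu).

Let df : has_gradient (joint f).
Proof. by case: freg => /differentiable_has_gradient. Qed.

Let lf : lipschitz_for (@l2norm R (p + q)) L (gradient (joint f)).
Proof. by case: freg. Qed.

Let dg : has_gradient (joint g).
Proof. by case: greg => /differentiable_has_gradient. Qed.

Let lg : lipschitz_for (@l2norm R (p + q)) L (gradient (joint g)).
Proof. by case: greg. Qed.

Lemma grad_le x y : l2norm (grad f x y) <= M.
Proof. by apply: lipschitz_gradient_le => //; case: freg. Qed.

Lemma grad_y_le x y : l2norm (grad_y f x y) <= M.
Proof.
apply: le_trans (grad_le x y); rewrite gradE.
by rewrite -[X in l2norm X <= _](col_mxKd (grad_x f x y)) l2norm_dsubmx.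
Qed.

Lemma ystar_lipschitz x x' : l2norm (ys x' - ys x) <= kap * l2norm (x' - x).
Proof.
have [->|n0] := eqVneq (l2norm (ys x' - ys x)) 0.
  by rewrite mulr_ge0 ?l2norm_ge0// divr_ge0 ?ltW.
have ngt0 : 0 < l2norm (ys x' - ys x) by rewrite lt_def n0 l2norm_ge0.
rewrite mulrAC ler_pdivlMr// mulrC -(ler_pM2r ngt0).
have := strongly_convex_monotone (joint_has_gradient_y x' dg)
  (gradient_y_lipschitz x' lg) (gsc x') (ys x) (ys x').
rewrite -/(grad_y g x' _) -/(grad_y g x' (ys x)) ys_stationary sub0r -mulrA -expr2.
move=> /le_trans; apply.
have -> : - grad_y g x' (ys x) = grad_y g x (ys x) - grad_y g x' (ys x).
  by rewrite ys_stationary sub0r.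
rewrite (le_trans (cauchy_schwarz _ _))// mulrC l2normBC ler_wpM2r ?l2norm_ge0//.
have := grad_y_lipschitz x' (ys x) x (ys x) lg.
by rewrite (subrr (ys x)) l2norm_col_mx0.
Qed.

(** The solution of the linear system that the iteration on v tracks: the
    gradient of f in y at the lower-level solution, divided by the Hessian of g. *)
Definition vs x := invmx (hess_y g x (ys x)) *m grad_y f x (ys x).

Lemma hess_vs x : hess_y g x (ys x) *m vs x = grad_y f x (ys x).
Proof. by rewrite mulKVmx// (hess_y_unitmx greg mu_gt0 L_gt0). Qed.

Lemma vs_le x : l2norm (vs x) <= M / mu.
Proof.
rewrite ler_pdivlMr// mulrC.
apply: le_trans (grad_y_le x (ys x)); rewrite -hess_vs.
exact: (hess_y_ge greg mu_gt0 L_gt0 gsc).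
Qed.

(** C1 is, up to the factor mu, a Lipschitz constant of the linear system that
    defines vs: L comes from its right-hand side, and rho times the bound M / mu
    on vs from its matrix. *)
Lemma vs_residual x x' y :
  l2norm (grad_y f x' y - hess_y g x' y *m vs x)
    <= mu * C1 mu L M rho * l2norm (col_mx (x' - x) (y - ys x)).
Proof.
rewrite (mulmx_residual _ _ (hess_vs x)).
rewrite (le_trans (l2normB _ _))//.
have h1 := grad_y_lipschitz x' y x (ys x) lf.
have h2 := hess_y_lipschitz greg x' y x (ys x) (vs x).
have h3 : rho * l2norm (col_mx (x' - x) (y - ys x)) * l2norm (vs x)
   <= rho * l2norm (col_mx (x' - x) (y - ys x)) * (M / mu).
  by rewrite ler_wpM2l ?mulr_ge0 ?l2norm_ge0// vs_le.
have -> : mu * C1 mu L M rho = L + rho * (M / mu).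
  by rewrite /C1; field; rewrite gt_eqF.
by rewrite mulrDl; lra.
Qed.

Lemma col_mx_ystar_le x x' :
  l2norm (col_mx (x' - x) (ys x' - ys x)) ^+ 2 <= (1 + kap ^+ 2) * l2norm (x' - x) ^+ 2.
Proof.
rewrite l2norm_col_mx_sqr mulrDl mul1r lerD2l -exprMn ler_sqr ?nnegrE ?l2norm_ge0//.
  exact: ystar_lipschitz.
by rewrite mulr_ge0 ?l2norm_ge0// divr_ge0 ?ltW.
Qed.

Lemma vs_lipschitz x x' :
  l2norm (vs x' - vs x) ^+ 2
    <= C1 mu L M rho ^+ 2 * (1 + kap ^+ 2) * l2norm (x' - x) ^+ 2.
Proof.
have h : l2norm (vs x' - vs x) <= C1 mu L M rho * l2norm (col_mx (x' - x) (ys x' - ys x)).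
  rewrite -(ler_pM2l mu_gt0) mulrA.
  apply: le_trans (vs_residual x x' (ys x')).
  rewrite (mulmx_solution_sub _ (hess_vs x')).
  exact: (hess_y_ge greg mu_gt0 L_gt0 gsc).
rewrite -mulrA; apply: le_trans (ler_wpM2l (sqr_ge0 _) (col_mx_ystar_le x x')).
rewrite -exprMn ler_sqr ?nnegrE ?l2norm_ge0//.
exact: le_trans (l2norm_ge0 _) h.
Qed.

(** The classical formula for the gradient of Phi, by implicit differentiation. *)
Definition hyper x := grad_x f x (ys x) - jac_xy g x (ys x) *m vs x.

(** Half of the smoothness constant of f at the displaced lower-level solution,
    plus the second-order errors of the increments of grad_y g, weighted by the
    bound on vs. *)
Definition curvature :=
  L / 2 * (1 + kap ^+ 2) + M / mu * (tau + tau * kap + rho * kap ^+ 2).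

(** The first-order variation of the lower-level solution drops out of the
    expansion: the stationarity condition at both points, tested against vs,
    trades it for the mixed derivative of g. *)
Lemma hyper_expansion x dx :
  `|f (x + dx) (ys (x + dx)) - f x (ys x) - dot (hyper x) dx|
    <= curvature * l2norm dx ^+ 2.
Proof.
set y := ys x; set dy := ys (x + dx) - y; set v := vs x.
have yE : ys (x + dx) = y + dy by rewrite subrKC.
have hdy : l2norm dy <= kap * l2norm dx by have := ystar_lipschitz x (x + dx); rewrite addrKC.
have hv : l2norm v <= M / mu := vs_le x.
have Mmu0 : 0 <= M / mu by rewrite divr_ge0 // ltW.
have L0 := ltW L_gt0; have mui0 : 0 <= mu^-1 by rewrite invr_ge0 ltW.
have kap0 : 0 <= kap by exact: mulr_ge0.
have t1 := taylor_gradient df lf (col_mx x y) (col_mx (x + dx) (y + dy)).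
rewrite !jointE -/(grad f x y) gradE opp_col_mx add_col_mx !addrKC dot_col_mx in t1.
have hz : l2norm (col_mx dx dy) ^+ 2 <= (1 + kap ^+ 2) * l2norm dx ^+ 2.
  by have := col_mx_ystar_le x (x + dx); rewrite addrKC yE addrKC.
have s1 := grad_y_increment_y greg x y dy v rho_ge0.
have s2 := grad_y_increment_x greg x (y + dy) dx v tau_ge0.
have s3 := jac_xy_lipschitz greg x (y + dy) x y v.
rewrite (subrr x) addrKC l2norm_0col_mx in s3.
have E0 : grad_y g (x + dx) (y + dy) = 0 by rewrite -yE.
have E1 : grad_y g x y = 0 by [].
rewrite hess_vs -/y E1 subr0 in s1; rewrite E0 sub0r dotNl in s2.
have s4 := le_trans (dot_norm_le _ dx) (ler_wpM2r (l2norm_ge0 dx) s3).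
rewrite mulmxBl dotBl in s4.
have hdy2 : l2norm dy ^+ 2 <= kap ^+ 2 * l2norm dx ^+ 2.
  by rewrite -exprMn ler_sqr ?nnegrE ?mulr_ge0 ?l2norm_ge0.
have b1 : rho * l2norm dy ^+ 2 * l2norm v <= rho * (kap ^+ 2 * l2norm dx ^+ 2) * (M / mu).
  by rewrite ler_pM ?mulr_ge0 ?sqr_ge0 ?l2norm_ge0// ler_wpM2l.
have b2 : tau * l2norm dx ^+ 2 * l2norm v <= tau * l2norm dx ^+ 2 * (M / mu).
  by rewrite ler_wpM2l ?mulr_ge0 ?l2norm_ge0.
have b3 : tau * l2norm dy * l2norm v * l2norm dx <= tau * (kap * l2norm dx) * (M / mu) * l2norm dx.
  rewrite ler_wpM2r ?l2norm_ge0// ler_pM ?mulr_ge0 ?l2norm_ge0//.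
  by rewrite ler_wpM2l.
have b4 : L / 2 * l2norm (col_mx dx dy) ^+ 2 <= L / 2 * ((1 + kap ^+ 2) * l2norm dx ^+ 2).
  by rewrite ler_wpM2l// divr_ge0// ltW.
rewrite yE /hyper -/y -/v dotBl.
have cE : curvature * l2norm dx ^+ 2 = L / 2 * ((1 + kap ^+ 2) * l2norm dx ^+ 2)
  + (rho * (kap ^+ 2 * l2norm dx ^+ 2) * (M / mu) + tau * l2norm dx ^+ 2 * (M / mu)
    + tau * (kap * l2norm dx) * (M / mu) * l2norm dx).
  by rewrite /curvature; ring.
apply: le_trans (telescope4_le t1 s1 s2 s4) _.
by rewrite cE -2!addrA [X in _ + X]addrA; exact: lerD b4 (lerD (lerD b1 b2) b3).
Qed.

Lemma gradient_hyper x : gradient (fun x => f x (ys x)) x = hyper x.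
Proof. exact: gradient_of_quadratic_bound (hyper_expansion x). Qed.

Lemma hyper_error x y v :
  l2norm ((grad_x f x y - jac_xy g x y *m v) - hyper x)
    <= Cbar1 mu L M tau * l2norm (y - ys x) + L * l2norm (v - vs x).
Proof.
rewrite /hyper affine_sub.
rewrite (le_trans (l2normB _ _))//; apply: lerD; last first.
  exact: (jac_xy_le greg _ _ _ tau_ge0 (ltW L_gt0)).
rewrite (le_trans (l2normB _ _))// /Cbar1 mulrDl.
have h1 := grad_x_lipschitz x y x (ys x) lf; rewrite (subrr x) l2norm_0col_mx in h1.
have h2 := jac_xy_lipschitz greg x y x (ys x) (vs x); rewrite (subrr x) l2norm_0col_mx in h2.
have h3 : tau * l2norm (y - ys x) * l2norm (vs x) <= tau * l2norm (y - ys x) * (M / mu).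
  by rewrite ler_wpM2l ?mulr_ge0 ?l2norm_ge0// vs_le.
by rewrite (mulrC M) -(mulrA tau) -(mulrA tau) (mulrC (M / mu)) mulrA; lra.
Qed.

(** Makes the gradient of Phi measurable along the iterates. *)
Lemma hyper_lipschitz : exists2 c, 0 <= c &
  forall x x', l2norm (hyper x' - hyper x) <= c * l2norm (x' - x).
Proof.
pose a := Num.sqrt (1 + kap ^+ 2).
have a0 : 0 <= a by exact: sqrtr_ge0.
have L0 := ltW L_gt0; have mui0 : 0 <= mu^-1 by rewrite invr_ge0 ltW.
have kap0 : 0 <= kap by exact: mulr_ge0.
have Mmu0 : 0 <= M / mu by rewrite divr_ge0 // ltW.
have C0 : 0 <= C1 mu L M rho.
  by rewrite /C1 addr_ge0// divr_ge0 ?mulr_ge0 ?sqr_ge0// ltW.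
have za x x' : l2norm (col_mx (x' - x) (ys x' - ys x)) <= a * l2norm (x' - x).
  rewrite -ler_sqr ?nnegrE ?mulr_ge0 ?l2norm_ge0// exprMn.
  by rewrite (@sqr_sqrtr _ (1 + kap ^+ 2)) ?addr_ge0 ?sqr_ge0// col_mx_ystar_le.
exists (L * a + tau * a * (M / mu) + L * (C1 mu L M rho * a)).
  by rewrite !addr_ge0// ?mulr_ge0.
move=> x x'; set z := l2norm (x' - x).
rewrite /hyper affine_sub.
rewrite (le_trans (l2normB _ _))// 2!mulrDl; apply: lerD; last first.
  rewrite (le_trans (jac_xy_le greg _ _ _ tau_ge0 (ltW L_gt0)))// -mulrA ler_wpM2l ?(ltW L_gt0)//.
  rewrite -ler_sqr ?nnegrE ?mulr_ge0 ?l2norm_ge0//.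
  have -> : (C1 mu L M rho * a * z) ^+ 2 = C1 mu L M rho ^+ 2 * a ^+ 2 * z ^+ 2 by ring.
  by rewrite (@sqr_sqrtr _ (1 + kap ^+ 2)) ?addr_ge0 ?sqr_ge0// vs_lipschitz.
rewrite (le_trans (l2normB _ _))//; apply: lerD.
  rewrite (le_trans (grad_x_lipschitz _ _ _ _ lf))// -mulrA ler_wpM2l ?za// ltW.
rewrite (le_trans (jac_xy_lipschitz greg _ _ _ _ _))//.
have -> : tau * a * (M / mu) * z = tau * (a * z) * (M / mu) by ring.
apply: ler_pM; rewrite ?mulr_ge0 ?l2norm_ge0 ?vs_le//.
by rewrite ler_wpM2l ?za.
Qed.

End Hypergradient.

(** Syntax-directed, so as never to compare numerals up to conversion. *)
Ltac nonneg := repeat lazymatch goal with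
  | |- is_true (_ <= _ ^+ _) => first [exact: sqr_ge0 | apply: exprn_ge0]
  | |- is_true (_ <= _ * _) => apply: mulr_ge0
  | |- is_true (_ <= _^-1) => rewrite invr_ge0
  | |- is_true (_ <= _ - _) => first [assumption | (apply: ltW; assumption) | rewrite subr_ge0]
  | |- is_true (_ <= _ + _) => first [assumption | (apply: ltW; assumption) | apply: addr_ge0]
  | |- is_true (_ <= _%:R) => exact: ler0n
  | |- is_true (_ <= 1) => first [exact: ler01 | assumption | (apply: ltW; assumption)]
  | |- is_true (_ <= l2norm _) => exact: l2norm_ge0
  | |- _ => first [assumption | (apply: ltW; assumption) | exact: sqr_ge0 | done]
  end.

(** * Recursive inequalities *)

Section Recursions.
Variable R : realFieldType.

Lemma sqr_convex_le (a u w : R) : 0 <= a <= 1 ->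
  (a * u + (1 - a) * w) ^+ 2 <= a * u ^+ 2 + (1 - a) * w ^+ 2.
Proof.
move=> /andP[a0 a1]; rewrite -subr_ge0.
rewrite (_ : _ - _ = a * (1 - a) * (u - w) ^+ 2); last by ring.
by nonneg.
Qed.

(** Young's inequality with the weight that spends half of the contraction. *)
Lemma contraction_young (A u w : R) : 0 <= A < 1 ->
  A * (u + w) ^+ 2 <= (1 - (1 - A) / 2) * u ^+ 2 + 2 * A / (1 - A) * w ^+ 2.
Proof.
move=> /andP[A0 A1]; have A1' : 0 < 1 - A by rewrite subr_gt0.
rewrite -subr_ge0.
rewrite (_ : _ - _ = (1 - A) / 2 * (u - 2 * A / (1 - A) * w) ^+ 2 + A * w ^+ 2); last first.
  by field; rewrite gt_eqF.
by rewrite addr_ge0// mulr_ge0 ?sqr_ge0// divr_ge0// ltW.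
Qed.

(** The weights with which the perturbations w i enter after n steps of the
    recursion u' <= a * u + (1 - a) * w i; they sum to 1 - a ^+ n. *)
Definition geometric_average (a : R) (n : nat) (w : nat -> R) : R :=
  \sum_(i < n) (1 - a) * a ^+ (n.-1 - i) * w i.

Lemma geometric_averageS a n w : geometric_average a n.+1 w =
  a * geometric_average a n w + (1 - a) * w n.
Proof.
rewrite /geometric_average big_ord_recr/= subnn expr0 mulr1; congr (_ + _).
rewrite mulr_sumr; apply: eq_bigr => i _.
rewrite !mulrA [a * _]mulrC -!mulrA; congr (_ * _); rewrite !mulrA -exprS.
by congr (a ^+ _ * _); have := ltn_ord i; lia.
Qed.

Lemma geometric_average_cst a n c : geometric_average a n (fun=> c) = (1 - a ^+ n) * c.
Proof.
elim: n => [|n IH]; first by rewrite /geometric_average big_ord0 expr0 subrr mul0r.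
by rewrite geometric_averageS IH exprS; ring.
Qed.

Lemma contraction_iter a (u w : nat -> R) n : 0 <= a ->
  (forall t, u t.+1 <= a * u t + (1 - a) * w t) ->
  u n <= a ^+ n * u 0%N + geometric_average a n w.
Proof.
move=> a0 uw; elim: n => [|n IH].
  by rewrite /geometric_average big_ord0 mul1r addr0.
rewrite (le_trans (uw n))// geometric_averageS addrA lerD2r exprS -mulrA -mulrDr.
by rewrite ler_wpM2l.
Qed.

Lemma telescope_le (c d : R) (V G N : nat -> R) K :
  (forall k, V k.+1 + c * G k <= V k + d * N k) ->
  V K + c * \sum_(k < K) G k <= V 0%N + d * \sum_(k < K) N k.
Proof.
move=> step; elim: K => [|m IH]; first by rewrite !big_ord0 !mulr0.
rewrite !big_ord_recr/= !mulrDr; have := step m; lra.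
Qed.

Lemma telescope_conclude (PK lo P0 dK d0 d0' eK e0 s1 s2 : R) :
  PK + dK + eK + s1 <= P0 + d0 + e0 + s2 -> 0 <= dK -> 0 <= eK -> d0 <= d0' ->
  lo <= PK -> s1 <= P0 - lo + d0' + e0 + s2.
Proof. lra. Qed.

(** The weights are tuned so that in the sum of the three recursions the
    coefficients of D and e telescope; the hypothesis on h then discards the
    squared step. *)
Lemma lyapunov_step (al L C1 Cb A B cx cv qq Ph Ph' G H D D' e e' Nh Ny Nv : R) :
  0 < al -> 0 <= A < 1 -> 0 <= B < 1 -> 0 <= H ->
  let W' := 2 / (1 - A) * al * (Cb ^+ 2 + 12 * L ^+ 2 * C1 ^+ 2) in
  let Wy := W' - 12 * al * L ^+ 2 * C1 ^+ 2 in
  let Wv := 4 * al * L ^+ 2 / (1 - B) in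
  W' * (2 * A / (1 - A)) * cx * al ^+ 2 + Wv * (2 * B / (1 - B)) * cv * al ^+ 2
     + qq * al ^+ 2 <= al / 2 ->
  Ph' <= Ph - al / 2 * G - (al / 2 - qq * al ^+ 2) * H
         + al / 2 * (2 * Cb ^+ 2 * D + 4 * L ^+ 2 * e + 8 * Nh) ->
  D' <= (1 - (1 - A) / 2) * D + 2 * A / (1 - A) * (cx * al ^+ 2 * H) + Ny ->
  e' <= (1 - (1 - B) / 2) * e + 2 * B / (1 - B) * (cv * al ^+ 2 * H)
         + (1 - B) * (3 * C1 ^+ 2 * D') + 3 * Nv ->
  Ph' + Wy * D' + Wv * e' + al / 2 * G
    <= Ph + Wy * D + Wv * e + (4 * al * Nh + W' * Ny + 3 * Wv * Nv).
Proof.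
move=> al0 /andP[A0 A1] /andP[B0 B1] H0 W' Wy Wv hc hP hD he.
have A1' : 0 < 1 - A by rewrite subr_gt0.
have B1' : 0 < 1 - B by rewrite subr_gt0.
have W'0 : 0 <= W' by rewrite /W'; nonneg.
have Wv0 : 0 <= Wv.
  by have Bi := ltW B1'; rewrite /Wv; nonneg.
have kD := ler_wpM2l W'0 hD; have ke := ler_wpM2l Wv0 he.
have kH := ler_wpM2r H0 hc.
have E1 : Wv * (1 - B) = 4 * al * L ^+ 2 by rewrite /Wv divfK ?gt_eqF.
have E2 : W' * (1 - A) = 2 * al * (Cb ^+ 2 + 12 * L ^+ 2 * C1 ^+ 2).
  by rewrite /W'; field; rewrite gt_eqF.
have F1 : Wv * ((1 - (1 - B) / 2) * e + 2 * B / (1 - B) * (cv * al ^+ 2 * H)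
         + (1 - B) * (3 * C1 ^+ 2 * D') + 3 * Nv)
   = Wv * e - (Wv * (1 - B)) / 2 * e + Wv * (2 * B / (1 - B)) * cv * al ^+ 2 * H
     + (Wv * (1 - B)) * 3 * C1 ^+ 2 * D' + 3 * Wv * Nv by ring.
have F2 : W' * ((1 - (1 - A) / 2) * D + 2 * A / (1 - A) * (cx * al ^+ 2 * H) + Ny)
   = W' * D - (W' * (1 - A)) / 2 * D + W' * (2 * A / (1 - A)) * cx * al ^+ 2 * H
     + W' * Ny by ring.
rewrite F1 E1 in ke; rewrite F2 E2 in kD.
rewrite /Wy; move: kD ke kH hP; clear.
move: (W' * (2 * A / (1 - A)) * cx * al ^+ 2) (Wv * (2 * B / (1 - B)) * cv * al ^+ 2).
move: W' Wv => w1 w2 z1 z2; lra.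
Qed.

End Recursions.

(** * Batch means and their noise *)

Section BatchMean.
Variables (R : realType) (S : Type).

Definition noise (V : lmodType R) (s : seq S) (h : S -> V) (h0 : V) : V :=
  batch_mean s h - h0.

Lemma batch_mean_mulmx m n (s : seq S) (A : S -> 'M[R]_(m, n)) (v : 'cV[R]_n) :
  batch_mean s A *m v = batch_mean s (fun a => A a *m v).
Proof. by rewrite /batch_mean -scalemxAl mulmx_suml. Qed.

Lemma noise_mulmx m n (s : seq S) (A : S -> 'M[R]_(m, n)) A0 (v : 'cV[R]_n) :
  noise s A A0 *m v = noise s (fun a => A a *m v) (A0 *m v).
Proof. by rewrite /noise mulmxBl batch_mean_mulmx. Qed.

Lemma l2norm_batch_mean_le n (s : seq S) (h : S -> 'cV[R]_n) c :
  0 <= c -> (forall a, l2norm (h a) <= c) -> l2norm (batch_mean s h) <= c.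
Proof.
move=> c0 hc; rewrite /batch_mean l2normZ ger0_norm ?invr_ge0//.
have [s0|s0] := posnP (size s); first by rewrite s0 invr0 mul0r.
rewrite mulrC ler_pdivrMr ?ltr0n// (le_trans (l2norm_sum _ _))//.
have -> : c * (size s)%:R = \sum_(a <- s) c.
  by rewrite big_const_seq count_predT iter_addr_0 mulr_natr.
exact: ler_sum.
Qed.

Lemma batch_mean_affine n (s : seq S) (h : S -> 'cV[R]_n) w t : (0 < size s)%N ->
  w - t *: batch_mean s h = batch_mean s (fun a => w - t *: h a).
Proof.
move=> s0; rewrite /batch_mean sumrB scalerBr; congr (_ - _).
  rewrite big_const_seq count_predT iter_addr_0 -(scaler_nat (size s) w) scalerA mulVf ?scale1r//.
  by rewrite pnatr_eq0 -lt0n.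
by rewrite scalerA mulrC -scalerA scaler_sumr.
Qed.

End BatchMean.

Lemma l2normBD (R : realType) n (u w z : 'cV[R]_n) :
  l2norm (u - w + z) <= l2norm z + l2norm u + l2norm w.
Proof.
rewrite (le_trans (l2normD _ _))// addrC -addrA lerD2l; exact: l2normB.
Qed.

(** * One run of the algorithm on given samples *)

Section Run.
Variables (R : realType) (p q : nat) (pb : bilevel_problem R p q).
Variables (L M tau rho mu : R).
Hypotheses (L_gt0 : 0 < L) (M_ge0 : 0 <= M) (tau_ge0 : 0 <= tau) (rho_ge0 : 0 <= rho).
Hypotheses (mu_gt0 : 0 < mu) (q_gt0 : (0 < q)%N).
Hypothesis asm1 : assumption1 pb mu.
Hypothesis asm2 : assumption2 pb L M tau rho.

Local Notation f := (f_ pb).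
Local Notation g := (g_ pb).
Local Notation ys := (ystar pb).
Local Notation vstar := (vs f g ys).
Local Notation kap := (L / mu).

Lemma gsc x : strongly_convex mu (g x). Proof. by case: asm1. Qed.
Lemma Gsc zeta x : strongly_convex mu (G_ (pb := pb) zeta x).
Proof. by have [_ + _] := asm1; exact. Qed.
Lemma freg : upper_regular L M f. Proof. by case: asm2. Qed.
Lemma greg : lower_regular L tau rho g. Proof. by case: asm2. Qed.
Lemma Freg xi : upper_regular L M (F_ (pb := pb) xi).
Proof. by have [_ _ + _] := asm2; exact. Qed.
Lemma Greg zeta : lower_regular L tau rho (G_ (pb := pb) zeta).
Proof. by have [_ _ _] := asm2; exact. Qed.

Lemma g_has_gradient x : has_gradient (g x).
Proof.
by apply: joint_has_gradient_y; case: greg => /differentiable_has_gradient.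
Qed.

Lemma g_gradient_lipschitz x : lipschitz_for (@l2norm R q) L (gradient (g x)).
Proof. by apply: gradient_y_lipschitz; case: greg. Qed.

Lemma mu_le_L : mu <= L.
Proof.
exact: (strong_convexity_le_smoothness (g_has_gradient 0) (g_gradient_lipschitz 0) (gsc 0)).
Qed.

(** The lower-level problem has a minimizer where the gradient vanishes, and
    strong convexity makes it the only minimizer. *)
Lemma ystar_stationary x : grad_y g x (ys x) = 0.
Proof.
have [y [y0 ymin]] := strongly_convex_minimizer mu_gt0 (g_has_gradient x)
  (g_gradient_lipschitz x) (gsc x) L_gt0 mu_le_L.
have ysmin : forall y', g x (ys x) <= g x y'.
  by rewrite /ystar; case: xgetP => [z -> //|/(_ y)]; exact.
have := strongly_convex_tangent (g_has_gradient x) (g_gradient_lipschitz x) (gsc x) y (ys x).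
rewrite y0 dot0l addr0 => h.
suff -> : ys x = y by [].
apply/eqP; rewrite -subr_eq0; apply/eqP/l2norm0_eq0/eqP.
rewrite -sqrf_eq0 eq_le sqr_ge0 andbT.
have h0 : 0 < mu / 2 by rewrite divr_gt0.
by rewrite -(pmulr_rle0 _ h0); have := ysmin y; lra.
Qed.

Let hs := ystar_stationary.

Lemma Phi_gradient x : gradient (Phi pb) x = hyper f g ys x.
Proof.
exact: (gradient_hyper L_gt0 M_ge0 tau_ge0 rho_ge0 mu_gt0 mu_le_L freg greg gsc hs).
Qed.

Lemma kap_ge1 : 1 <= kap.
Proof. by rewrite ler_pdivlMr// mul1r mu_le_L. Qed.

Lemma vstar_le x : l2norm (vstar x) <= M / mu.
Proof. exact: (vs_le ys L_gt0 M_ge0 mu_gt0 mu_le_L freg greg gsc). Qed.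

Section Steps.
Variables (beta eta : R).
Hypotheses (beta_gt0 : 0 < beta) (beta_le : beta <= 2 / (mu + L)) (beta_mu : beta * mu <= 1).
Hypotheses (eta_gt0 : 0 < eta) (eta_le : eta <= 2 / (mu + L)) (eta_mu : eta * mu <= 1).

Local Notation a := (1 - beta * mu).
Local Notation b := (1 - eta * mu).

Let a01 : 0 <= a <= 1.
Proof. by rewrite subr_ge0 beta_mu gerBl mulr_ge0// ltW. Qed.
Let b01 : 0 <= b <= 1.
Proof. by rewrite subr_ge0 eta_mu gerBl mulr_ge0// ltW. Qed.

Definition y_noise S x y t : R :=
  let yt := y_loop beta S x y t in
  l2norm (noise (S t) (fun zeta => grad_y (G_ (pb := pb) zeta) x yt) (grad_y g x yt)) ^+ 2.

(** The exact gradient step contracts by a, and the noise is beta times n, that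
    is (1 - a) times n / mu; convexity of the square then avoids any cross term
    between the error and the noise. *)
Lemma y_loop_step S x y t :
  l2norm (y_loop beta S x y t.+1 - ys x) ^+ 2
    <= a * l2norm (y_loop beta S x y t - ys x) ^+ 2
       + (1 - a) * (y_noise S x y t / mu ^+ 2).
Proof.
rewrite /y_noise /=; set yt := y_loop beta S x y t; set n := noise _ _ _.
have -> : yt - beta *: batch_mean (S t) (fun zeta => grad_y (G_ zeta) x yt) - ys x
   = ((yt - beta *: gradient (g x) yt) - (ys x - beta *: gradient (g x) (ys x))) - beta *: n.
  have -> : gradient (g x) (ys x) = 0 by exact: hs.
  rewrite scaler0 subr0 /n /noise scalerBr -/(grad_y g x yt).
  by move: (beta *: batch_mean _ _) (beta *: grad_y g x yt) => u w; apply/matrixP => i j; rewrite !mxE; ring.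
have h1 := gradient_step_contraction mu_gt0 (g_has_gradient x) (g_gradient_lipschitz x)
  (gsc x) (ys x) yt (ltW beta_gt0) beta_le L_gt0 beta_mu.
have h2 : l2norm (((yt - beta *: gradient (g x) yt) - (ys x - beta *: gradient (g x) (ys x))) - beta *: n)
   <= a * l2norm (yt - ys x) + (1 - a) * (l2norm n / mu).
  rewrite (le_trans (l2normB _ _))//; apply: lerD => //.
  by rewrite l2normZ gtr0_norm// subKr -mulrA ler_pM2l// mulrCA mulfV ?mulr1 ?gt_eqF.
have := sqr_convex_le (l2norm (yt - ys x)) (l2norm n / mu) a01.
rewrite expr_div_n; apply: le_trans.
by rewrite ler_sqr ?nnegrE ?l2norm_ge0// (le_trans (l2norm_ge0 _) h2).
Qed.

Definition y_noise_avg S x y T : R :=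
  geometric_average a T (fun t => y_noise S x y t / mu ^+ 2).

Lemma y_loop_error S x y T :
  l2norm (y_loop beta S x y T - ys x) ^+ 2
    <= a ^+ T * l2norm (y - ys x) ^+ 2 + y_noise_avg S x y T.
Proof.
case/andP: a01 => a0 _.
exact: (@contraction_iter _ a (fun t => l2norm (y_loop beta S x y t - ys x) ^+ 2) _ T a0 (y_loop_step S x y)).
Qed.

Lemma sampled_hess_contraction (B : seq (zeta_space pb)) x y w : (0 < size B)%N ->
  l2norm ((1%:M - eta *: batch_mean B (fun zeta => hess_y (G_ zeta) x y)) *m w)
    <= b * l2norm w.
Proof.
move=> B0; rewrite mulmxBl mul1mx -scalemxAl batch_mean_mulmx batch_mean_affine//.
case/andP: b01 => b0 _.
apply: l2norm_batch_mean_le => [|zeta]; first by rewrite mulr_ge0 ?l2norm_ge0.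
exact: (hess_y_contraction (Greg zeta) mu_gt0 L_gt0 (Gsc zeta) _ _ _ (ltW eta_gt0)).
Qed.

Lemma sampled_grad_y_le (D : seq (xi_space pb)) x y :
  l2norm (batch_mean D (fun xi => grad_y (F_ xi) x y)) <= M.
Proof. by apply: l2norm_batch_mean_le => // xi; exact: (grad_y_le M_ge0 (Freg xi)). Qed.

(** Whatever the samples, a step takes v to a point of norm at most
    (1 - eta mu) |v| + eta M, and M / mu is the fixed point of this map. *)
Lemma v_loop_le (B : nat -> seq (zeta_space pb)) D x y v j :
  (forall j, (0 < size (B j))%N) -> l2norm v <= M / mu ->
  l2norm (v_loop eta B D x y v j) <= M / mu.
Proof.
move=> B0 v0; elim: j => [//|j IH] /=; case/andP: b01 => b0 _.
rewrite (le_trans (l2normD _ _))// l2normZ gtr0_norm//.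
have h1 := le_trans (sampled_hess_contraction x y (v_loop eta B D x y v j) (B0 j)) (ler_wpM2l b0 IH).
have h2 := ler_wpM2l (ltW eta_gt0) (sampled_grad_y_le (D j) x y).
apply: le_trans (lerD h1 h2) _.
by rewrite (_ : _ + _ = M / mu)//; field; rewrite gt_eqF.
Qed.

Definition v_noise (B : nat -> seq (zeta_space pb)) D x y j : R :=
  l2norm (noise (D j) (fun xi => grad_y (F_ (pb := pb) xi) x y) (grad_y f x y)) ^+ 2
  + l2norm (noise (B j) (fun zeta => hess_y (G_ zeta) x y) (hess_y g x y) *m vstar x) ^+ 2.

(** The error is contracted by the sampled matrix itself, so that the noise of
    the Hessian only acts on vstar, which does not depend on the iteration. *)
Lemma v_loop_step B D x y v j : (0 < size (B j))%N ->
  l2norm (v_loop eta B D x y v j.+1 - vstar x) ^+ 2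
    <= b * l2norm (v_loop eta B D x y v j - vstar x) ^+ 2
       + (1 - b) * (3 * C1 mu L M rho ^+ 2 * l2norm (y - ys x) ^+ 2
                    + 3 * (v_noise B D x y j / mu ^+ 2)).
Proof.
move=> B0; rewrite /v_noise /=; set vj := v_loop eta B D x y v j.
set nF := noise _ _ _; set nH := noise _ _ _.
set HB := batch_mean _ (fun zeta => hess_y (G_ zeta) x y).
set bD := batch_mean _ _.
pose r := nF - nH *m vstar x + (grad_y f x y - hess_y g x y *m vstar x).
have -> : (1%:M - eta *: HB) *m vj + eta *: bD - vstar x
   = (1%:M - eta *: HB) *m (vj - vstar x) + eta *: r.
  have -> : r = bD - HB *m vstar x.
    rewrite /r /nF /nH /noise mulmxBl -/HB -/bD.
    move: (grad_y f x y) (hess_y g x y *m vstar x) (HB *m vstar x) => u w z.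
    by apply/matrixP => i k; rewrite !mxE; ring.
  rewrite !mulmxBl !mul1mx -!scalemxAl mulmxBr !scalerBr.
  move: (HB *m vj) (HB *m vstar x) => u w.
  by apply/matrixP => i k; rewrite !mxE; ring.
set c1 := C1 mu L M rho; set dy := l2norm (y - ys x).
have hr : l2norm r <= mu * c1 * dy + l2norm nF + l2norm (nH *m vstar x).
  apply: le_trans (l2normBD _ _ _) _; rewrite 2!lerD2r.
  have := vs_residual ys L_gt0 M_ge0 rho_ge0 mu_gt0 mu_le_L freg greg gsc x x y.
  by rewrite (subrr x) l2norm_0col_mx.
set w := l2norm r / mu.
have h2 : l2norm ((1%:M - eta *: HB) *m (vj - vstar x) + eta *: r)
   <= b * l2norm (vj - vstar x) + (1 - b) * w.
  rewrite (le_trans (l2normD _ _))//; apply: lerD; first exact: sampled_hess_contraction.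
  by rewrite l2normZ gtr0_norm// subKr -mulrA ler_pM2l// mulrCA mulfV ?mulr1 ?gt_eqF.
have := sqr_convex_le (l2norm (vj - vstar x)) w b01.
have h3 : w ^+ 2 <= 3 * c1 ^+ 2 * dy ^+ 2 + 3 * ((l2norm nF ^+ 2 + l2norm (nH *m vstar x) ^+ 2) / mu ^+ 2).
  rewrite expr_div_n ler_pdivrMr ?exprn_gt0// mulrDl.
  rewrite -[3 * (_ / _) * _]mulrA divfK ?gt_eqF ?exprn_gt0//.
  have hr2 : l2norm r ^+ 2 <= (mu * c1 * dy + l2norm nF + l2norm (nH *m vstar x)) ^+ 2.
    by rewrite ler_sqr ?nnegrE ?l2norm_ge0// (le_trans (l2norm_ge0 _) hr).
  apply: le_trans hr2 _; move: (l2norm nF) (l2norm (nH *m _)) => u z.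
  have := sqr_ge0 (mu * c1 * dy - u); have := sqr_ge0 (mu * c1 * dy - z); have := sqr_ge0 (u - z).
  lra.
move=> h4; apply: le_trans (le_trans _ h4) _.
  by rewrite ler_sqr ?nnegrE ?l2norm_ge0// (le_trans (l2norm_ge0 _) h2).
by rewrite lerD2l ler_wpM2l// subKr mulr_ge0// ltW.
Qed.

Definition v_noise_avg B D x y J : R :=
  geometric_average b J (fun j => v_noise B D x y j / mu ^+ 2).

Lemma v_loop_error B D x y v J : (forall j, (0 < size (B j))%N) ->
  l2norm (v_loop eta B D x y v J - vstar x) ^+ 2
    <= b ^+ J * l2norm (v - vstar x) ^+ 2
       + (1 - b ^+ J) * (3 * C1 mu L M rho ^+ 2 * l2norm (y - ys x) ^+ 2)
       + 3 * v_noise_avg B D x y J.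
Proof.
move=> B0; case/andP: b01 => b0 _.
have := @contraction_iter _ b (fun j => l2norm (v_loop eta B D x y v j - vstar x) ^+ 2) _ J b0
  (fun j => v_loop_step D x y v (B0 j)).
move=> /le_trans; apply; rewrite -addrA lerD2l.
rewrite -geometric_average_cst /v_noise_avg /geometric_average mulr_sumr -big_split/=.
by rewrite le_eqVlt; apply/orP; left; apply/eqP/eq_bigr => i _; ring.
Qed.

Variables (alpha : R) (T J : nat) (x0 : 'cV[R]_p) (y0 v0 : 'cV[R]_q).
Variable D : sample_sets (xi_space pb) (zeta_space pb).
Hypothesis alpha_gt0 : 0 < alpha.
Hypotheses (T_gt0 : (0 < T)%N) (J_gt0 : (0 < J)%N).
Hypothesis B_nonempty : forall k j, (0 < size (B_set D k j))%N.
Hypothesis v0_le : l2norm v0 <= M / mu.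

Local Notation st k := (ssgd alpha beta eta T J D x0 y0 v0 k).
Local Notation xk k := (st k).1.1.
Local Notation yk k := (st k).1.2.
Local Notation vk k := (st k).2.
Local Notation hk k := (hypergrad (DF_set D k) (DG_set D k) (xk k) (yk k) (vk k)).

Lemma ssgdS k : [/\ xk k.+1 = xk k - alpha *: hk k,
  yk k.+1 = y_loop beta (S_set D k) (xk k.+1) (yk k) T &
  vk k.+1 = v_loop eta (B_set D k) (DFj_set D k) (xk k.+1) (yk k.+1) (vk k) J].
Proof. by rewrite /=; case: (ssgd _ _ _ _ _ _ _ _ _ k) => [[x y] v]. Qed.

Lemma vk_le k : l2norm (vk k) <= M / mu.
Proof.
elim: k => [//|k IH]; have [_ _ ->] := ssgdS k.
by apply: v_loop_le => // j; exact: B_nonempty.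
Qed.

Definition h_noise (DF : seq (xi_space pb)) (DG : seq (zeta_space pb)) x y v : R :=
  l2norm (noise DF (fun xi => grad_x (F_ xi) x y) (grad_x f x y)) ^+ 2
  + l2norm (noise DG (fun zeta => jac_xy (G_ zeta) x y) (jac_xy g x y) *m v) ^+ 2.

(** The four sources of error are separated by Cauchy-Schwarz with weights
    1/2, 1/4, 1/8 and 1/8. *)
Lemma hypergrad_error DF DG x y v :
  l2norm (hypergrad DF DG x y v - hyper f g ys x) ^+ 2
    <= 2 * Cbar1 mu L M tau ^+ 2 * l2norm (y - ys x) ^+ 2
       + 4 * L ^+ 2 * l2norm (v - vstar x) ^+ 2 + 8 * h_noise DF DG x y v.
Proof.
rewrite /h_noise; set n1 := noise _ _ _; set n2 := noise _ _ _.
have E : hypergrad DF DG x y v - hyper f g ys x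
   = ((grad_x f x y - jac_xy g x y *m v) - hyper f g ys x) + (n1 - n2 *m v).
  rewrite /hypergrad /n1 /n2 /noise mulmxBl.
  move: (grad_x f x y) (jac_xy g x y *m v) (hyper f g ys x) (_ *m v) => u w z s.
  by apply/matrixP => i j; rewrite !mxE; ring.
have h := hyper_error ys L_gt0 M_ge0 tau_ge0 mu_gt0 mu_le_L freg greg gsc x y v.
set c1 := Cbar1 mu L M tau in h *; set dy := l2norm (y - ys x) in h *.
set dv := l2norm (v - vstar x) in h *.
have h2 : l2norm (hypergrad DF DG x y v - hyper f g ys x) <=
   c1 * dy + L * dv + (l2norm n1 + l2norm (n2 *m v)).
  by rewrite E (le_trans (l2normD _ _))//; apply: lerD => //; exact: l2normB.
have h3 : l2norm (hypergrad DF DG x y v - hyper f g ys x) ^+ 2 <=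
   (c1 * dy + L * dv + (l2norm n1 + l2norm (n2 *m v))) ^+ 2.
  by rewrite ler_sqr ?nnegrE ?l2norm_ge0// (le_trans (l2norm_ge0 _) h2).
apply: le_trans h3 _; move: (l2norm n1) (l2norm (n2 *m v)) => u z.
have := sqr_ge0 (c1 * dy - 2 * (L * dv)); have := sqr_ge0 (c1 * dy - 2 * (u + z)).
have := sqr_ge0 (L * dv - (u + z)); have := sqr_ge0 (u - z); have := sqr_ge0 (c1 * dy - (L * dv) - (u + z)).
have := sqr_ge0 (c1 * dy - L * dv - (u + z)).
nra.
Qed.

Let Ph k := Phi pb (xk k).
Let Gk k := l2norm (gradient (Phi pb) (xk k)) ^+ 2.
Let Hk k := l2norm (hk k) ^+ 2.
Let Dk k := l2norm (yk k - ys (xk k)) ^+ 2.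
Let ek k := l2norm (vk k - vstar (xk k)) ^+ 2.

Definition h_noise_at k := h_noise (DF_set D k) (DG_set D k) (xk k) (yk k) (vk k).
Definition y_noise_at k := y_noise_avg (S_set D k) (xk k.+1) (yk k) T.
Definition v_noise_at k := v_noise_avg (B_set D k) (DFj_set D k) (xk k.+1) (yk k.+1) J.

Lemma descent k :
  Ph k.+1 <= Ph k - alpha / 2 * Gk k - (alpha / 2 - curvature L M tau rho mu * alpha ^+ 2) * Hk k
     + alpha / 2 * (2 * Cbar1 mu L M tau ^+ 2 * Dk k + 4 * L ^+ 2 * ek k + 8 * h_noise_at k).
Proof.
have [xE _ _] := ssgdS k.
have := hyper_expansion L_gt0 M_ge0 tau_ge0 rho_ge0 mu_gt0 mu_le_L freg greg gsc hs
  (xk k) (- (alpha *: hk k)).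
have := hypergrad_error (DF_set D k) (DG_set D k) (xk k) (yk k) (vk k).
rewrite -xE -/(Phi pb (xk k.+1)) -/(Phi pb (xk k)) -/(Ph k.+1) -/(Ph k) -/(h_noise_at k).
rewrite /Gk Phi_gradient -/(Dk k) -/(ek k) /Hk.
move: (hk k) (hyper f g ys (xk k)) => h G.
rewrite l2normN l2normZ exprMn (gtr0_norm alpha_gt0) !dotE => h1.
move=> /(le_trans (ler_norm _)) h2.
rewrite l2norm_sqr !dotE (dotC h G) in h1.
rewrite !l2norm_sqr in h2 *.
have h3 := ler_wpM2l (ltW (divr_gt0 alpha_gt0 (ltr0n _ 2))) h1.
lra.
Qed.

Let A := a ^+ T.
Let B := b ^+ J.

(** One half of the contraction of the inner loop absorbs the displacement of
    the lower-level solution caused by the step in x. *)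
Lemma lower_error k : beta * mu < 1 ->
  Dk k.+1 <= (1 - (1 - A) / 2) * Dk k + 2 * A / (1 - A) * (kap ^+ 2 * alpha ^+ 2 * Hk k)
    + y_noise_at k.
Proof.
move=> bm1; have [xE yE _] := ssgdS k.
rewrite /Dk yE; apply: le_trans (y_loop_error _ _ _ _) _; rewrite lerD2r -/A.
have A01 : 0 <= A < 1.
  case/andP: a01 => a0 a1; rewrite exprn_ge0//= exprn_ilt1// -?lt0n//.
  by rewrite gtrBl mulr_gt0.
have h1 : l2norm (yk k - ys (xk k.+1)) <=
    l2norm (yk k - ys (xk k)) + kap * (alpha * l2norm (hk k)).
  have := ystar_lipschitz L_gt0 mu_gt0 greg gsc hs (xk k.+1) (xk k).
  have -> : xk k - xk k.+1 = alpha *: hk k by rewrite xE opprB addrC subrK.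
  rewrite l2normZ gtr0_norm// => h.
  rewrite -(subrK (ys (xk k)) (yk k)) -addrA (le_trans (l2normD _ _))// subrK.
  exact: lerD.
case/andP: (A01) => A0 _.
apply: le_trans (ler_wpM2l A0 _) _; last first.
  have -> : kap ^+ 2 * alpha ^+ 2 * Hk k = (kap * (alpha * l2norm (hk k))) ^+ 2 by rewrite /Hk; ring.
  exact: contraction_young.
by rewrite ler_sqr ?nnegrE ?l2norm_ge0// (le_trans (l2norm_ge0 _) h1).
Qed.

Lemma linear_error k : eta * mu < 1 ->
  ek k.+1 <= (1 - (1 - B) / 2) * ek k
     + 2 * B / (1 - B) * (C1 mu L M rho ^+ 2 * (1 + kap ^+ 2) * alpha ^+ 2 * Hk k)
     + (1 - B) * (3 * C1 mu L M rho ^+ 2 * Dk k.+1) + 3 * v_noise_at k.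
Proof.
move=> em1; have [xE _ vE] := ssgdS k.
rewrite /ek vE; apply: le_trans (v_loop_error _ _ _ _ _ (B_nonempty k)) _.
rewrite !lerD2r -/B.
have B01 : 0 <= B < 1.
  case/andP: b01 => b0 b1; rewrite exprn_ge0//= exprn_ilt1// -?lt0n//.
  by rewrite gtrBl mulr_gt0.
pose w := l2norm (vstar (xk k) - vstar (xk k.+1)).
have h1 : l2norm (vk k - vstar (xk k.+1)) <= l2norm (vk k - vstar (xk k)) + w.
  have -> : vk k - vstar (xk k.+1) = (vk k - vstar (xk k)) + (vstar (xk k) - vstar (xk k.+1)).
    by rewrite addrA subrK.
  exact: l2normD.
have h2 : w ^+ 2 <= C1 mu L M rho ^+ 2 * (1 + kap ^+ 2) * alpha ^+ 2 * Hk k.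
  have := vs_lipschitz L_gt0 M_ge0 rho_ge0 mu_gt0 mu_le_L freg greg gsc hs (xk k.+1) (xk k).
  have -> : xk k - xk k.+1 = alpha *: hk k by rewrite xE opprB addrC subrK.
  have -> : l2norm (alpha *: hk k) ^+ 2 = alpha ^+ 2 * Hk k.
    by rewrite l2normZ gtr0_norm// exprMn.
  by rewrite mulrA.
case/andP: (B01) => B0 B1; have B1' : 0 <= 1 - B by rewrite subr_ge0 ltW.
apply: le_trans (ler_wpM2l B0 _) _; last first.
  apply: le_trans (contraction_young (l2norm (vk k - vstar (xk k))) w B01) _.
  by rewrite lerD2l ler_wpM2l//; nonneg.
by rewrite ler_sqr ?nnegrE ?l2norm_ge0// (le_trans (l2norm_ge0 _) h1).
Qed.

(** Divided by alpha, the Lyapunov function gives the weight weight_v to e and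
    weight_y - 12 L^2 C1^2 to D; the difference pays for the D-term in the
    recursion for e. *)
Definition weight_y : R :=
  2 / (1 - A) * (Cbar1 mu L M tau ^+ 2 + 12 * L ^+ 2 * C1 mu L M rho ^+ 2).
Definition weight_v : R := 4 * L ^+ 2 / (1 - B).

(** The function Phi + alpha (w_y D + w_v e) decreases along the run up to the
    sampling noise, for each realization of the samples; summing telescopes. *)
Lemma run_bound K lo : beta * mu < 1 -> eta * mu < 1 -> (forall x, lo <= Phi pb x) ->
  weight_y * (2 * A / (1 - A)) * kap ^+ 2 * alpha ^+ 2
    + weight_v * (2 * B / (1 - B)) * (C1 mu L M rho ^+ 2 * (1 + kap ^+ 2)) * alpha ^+ 2
    + curvature L M tau rho mu * alpha <= 1 / 2 ->
  \sum_(k < K) Gk k <=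
    2 / alpha * (Phi pb x0 - lo) + 2 * weight_y * l2norm (y0 - ys x0) ^+ 2
      + 2 * weight_v * l2norm (v0 - vstar x0) ^+ 2
    + \sum_(k < K) (8 * h_noise_at k + 2 * weight_y * y_noise_at k + 6 * weight_v * v_noise_at k).
Proof.
move=> bm1 em1 lo_le hc.
have A01 : 0 <= A < 1.
  case/andP: a01 => a0 a1; rewrite exprn_ge0//= exprn_ilt1// -?lt0n//.
  by rewrite gtrBl mulr_gt0.
have B01 : 0 <= B < 1.
  case/andP: b01 => b0 b1; rewrite exprn_ge0//= exprn_ilt1// -?lt0n//.
  by rewrite gtrBl mulr_gt0.
have A1' : 0 < 1 - A by case/andP: A01; rewrite subr_gt0.
have B1' : 0 < 1 - B by case/andP: B01; rewrite subr_gt0.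
set c1 := C1 mu L M rho; set cb := Cbar1 mu L M tau.
pose Wy := weight_y - 12 * L ^+ 2 * c1 ^+ 2.
have Wy0 : 0 <= Wy.
  rewrite subr_ge0 /weight_y -/c1 -/cb.
  have h1 : 12 * L ^+ 2 * c1 ^+ 2 <= cb ^+ 2 + 12 * L ^+ 2 * c1 ^+ 2 by rewrite lerDr sqr_ge0.
  apply: le_trans h1 _; rewrite -[leLHS]mul1r ler_wpM2r//; first by nonneg.
  by rewrite ler_pdivlMr// mul1r; case/andP: A01; lra.
have step k : Ph k.+1 + alpha * Wy * Dk k.+1 + alpha * weight_v * ek k.+1 + alpha / 2 * Gk k
   <= Ph k + alpha * Wy * Dk k + alpha * weight_v * ek k
      + alpha * (4 * h_noise_at k + weight_y * y_noise_at k + 3 * weight_v * v_noise_at k).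
  have hc' : 2 / (1 - A) * alpha * (cb ^+ 2 + 12 * L ^+ 2 * c1 ^+ 2) * (2 * A / (1 - A)) * kap ^+ 2 * alpha ^+ 2
    + 4 * alpha * L ^+ 2 / (1 - B) * (2 * B / (1 - B)) * (c1 ^+ 2 * (1 + kap ^+ 2)) * alpha ^+ 2
    + curvature L M tau rho mu * alpha ^+ 2 <= alpha / 2.
    have := ler_wpM2l (ltW alpha_gt0) hc; rewrite /weight_y /weight_v -/c1 -/cb.
    by congr (_ <= _); field; rewrite ?gt_eqF.
  have := lyapunov_step alpha_gt0 A01 B01 (sqr_ge0 (l2norm (hk k))) hc' (descent k)
    (lower_error k bm1) (linear_error k em1).
  rewrite -/c1 -/cb; congr (_ <= _); rewrite /Wy /weight_y /weight_v -/c1 -/cb; field; rewrite ?gt_eqF//.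
have tele : Ph K + alpha * Wy * Dk K + alpha * weight_v * ek K + alpha / 2 * \sum_(k < K) Gk k
   <= Ph 0%N + alpha * Wy * Dk 0%N + alpha * weight_v * ek 0%N
    + alpha * \sum_(k < K) (4 * h_noise_at k + weight_y * y_noise_at k + 3 * weight_v * v_noise_at k).
  exact: (@telescope_le _ (alpha / 2) alpha (fun k => Ph k + alpha * Wy * Dk k + alpha * weight_v * ek k) Gk
    (fun k => 4 * h_noise_at k + weight_y * y_noise_at k + 3 * weight_v * v_noise_at k) K step).
have hlo : lo <= Ph K by exact: lo_le.
have Wv0 : 0 <= weight_v by rewrite /weight_v; have := ltW B1' => ?; nonneg.
have p1 : 0 <= alpha * Wy * Dk K by nonneg.
have p2 : 0 <= alpha * weight_v * ek K by nonneg.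
have WyE : alpha * Wy * Dk 0%N <= alpha * weight_y * Dk 0%N.
  by rewrite ler_wpM2r ?sqr_ge0// ler_pM2l// gerBl; nonneg.
have a2 : 0 < alpha / 2 by rewrite divr_gt0.
rewrite -(ler_pM2l a2).
have -> : \sum_(k < K) (8 * h_noise_at k + 2 * weight_y * y_noise_at k + 6 * weight_v * v_noise_at k)
  = 2 * \sum_(k < K) (4 * h_noise_at k + weight_y * y_noise_at k + 3 * weight_v * v_noise_at k).
  by rewrite mulr_sumr; apply: eq_bigr => k _; ring.
move: tele; set s1 := \sum_(k < K) Gk k; set s2 := \sum_(k < K) (4 * h_noise_at k + _ + _) => tele.
rewrite (_ : alpha / 2 * (_ + _) = (Phi pb x0 - lo) + alpha * weight_y * l2norm (y0 - ys x0) ^+ 2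
   + alpha * weight_v * l2norm (v0 - vstar x0) ^+ 2 + alpha * s2); last by field; rewrite gt_eqF.
exact: (telescope_conclude tele p1 p2 WyE hlo).
Qed.

End Steps.

End Run.

(** * The prescribed stepsize *)

Ltac pos := repeat lazymatch goal with
  | |- is_true (_ < _ ^+ _) => apply: exprn_gt0
  | |- is_true (_ < _ * _) => apply: mulr_gt0
  | |- is_true (_ < _^-1) => rewrite invr_gt0
  | |- is_true (_ < _ + _) => first [assumption | apply: addr_gt0]
  | |- is_true (_ < _%:R) => exact: ltr0Sn
  | |- is_true (_ < 1) => exact: ltr01
  | |- _ => first [assumption | done]
  end.

Section StepsizeArithmetic.
Variables (R : realType) (L kap c1 cb al Z rho2 : R).
Hypotheses (L_gt0 : 0 < L) (kap_ge1 : 1 <= kap) (c1_ge_kap : kap <= c1) (cb_gt0 : 0 < cb).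
Hypotheses (al_gt0 : 0 < al) (rho2_gt0 : 0 < rho2) (Z_ge : 400 * kap * c1 ^+ 2 <= Z).
Hypothesis alpha_le1 : 8 * al * rho2 * Z * (kap ^+ 2 + 1) ^+ 2 <= 1.
Hypothesis alpha_le2 : 8 * al * L ^+ 2 * kap <= rho2.
Hypothesis alpha_le3 : al * cb ^+ 2 <= Z * rho2.

Let L0 : 0 <= L. Proof. exact: ltW. Qed.
Let kap_gt0 : 0 < kap. Proof. exact: lt_le_trans kap_ge1. Qed.
Let kap0 : 0 <= kap. Proof. exact: ltW. Qed.
Let kap_neq0 : kap != 0. Proof. by rewrite gt_eqF. Qed.
Let c1_gt0 : 0 < c1. Proof. exact: lt_le_trans c1_ge_kap. Qed.
Let c0 : 0 <= c1. Proof. exact: ltW. Qed.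
Let al0 : 0 <= al. Proof. exact: ltW. Qed.
Let cb0 : 0 <= cb. Proof. exact: ltW. Qed.
Let s0 : 0 < kap ^+ 2 + 1. Proof. by pos. Qed.
Let Z_gt0 : 0 < Z. Proof. by apply: lt_le_trans Z_ge; pos. Qed.

(** The first and the third bounds on alpha multiply to a bound on alpha * Cbar1
    where Z and rho2 cancel. *)
Lemma alpha_Cbar1 : 8 * (al * cb * (kap ^+ 2 + 1)) ^+ 2 <= 1.
Proof.
apply: le_trans alpha_le1.
have k : 0 <= 8 * al * (kap ^+ 2 + 1) ^+ 2 by nonneg.
have := ler_wpM2l k alpha_le3; lra.
Qed.

(** The first and the second bounds on alpha multiply to a bound on
    alpha * L * C1 where rho2 cancels and Z is traded for kappa * C1^2. *)
Lemma alpha_C1 : al * L * c1 * kap ^+ 3 <= 1 / 160.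
Proof.
have r0 := ltW rho2_gt0; have z0 := ltW Z_gt0; have k0 := kap0.
have p1 : 8 * al * L ^+ 2 * kap * (400 * kap * c1 ^+ 2) <= rho2 * Z.
  by apply: ler_pM; [nonneg|nonneg|exact: alpha_le2|exact: Z_ge].
have p2 : (8 * al * (kap ^+ 2 + 1) ^+ 2) * (8 * al * L ^+ 2 * kap * (400 * kap * c1 ^+ 2)) <= 1.
  apply: le_trans alpha_le1.
  have k : 0 <= 8 * al * (kap ^+ 2 + 1) ^+ 2 by nonneg.
  have := ler_wpM2l k p1; lra.
have p3 : (kap ^+ 2) ^+ 2 <= (kap ^+ 2 + 1) ^+ 2.
  by rewrite ler_sqr ?nnegrE ?addr_ge0 ?sqr_ge0// lerDl.
have q0 : 0 <= al ^+ 2 * L ^+ 2 * c1 ^+ 2 * kap ^+ 2 by nonneg.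
have p4 := ler_wpM2l q0 p3.
have p5 : (160 * (al * L * c1 * kap ^+ 3)) ^+ 2 <= 1 ^+ 2.
  rewrite expr1n; apply: le_trans p2; rewrite -subr_ge0.
  rewrite (_ : _ - _ = 160 ^+ 2 * (al ^+ 2 * L ^+ 2 * c1 ^+ 2 * kap ^+ 2 * (kap ^+ 2 + 1) ^+ 2
     - al ^+ 2 * L ^+ 2 * c1 ^+ 2 * kap ^+ 2 * (kap ^+ 2) ^+ 2)); last by ring.
  by rewrite mulr_ge0 ?sqr_ge0// subr_ge0.
have q : 0 <= 160 * (al * L * c1 * kap ^+ 3) by nonneg.
rewrite ler_sqr ?nnegrE// in p5; lra.
Qed.

Lemma frac_mono (x y : R) : 0 <= x -> x <= y -> y < 1 ->
  x / (1 - x) ^+ 2 <= y / (1 - y) ^+ 2.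
Proof.
move=> x0 xy y1; have x1 := le_lt_trans xy y1.
apply: ler_pM => //; first by rewrite invr_ge0 sqr_ge0.
rewrite lef_pV2 ?posrE ?exprn_gt0 ?subr_gt0//.
by rewrite ler_sqr ?nnegrE ?subr_ge0 ?(ltW x1) ?(ltW y1)// lerB.
Qed.

(** The three contributions to the curvature of Phi, with alpha factored in. *)
Lemma curvature_arith :
  al * L / 2 * (1 + kap ^+ 2) + (al * cb - al * L) * (1 + kap) + (al * L * c1 * kap - al * L * kap ^+ 2)
  <= al * cb * (1 + kap) + 2 / 160.
Proof.
have h1 := alpha_C1.
have [W WE] : exists W, W = al * L by eexists.
have W0 : 0 <= W by rewrite WE; nonneg.
rewrite -!WE in h1 *.
have k2 : kap <= kap ^+ 3 by rewrite -[leLHS]expr1 ler_weXn2l.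
have q1 : W * c1 * kap <= W * c1 * kap ^+ 3 by apply: ler_wpM2l => //; nonneg.
have q2 : W * kap ^+ 2 <= W * c1 * kap.
  by rewrite -mulrA expr2; apply: ler_wpM2l => //; apply: ler_wpM2r.
have q4 : W / 2 * (1 + kap ^+ 2) <= W * kap ^+ 2.
  have : 1 <= kap ^+ 2 by rewrite exprn_ege1.
  move: (kap ^+ 2) => z; nra.
have q5 : 0 <= W * (1 + kap) by nonneg.
lra.
Qed.

(** The numerical heart of the choice of alpha: writing X for alpha * Cbar1, the
    two leading terms are bounded through X * (kappa^2 + 1) <= 8^(-1/2). *)
Lemma leading_terms (X : R) : 0 <= X -> 8 * (X * (kap ^+ 2 + 1)) ^+ 2 <= 1 ->
  8 / 9 * ((kap + 1) * (2 * kap - 1)) * kap ^+ 2 * X ^+ 2 + X * (1 + kap) <= 9 / 20.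
Proof.
move=> X0 hX; have [s sE] : exists s, s = kap ^+ 2 + 1 by eexists.
have [Y YE] : exists Y, Y = X * s by eexists.
rewrite -sE -YE in hX; have s_gt0 : 0 < s by rewrite sE.
have Y0 : 0 <= Y by rewrite YE; nonneg.
have Yle : Y <= 3 / 8.
  have q : 0 <= (3 / 8 : R) by nonneg.
  rewrite -ler_sqr ?nnegrE//; lra.
have s2 : 0 < s ^+ 2 by rewrite exprn_gt0.
rewrite -(ler_pM2r s2).
have -> : (8 / 9 * ((kap + 1) * (2 * kap - 1)) * kap ^+ 2 * X ^+ 2 + X * (1 + kap)) * s ^+ 2
  = 8 / 9 * ((kap + 1) * (2 * kap - 1)) * kap ^+ 2 * Y ^+ 2 + Y * ((1 + kap) * s).
  by rewrite YE; ring.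
have k1 := kap_ge1.
have p0 : 0 <= 8 / 9 * ((kap + 1) * (2 * kap - 1)) * kap ^+ 2.
  have : 0 <= 2 * kap - 1 by lra.
  by move=> ?; nonneg.
have p1 : 8 / 9 * ((kap + 1) * (2 * kap - 1)) * kap ^+ 2 * Y ^+ 2 <=
   8 / 9 * ((kap + 1) * (2 * kap - 1)) * kap ^+ 2 * (1 / 8) by apply: ler_wpM2l => //; lra.
have p2 : Y * ((1 + kap) * s) <= 3 / 8 * ((1 + kap) * s).
  by apply: ler_wpM2r => //; nonneg.
apply: le_trans (lerD p1 p2) _; rewrite sE.
have : 0 <= kap - 1 by lra.
have [t tE] : exists t, t = kap - 1 by eexists.
have -> : kap = 1 + t by rewrite tE; ring.
rewrite addrAC subrr add0r => t0.
have t2 := mulr_ge0 t0 t0; have t3 := mulr_ge0 t2 t0; have t4 := mulr_ge0 t3 t0.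
rewrite -subr_ge0.
rewrite (_ : _ - _ = 1 / 360 * (28 + 126 * t + 196 * (t * t) + 153 * (t * t * t) + 82 * (t * t * t * t))); first by lra.
by field.
Qed.

(** With one inner step the contraction factors are the largest, so a and b are
    the worst case for A and B. *)
Lemma stepsize_arith (a b A B q : R) :
  a = 1 - 3 / (2 * (kap + 1)) -> b = 1 - (2 * kap)^-1 ->
  0 <= A -> 0 <= B -> A <= a -> B <= b ->
  q <= al * cb * (1 + kap) + 2 / 160 ->
  2 / (1 - A) * (cb ^+ 2 + 12 * L ^+ 2 * c1 ^+ 2) * (2 * A / (1 - A)) * kap ^+ 2 * al ^+ 2
    + 4 * L ^+ 2 / (1 - B) * (2 * B / (1 - B)) * (c1 ^+ 2 * (1 + kap ^+ 2)) * al ^+ 2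
    + q <= 1 / 2.
Proof.
move=> aE bE A0 B0 Aa Bb t3; have k1 := kap_ge1.
have kp : 0 < 2 * (kap + 1) by lra.
have a1 : a < 1 by rewrite aE gtrBl divr_gt0.
have b1 : b < 1 by rewrite bE gtrBl invr_gt0 mulr_gt0.
have fA : A / (1 - A) ^+ 2 <= 2 / 9 * ((kap + 1) * (2 * kap - 1)).
  apply: le_trans (frac_mono A0 Aa a1) _.
  rewrite aE le_eqVlt; apply/orP; left; apply/eqP; field.
  by rewrite gt_eqF//; lra.
have fB : B / (1 - B) ^+ 2 <= 4 * kap ^+ 2.
  apply: le_trans (frac_mono B0 Bb b1) _.
  rewrite bE subKr (_ : _ / _ = 4 * kap ^+ 2 - 2 * kap); first by lra.
  by field; rewrite kap_neq0.
have A1 : 1 - A != 0 by rewrite gt_eqF// subr_gt0 (le_lt_trans Aa).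
have B1 : 1 - B != 0 by rewrite gt_eqF// subr_gt0 (le_lt_trans Bb).
have [X XE] : exists X, X = al * cb by eexists.
have [W WE] : exists W, W = al * L * c1 by eexists.
have X0 : 0 <= X by rewrite XE; nonneg.
have W0 : 0 <= W by rewrite WE; nonneg.
have hW : W * kap ^+ 3 <= 1 / 160 by rewrite WE; exact: alpha_C1.
have hW2 : W ^+ 2 * kap ^+ 4 <= 1 / 160 * (1 / 160).
  have h : (W * kap ^+ 3) ^+ 2 <= (1 / 160) ^+ 2.
    have q' : 0 <= (1 / 160 : R) by nonneg.
    by rewrite ler_sqr ?nnegrE ?mulr_ge0 ?exprn_ge0.
  apply: (@le_trans _ _ ((W * kap ^+ 3) ^+ 2)); last by apply: le_trans h _; rewrite expr2.
  by rewrite exprMn ler_wpM2l ?sqr_ge0// -exprM ler_weXn2l.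
have -> : 2 / (1 - A) * (cb ^+ 2 + 12 * L ^+ 2 * c1 ^+ 2) * (2 * A / (1 - A)) * kap ^+ 2 * al ^+ 2
  = 4 * (A / (1 - A) ^+ 2) * (kap ^+ 2 * (X ^+ 2 + 12 * W ^+ 2)).
  by rewrite XE WE; field; rewrite A1.
have -> : 4 * L ^+ 2 / (1 - B) * (2 * B / (1 - B)) * (c1 ^+ 2 * (1 + kap ^+ 2)) * al ^+ 2
  = 8 * (B / (1 - B) ^+ 2) * ((1 + kap ^+ 2) * W ^+ 2).
  by rewrite WE; field; rewrite B1.
have t1 : 4 * (A / (1 - A) ^+ 2) * (kap ^+ 2 * (X ^+ 2 + 12 * W ^+ 2)) <=
   4 * (2 / 9 * ((kap + 1) * (2 * kap - 1))) * (kap ^+ 2 * (X ^+ 2 + 12 * W ^+ 2)).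
  by apply: ler_wpM2r; [nonneg|apply: ler_wpM2l].
have t2 : 8 * (B / (1 - B) ^+ 2) * ((1 + kap ^+ 2) * W ^+ 2) <=
   8 * (4 * kap ^+ 2) * ((1 + kap ^+ 2) * W ^+ 2).
  by apply: ler_wpM2r; [nonneg|apply: ler_wpM2l].
rewrite -XE in t3.
have t4 := alpha_Cbar1; rewrite -XE in t4; have {}t4 := leading_terms X0 t4.
have t5 : (kap + 1) * (2 * kap - 1) * kap ^+ 2 * W ^+ 2 <= 3 * (W ^+ 2 * kap ^+ 4).
  have : 0 <= W ^+ 2 * kap ^+ 2 by nonneg.
  have : (kap + 1) * (2 * kap - 1) <= 3 * kap ^+ 2 by nra.
  move=> h1 h2; have := ler_wpM2r h2 h1; lra.
have t6 : kap ^+ 2 * ((1 + kap ^+ 2) * W ^+ 2) <= 2 * (W ^+ 2 * kap ^+ 4).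
  have : 0 <= W ^+ 2 * kap ^+ 2 by nonneg.
  have : 1 + kap ^+ 2 <= 2 * kap ^+ 2.
    by have : 1 <= kap ^+ 2 by [rewrite exprn_ege1]; lra.
  move=> h1 h2; have := ler_wpM2r h2 h1; lra.
lra.
Qed.

End StepsizeArithmetic.

Section Stepsize.
Variables (R : realType) (L M tau rho mu rho2 kap : R).
Hypotheses (L_gt0 : 0 < L) (M_ge0 : 0 <= M) (tau_ge0 : 0 <= tau) (rho_ge0 : 0 <= rho).
Hypotheses (mu_gt0 : 0 < mu) (mu_le_L : mu <= L) (rho2_gt0 : 0 < rho2).

Hypothesis kapE : kap = L / mu.
Local Notation c1 := (C1 mu L M rho).
Local Notation cb := (Cbar1 mu L M tau).
Local Notation al := (alpha_ mu L M tau rho rho2).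

Let L0 : 0 <= L. Proof. exact: ltW. Qed.
Let mu0 : 0 <= mu. Proof. exact: ltW. Qed.
Let mu_neq0 : mu != 0. Proof. by rewrite gt_eqF. Qed.
Let L_neq0 : L != 0. Proof. by rewrite gt_eqF. Qed.

Let kap_ge1 : 1 <= kap. Proof. by rewrite kapE ler_pdivlMr// mul1r. Qed.
Let kap_gt0 : 0 < kap. Proof. by rewrite kapE divr_gt0. Qed.
Let kap0 : 0 <= kap. Proof. exact: ltW. Qed.
Let kap_neq0 : kap != 0. Proof. by rewrite gt_eqF. Qed.

Let muE : mu = L / kap. Proof. by rewrite kapE; field; rewrite mu_neq0. Qed.

Lemma eta_mu_kap : eta_ L * mu = (2 * kap)^-1.
Proof. by rewrite muE /eta_; field; rewrite kap_neq0. Qed.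

Lemma beta_mu_kap : beta_ mu L * mu = 3 / (2 * (kap + 1)).
Proof.
rewrite /beta_ muE; field.
have h : kap + 1 != 0 by rewrite gt_eqF// addr_gt0.
rewrite h kap_neq0 /= -[X in _ + X]mul1r [X in X + _]mulrC -mulrDl mulf_neq0//.
Qed.

Lemma r_v_kap : r_v mu L = 2 * kap / (kap ^+ 2 + 1).
Proof.
rewrite /r_v muE; field.
have h : kap ^+ 2 + 1 != 0 by rewrite gt_eqF// ltr_wpDl ?sqr_ge0.
by rewrite h kap_neq0 /= gt_eqF//; pos.
Qed.

Lemma r_w_kap : r_w mu L = (7 * (4 * kap - 1))^-1.
Proof.
rewrite /r_w eta_mu_kap; field.
by rewrite kap_neq0 andbT gt_eqF//; have := kap_ge1; lra.
Qed.

Lemma inv_r_w_kap : 1 + 1 / r_w mu L = 28 * kap - 6.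
Proof. by rewrite r_w_kap invrK; ring. Qed.

Lemma r_w_bounds : 0 <= r_w mu L <= 1.
Proof.
rewrite r_w_kap invr_ge0; apply/andP; split; first by have := kap_ge1; lra.
by rewrite invf_le1; have := kap_ge1; lra.
Qed.

(** With the prescribed beta, rho_y is 3 kappa / (kappa + 1)^2 and the
    denominator of rho1 collapses. *)
Lemma rho1_denominator :
  rho_y mu L * (1 + r_v mu L) - r_v mu L = r_v mu L / 2.
Proof.
rewrite r_v_kap /rho_y /beta_ muE; field.
have h1 : kap ^+ 2 + 1 != 0 by rewrite gt_eqF// ltr_wpDl ?sqr_ge0.
have h2 : L / kap + L != 0 by rewrite gt_eqF// addr_gt0// divr_gt0.
have h3 : L + L * kap != 0 by rewrite gt_eqF// addr_gt0// mulr_gt0.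
have h4 : L * kap + L != 0 by rewrite gt_eqF// addr_gt0// mulr_gt0.
have h5 : kap + 1 != 0 by rewrite gt_eqF// addr_gt0.
by rewrite ?h1 ?h2 ?h3 ?h4 ?h5 ?kap_neq0 ?L_neq0.
Qed.

(** The combination of constants shared by rho1 and by the third bound on alpha. *)
Definition rho1_factor : R := (1 + r_w mu L) * C23 mu L M rho + 2 * C24 mu L M rho.
Local Notation Z := rho1_factor.

Lemma C1_kap : c1 = M * rho / L ^+ 2 * kap ^+ 2 + kap.
Proof. by rewrite /C1 kapE; field; rewrite mu_neq0 L_neq0. Qed.

Lemma Cbar1_kap : cb = L + M * tau / L * kap.
Proof. by rewrite /Cbar1 kapE; field; rewrite mu_neq0 L_neq0. Qed.

Lemma C1_ge_kap : kap <= c1.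
Proof.
by rewrite C1_kap lerDr; have Li := ltW L_gt0; nonneg.
Qed.

Let c1_gt0 : 0 < c1. Proof. exact: lt_le_trans kap_gt0 C1_ge_kap. Qed.
Let cb_gt0 : 0 < cb.
Proof. by rewrite ltr_wpDr// divr_ge0// mulr_ge0. Qed.

Lemma ZE : Z = (28 * kap - 6) * c1 ^+ 2 *
  ((1 + r_w mu L) * (5 + r_w mu L) + 2 * (9 + 8 * r_w mu L)).
Proof. by rewrite /rho1_factor /C23 /C24 inv_r_w_kap; ring. Qed.

Lemma Z_ge : 400 * kap * c1 ^+ 2 <= Z.
Proof.
rewrite ZE [leRHS]mulrAC; apply: (ler_wpM2r (sqr_ge0 c1)).
case/andP: r_w_bounds => w0 _; have h := mulr_ge0 w0 w0; have k1 := kap_ge1.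
have p1 : 20 * kap <= 28 * kap - 6 by lra.
have p2 : 20 <= (1 + r_w mu L) * (5 + r_w mu L) + 2 * (9 + 8 * r_w mu L) by lra.
have -> : 400 * kap = (20 * kap) * 20 by ring.
by apply: ler_pM => //; nonneg.
Qed.

Let Z_gt0 : 0 < Z.
Proof. by apply: lt_le_trans Z_ge; pos. Qed.

Lemma rho1E : rho1 mu L M rho rho2 = 2 * rho2 * Z * (kap ^+ 2 + 1) / kap.
Proof.
rewrite /rho1 rho1_denominator -/rho1_factor r_v_kap; field.
by rewrite kap_neq0 gt_eqF// ltr_wpDl ?sqr_ge0.
Qed.

Lemma L_Phi_ge0 : 0 <= L_Phi mu L M tau rho.
Proof. by rewrite /L_Phi; nonneg. Qed.

Lemma inv_r_v : 2 / r_v mu L = (kap ^+ 2 + 1) / kap.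
Proof.
rewrite r_v_kap; field.
by rewrite kap_neq0 gt_eqF// ltr_wpDl ?sqr_ge0.
Qed.

Let s0 : 0 < kap ^+ 2 + 1. Proof. by rewrite ltr_wpDl ?sqr_ge0. Qed.

Lemma C22_ge0 : 0 <= C22 mu L M rho.
Proof.
rewrite /C22 inv_r_w_kap; have h : 0 <= 28 * kap - 6 by have := kap_ge1; lra.
by nonneg.
Qed.

Lemma C24_ge0 : 0 <= C24 mu L M rho.
Proof.
rewrite /C24 inv_r_w_kap; have h : 0 <= 28 * kap - 6 by have := kap_ge1; lra.
by case/andP: r_w_bounds => w0 _; nonneg.
Qed.

Lemma L31_ge : 4 * rho2 * Z * (kap ^+ 2 + 1) ^+ 2 <= L31 mu L M tau rho rho2.
Proof.
rewrite /L31 -expr_div_n -kapE inv_r_v rho1E.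
have r0 := ltW rho2_gt0; have s0' := ltW s0.
case/andP: r_w_bounds => w0 _; have h22 := C22_ge0; have h24 := C24_ge0.
have e1 : 0 <= L_Phi mu L M tau rho / 2 by have := L_Phi_ge0; lra.
have e2 : 0 <= C24 mu L M rho * rho2 * ((kap ^+ 2 + 1) / kap) * kap ^+ 2 by nonneg.
have e3 : 0 <= (1 + r_w mu L) * C22 mu L M rho * rho2 by nonneg.
have -> : 4 * rho2 * Z * (kap ^+ 2 + 1) ^+ 2
  = 2 * ((2 * rho2 * Z * (kap ^+ 2 + 1) / kap) * ((kap ^+ 2 + 1) / kap) * kap ^+ 2).
  by field; rewrite kap_neq0.
rewrite mulrDl mulrDl; lra.
Qed.

Let L31_gt0 : 0 < L31 mu L M tau rho rho2.
Proof. by apply: lt_le_trans L31_ge; pos. Qed.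

Lemma alpha_gt0 : 0 < al.
Proof.
rewrite /alpha_ !lt_min; apply/and3P; split.
- by pos.
- by rewrite -mulrA eta_mu_kap; pos.
- by rewrite -/rho1_factor; pos.
Qed.

Let al0 : 0 <= al. Proof. exact: ltW alpha_gt0. Qed.

Lemma alpha_le1 : 8 * al * rho2 * Z * (kap ^+ 2 + 1) ^+ 2 <= 1.
Proof.
have h : al <= 1 / (2 * L31 mu L M tau rho rho2) by rewrite ge_min lexx.
have k : 0 < 2 * L31 mu L M tau rho rho2 by pos.
rewrite ler_pdivlMr// in h; apply: le_trans h.
have := ler_wpM2l al0 L31_ge; lra.
Qed.

Lemma alpha_le2 : 8 * al * L ^+ 2 * kap <= rho2.
Proof.
have h : al <= 1 / (4 * L ^+ 2) * rho2 * eta_ L * mu by rewrite !ge_min lexx orbT.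
rewrite -mulrA eta_mu_kap in h.
have k : 0 < 8 * L ^+ 2 * kap by pos.
have := ler_wpM2r (ltW k) h; rewrite (_ : _ * rho2 / _ * _ = rho2); first by lra.
by field; rewrite kap_neq0 L_neq0.
Qed.

Lemma alpha_le3 : al * cb ^+ 2 <= Z * rho2.
Proof.
have h : al <= Z * (rho2 / cb ^+ 2) by rewrite !ge_min lexx !orbT.
by rewrite mulrA ler_pdivlMr ?exprn_gt0 in h.
Qed.

Lemma stepsize_condition T J : (0 < T)%N -> (0 < J)%N ->
  weight_y L M tau rho mu (beta_ mu L) T
      * (2 * (1 - beta_ mu L * mu) ^+ T / (1 - (1 - beta_ mu L * mu) ^+ T)) * kap ^+ 2 * al ^+ 2
    + weight_v L mu (eta_ L) J
      * (2 * (1 - eta_ L * mu) ^+ J / (1 - (1 - eta_ L * mu) ^+ J))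
      * (c1 ^+ 2 * (1 + kap ^+ 2)) * al ^+ 2
    + curvature L M tau rho mu * al <= 1 / 2.
Proof.
move=> T0 J0; have k1 := kap_ge1; have k0 := kap0.
set A := (1 - beta_ mu L * mu) ^+ T; set B := (1 - eta_ L * mu) ^+ J.
pose a := 1 - beta_ mu L * mu; pose b := 1 - eta_ L * mu.
have kp : 0 < 2 * (kap + 1) by lra.
have aE : a = 1 - 3 / (2 * (kap + 1)) by rewrite /a beta_mu_kap.
have bE : b = 1 - (2 * kap)^-1 by rewrite /b eta_mu_kap.
have a0 : 0 <= a by rewrite aE subr_ge0 ler_pdivrMr//; lra.
have a1 : a < 1 by rewrite aE gtrBl divr_gt0 ?ltr0Sn.
have b0 : 0 <= b by rewrite bE subr_ge0 invf_le1; lra.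
have b1 : b < 1 by rewrite bE gtrBl invr_gt0 mulr_gt0.
have A0 : 0 <= A by exact: exprn_ge0.
have B0 : 0 <= B by exact: exprn_ge0.
have Aa : A <= a by rewrite -[leRHS]expr1 ler_wiXn2l// ltW.
have Bb : B <= b by rewrite -[leRHS]expr1 ler_wiXn2l// ltW.
have hq : curvature L M tau rho mu * al <= al * cb * (1 + kap) + 2 / 160.
  have := curvature_arith cb L_gt0 kap_ge1 C1_ge_kap alpha_gt0 rho2_gt0 Z_ge alpha_le1 alpha_le2.
  rewrite /curvature -kapE; congr (_ <= _).
  by rewrite /Cbar1 /C1 muE; field; rewrite kap_neq0 L_neq0.
exact: (stepsize_arith L_gt0 kap_ge1 C1_ge_kap cb_gt0 alpha_gt0 rho2_gt0 Z_ge alpha_le1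
  alpha_le2 alpha_le3 aE bE A0 B0 Aa Bb hq).
Qed.

(** ** Orders of magnitude in the condition number *)

Variables (c_lo c_hi : R).
Hypotheses (c_lo_gt0 : 0 < c_lo) (rho2_ge : c_lo / kap ^+ 4 <= rho2) (rho2_le : rho2 <= c_hi / kap ^+ 4).

Definition C1_const : R := M * rho / L ^+ 2 + 1.
Definition Cbar1_const : R := L + M * tau / L.
Definition L_Phi_const : R :=
  L + (2 * L ^+ 2 + tau * M ^+ 2) / L + (rho * L * M + L ^+ 3 + tau * M * L) / L ^+ 2
    + rho * L ^+ 2 * M / L ^+ 3.
Definition L31_const : R :=
  L_Phi_const + 16 * (28 * 46) * C1_const ^+ 2 * c_hi + 4 * (28 * 17) * C1_const ^+ 2 * c_hi
   + 4 * (28 * 10) * C1_const ^+ 2 * c_hi.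
Definition inv_alpha_const : R :=
  2 * L31_const + 8 * L ^+ 2 / c_lo + Cbar1_const ^+ 2 / c_lo.

Let Li : 0 <= L^-1. Proof. by rewrite invr_ge0. Qed.
Let k1_ge0 : 0 <= C1_const. Proof. by rewrite /C1_const; nonneg. Qed.
Let kb_ge0 : 0 <= Cbar1_const. Proof. by rewrite /Cbar1_const; nonneg. Qed.
Let kp4 : 0 < kap ^+ 4. Proof. exact: exprn_gt0. Qed.

Let rho2_kap4_ge : c_lo <= rho2 * kap ^+ 4.
Proof. by rewrite -ler_pdivrMr. Qed.
Let rho2_kap4_le : rho2 * kap ^+ 4 <= c_hi.
Proof. by rewrite -ler_pdivlMr. Qed.
Let c_hi_ge0 : 0 <= c_hi.
Proof. by apply: le_trans rho2_kap4_le; have := ltW rho2_gt0 => ?; nonneg. Qed.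

Let kap_pow i j : (i <= j)%N -> kap ^+ i <= kap ^+ j.
Proof. by move=> ij; apply: ler_weXn2l. Qed.

Lemma C1_le : c1 <= C1_const * kap ^+ 2.
Proof. by rewrite C1_kap mulrDl mul1r lerD2l -[leLHS]expr1 kap_pow. Qed.

Lemma Cbar1_le : cb <= Cbar1_const * kap.
Proof. by rewrite Cbar1_kap mulrDl lerD2r ler_peMr. Qed.

Lemma L_Phi_le : L_Phi mu L M tau rho <= L_Phi_const * kap ^+ 3.
Proof.
have h1 : 1 <= kap ^+ 3 := kap_pow (leq0n 3).
have h2 : kap <= kap ^+ 3 by rewrite -[leLHS]expr1 kap_pow.
have h3 : kap ^+ 2 <= kap ^+ 3 by exact: kap_pow.
have -> : L_Phi mu L M tau rho = L * 1 + (2 * L ^+ 2 + tau * M ^+ 2) / L * kap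
  + (rho * L * M + L ^+ 3 + tau * M * L) / L ^+ 2 * kap ^+ 2
    + rho * L ^+ 2 * M / L ^+ 3 * kap ^+ 3.
  by rewrite /L_Phi muE; field; rewrite kap_neq0 L_neq0.
rewrite /L_Phi_const !mulrDl; apply: lerD => //; apply: lerD.
  by apply: lerD; [exact: ler_wpM2l|rewrite -!mulrDl; apply: ler_wpM2l => //; nonneg].
by rewrite -!mulrDl; apply: ler_wpM2l => //; nonneg.
Qed.

Let sum_inv_le : (kap ^+ 2 + 1) / kap <= 2 * kap.
Proof.
rewrite ler_pdivrMr// -mulrA -expr2.
by have := kap_pow (leq0n 2); rewrite expr0; lra.
Qed.

Let c1sq_le : c1 ^+ 2 <= C1_const ^+ 2 * kap ^+ 4.
Proof.
rewrite [kap ^+ 4](exprM _ 2 2) -exprMn ler_sqr ?nnegrE ?C1_le//; first exact: ltW.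
by nonneg.
Qed.

Let fac_le : 28 * kap - 6 <= 28 * kap. Proof. by lra. Qed.
Let fac_ge0 : 0 <= 28 * kap - 6. Proof. by have := kap_ge1; lra. Qed.

Lemma Z_le : Z <= 28 * 46 * C1_const ^+ 2 * kap ^+ 5.
Proof.
case/andP: r_w_bounds => w0 w1.
have h : (1 + r_w mu L) * (5 + r_w mu L) + 2 * (9 + 8 * r_w mu L) <= 46.
  have : (1 + r_w mu L) * (5 + r_w mu L) <= 2 * 6 by apply: ler_pM; lra.
  by lra.
have -> : 28 * 46 * C1_const ^+ 2 * kap ^+ 5 = 28 * kap * (C1_const ^+ 2 * kap ^+ 4) * 46 by ring.
by rewrite ZE; apply: ler_pM => //; nonneg; apply: ler_pM => //; nonneg.
Qed.

Lemma rho1_le : rho1 mu L M rho rho2 <= 4 * (28 * 46) * C1_const ^+ 2 * c_hi * kap ^+ 2.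
Proof.
have r0 := ltW rho2_gt0; have z0 := ltW Z_gt0; have s0' := ltW s0.
rewrite rho1E -mulrA.
have h1 : 2 * rho2 * Z * ((kap ^+ 2 + 1) / kap) <=
   2 * rho2 * (28 * 46 * C1_const ^+ 2 * kap ^+ 5) * (2 * kap).
  apply: ler_pM => //; [nonneg|nonneg|apply: ler_wpM2l; [nonneg|exact: Z_le]].
apply: le_trans h1 _.
have -> : 2 * rho2 * (28 * 46 * C1_const ^+ 2 * kap ^+ 5) * (2 * kap)
  = 4 * (28 * 46) * C1_const ^+ 2 * (rho2 * kap ^+ 4) * kap ^+ 2 by ring.
by apply: ler_wpM2r; [nonneg|apply: ler_wpM2l; [nonneg|]].
Qed.

Lemma L31_le : L31 mu L M tau rho rho2 <= L31_const * kap ^+ 5.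
Proof.
have r0 := ltW rho2_gt0; have z0 := ltW Z_gt0; have s0' := ltW s0.
case/andP: r_w_bounds => w0 w1.
rewrite /L31 -expr_div_n -kapE inv_r_v.
have e1 : L_Phi mu L M tau rho / 2 <= L_Phi_const * kap ^+ 5.
  have k0 : 0 <= L_Phi_const by rewrite /L_Phi_const; nonneg.
  have h := le_trans L_Phi_le (ler_wpM2l k0 (kap_pow (isT : (3 <= 5)%N))).
  by have := L_Phi_ge0; lra.
have rr0 : 0 <= rho1 mu L M rho rho2 by rewrite rho1E; nonneg.
have e2 : rho1 mu L M rho rho2 * ((kap ^+ 2 + 1) / kap) * kap ^+ 2
  <= 8 * (28 * 46) * C1_const ^+ 2 * c_hi * kap ^+ 5.
  have h : rho1 mu L M rho rho2 * ((kap ^+ 2 + 1) / kap) <=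
    4 * (28 * 46) * C1_const ^+ 2 * c_hi * kap ^+ 2 * (2 * kap).
    by apply: ler_pM => //; [nonneg|exact: rho1_le].
  by have := ler_wpM2r (sqr_ge0 kap) h; congr (_ <= _); ring.
have hC24 : C24 mu L M rho <= 28 * 17 * C1_const ^+ 2 * kap ^+ 5.
  rewrite /C24 inv_r_w_kap.
  have -> : 28 * 17 * C1_const ^+ 2 * kap ^+ 5 = 28 * kap * 17 * (C1_const ^+ 2 * kap ^+ 4) by ring.
  apply: ler_pM; [by nonneg|by nonneg| |exact: c1sq_le].
  by apply: ler_pM; [done|nonneg|done|lra].
have e3 : C24 mu L M rho * rho2 * ((kap ^+ 2 + 1) / kap) * kap ^+ 2
  <= 2 * (28 * 17) * C1_const ^+ 2 * c_hi * kap ^+ 5.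
  have h : C24 mu L M rho * rho2 * ((kap ^+ 2 + 1) / kap) <=
    28 * 17 * C1_const ^+ 2 * kap ^+ 5 * rho2 * (2 * kap).
    apply: ler_pM => //; [by have := C24_ge0 => ?; nonneg|nonneg|exact: ler_wpM2r].
  have h2 := ler_wpM2r (sqr_ge0 kap) h; apply: le_trans h2 _.
  have -> : 28 * 17 * C1_const ^+ 2 * kap ^+ 5 * rho2 * (2 * kap) * kap ^+ 2
   = 2 * (28 * 17) * C1_const ^+ 2 * (rho2 * kap ^+ 4) * kap ^+ 4 by ring.
  apply: ler_pM; [nonneg|nonneg|apply: ler_wpM2l => //; nonneg|exact: kap_pow].
have e4 : (1 + r_w mu L) * C22 mu L M rho * rho2 <= 2 * (28 * 10) * C1_const ^+ 2 * c_hi * kap ^+ 5.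
  have hC22 : C22 mu L M rho <= 28 * kap * (10 * kap ^+ 2) * (C1_const ^+ 2 * kap ^+ 4).
    have E : 8 * L ^+ 2 / mu ^+ 2 = 8 * kap ^+ 2 by rewrite kapE; field; rewrite mu_neq0.
    rewrite /C22 inv_r_w_kap E.
    apply: ler_pM; [by nonneg|by nonneg| |exact: c1sq_le].
    apply: ler_pM; [done|by nonneg|done|].
    by have := kap_pow (leq0n 2); rewrite expr0; lra.
  have h : (1 + r_w mu L) * C22 mu L M rho * rho2 <=
     2 * (28 * kap * (10 * kap ^+ 2) * (C1_const ^+ 2 * kap ^+ 4)) * rho2.
    apply: ler_wpM2r => //; apply: ler_pM => //; [nonneg|exact: C22_ge0|lra].
  apply: le_trans h _.
  have -> : 2 * (28 * kap * (10 * kap ^+ 2) * (C1_const ^+ 2 * kap ^+ 4)) * rho2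
   = 2 * (28 * 10) * C1_const ^+ 2 * (rho2 * kap ^+ 4) * kap ^+ 3 by ring.
  apply: ler_pM; [nonneg|nonneg|apply: ler_wpM2l => //; nonneg|exact: kap_pow].
rewrite /L31_const; move: e1 e2 e3 e4; set k5 := kap ^+ 5 => e1 e2 e3 e4.
have -> : (L_Phi_const + 16 * (28 * 46) * C1_const ^+ 2 * c_hi + 4 * (28 * 17) * C1_const ^+ 2 * c_hi
   + 4 * (28 * 10) * C1_const ^+ 2 * c_hi) * k5
  = L_Phi_const * k5 + 2 * (8 * (28 * 46) * C1_const ^+ 2 * c_hi * k5
    + 2 * (28 * 17) * C1_const ^+ 2 * c_hi * k5 + 2 * (28 * 10) * C1_const ^+ 2 * c_hi * k5) by ring.
apply: lerD => //; apply: ler_wpM2l => //; apply: lerD => //.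
by rewrite mulrDl mulrDl; exact: lerD.
Qed.

Lemma inv_alpha_const_gt0 : 0 < inv_alpha_const.
Proof.
have ci := ltW c_lo_gt0.
rewrite /inv_alpha_const /L31_const /L_Phi_const addrAC ltr_wpDl//; first by nonneg.
by pos.
Qed.

Lemma inv_alpha_le : 1 / al <= inv_alpha_const * kap ^+ 5.
Proof.
have ci := ltW c_lo_gt0; have kc := inv_alpha_const_gt0.
have k5 : 0 < kap ^+ 5 by exact: exprn_gt0.
have P : 0 < inv_alpha_const * kap ^+ 5 by exact: mulr_gt0.
rewrite ler_pdivrMr ?alpha_gt0// mulrC -ler_pdivrMr// /alpha_ !le_min.
have inv_le x : 0 < x -> x <= inv_alpha_const * kap ^+ 5 -> 1 / (inv_alpha_const * kap ^+ 5) <= 1 / x.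
  by move=> x0 xP; rewrite !mul1r lef_pV2 ?posrE.
have kpart x : 0 <= x -> x * kap ^+ 5 <= (x + 0) * kap ^+ 5 by rewrite addr0.
have L31c0 : 0 <= L31_const by rewrite /L31_const /L_Phi_const; nonneg.
have u1 : 0 <= 8 * L ^+ 2 / c_lo by nonneg.
have u2 : 0 <= Cbar1_const ^+ 2 / c_lo by nonneg.
apply/and3P; split.
- apply: inv_le; first by pos.
  apply: le_trans (_ : 2 * (L31_const * kap ^+ 5) <= _); first by apply: ler_wpM2l => //; exact: L31_le.
  rewrite mulrA; apply: ler_wpM2r; first exact: ltW.
  by rewrite /inv_alpha_const; lra.
- rewrite -mulrA eta_mu_kap.
  have -> : 1 / (4 * L ^+ 2) * rho2 / (2 * kap) = 1 / (8 * L ^+ 2 * kap / rho2).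
    by field; rewrite kap_neq0 L_neq0 gt_eqF.
  apply: inv_le; first by pos.
  rewrite ler_pdivrMr//.
  have h : 8 * L ^+ 2 / c_lo * kap * c_lo <= inv_alpha_const * kap * (rho2 * kap ^+ 4).
    apply: ler_pM => //; first by nonneg.
    by apply: ler_wpM2r => //; rewrite /inv_alpha_const; lra.
  move: h; congr (_ <= _); last by ring.
  by field; rewrite gt_eqF.
- rewrite -/rho1_factor.
  have -> : Z * (rho2 / cb ^+ 2) = 1 / (cb ^+ 2 / (Z * rho2)).
    by field; rewrite !gt_eqF.
  apply: inv_le; first by pos.
  rewrite ler_pdivrMr; last by pos.
  have hZ : kap ^+ 2 <= Z.
    apply: le_trans Z_ge; rewrite -[leLHS]mul1r.
    apply: ler_pM => //; first by nonneg.
      by have := kap_ge1; lra.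
    by rewrite ler_sqr ?nnegrE ?C1_ge_kap// ltW.
  have h1 : cb ^+ 2 <= Cbar1_const ^+ 2 * kap ^+ 2.
    by rewrite -exprMn ler_sqr ?nnegrE ?Cbar1_le ?(ltW cb_gt0)//; nonneg.
  have h2 : Cbar1_const ^+ 2 / c_lo * c_lo * kap ^+ 2 <= inv_alpha_const * (rho2 * kap ^+ 4) * Z.
    apply: ler_pM => //; [nonneg|nonneg|].
    by apply: ler_pM => //; rewrite /inv_alpha_const; lra.
  rewrite divfK ?gt_eqF// in h2; apply: le_trans h1 (le_trans h2 _).
  have -> : inv_alpha_const * (rho2 * kap ^+ 4) * Z = inv_alpha_const * rho2 * Z * kap ^+ 4 by ring.
  have -> : inv_alpha_const * kap ^+ 5 * (Z * rho2) = inv_alpha_const * rho2 * Z * kap ^+ 5 by ring.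
  have r0 := ltW rho2_gt0; have z0 := ltW Z_gt0; have kc0 := ltW kc.
  by apply: ler_wpM2l; [nonneg|exact: kap_pow].
Qed.

Section Weights.
Variables T J : nat.
Hypotheses (T_gt0 : (0 < T)%N) (J_gt0 : (0 < J)%N).
Local Notation wy := (weight_y L M tau rho mu (beta_ mu L) T).
Local Notation wv := (weight_v L mu (eta_ L) J).
Local Notation A := ((1 - beta_ mu L * mu) ^+ T).
Local Notation B := ((1 - eta_ L * mu) ^+ J).

Lemma beta_mu_lt1 : 0 < beta_ mu L * mu < 1.
Proof.
rewrite beta_mu_kap; apply/andP; split; first by pos.
by rewrite ltr_pdivrMr; have := kap_ge1; lra.
Qed.

Lemma eta_mu_lt1 : 0 < eta_ L * mu < 1.
Proof.
rewrite eta_mu_kap invr_gt0; apply/andP; split; first by pos.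
by rewrite invf_lt1; have := kap_ge1; lra.
Qed.

Let hA : A <= 1 - beta_ mu L * mu.
Proof.
case/andP: beta_mu_lt1 => b0 b1.
by rewrite -[leRHS]expr1 ler_wiXn2l// ?subr_ge0 ?gerBl ltW.
Qed.

Let hB : B <= 1 - eta_ L * mu.
Proof.
case/andP: eta_mu_lt1 => b0 b1.
by rewrite -[leRHS]expr1 ler_wiXn2l// ?subr_ge0 ?gerBl ltW.
Qed.

Let A1 : 0 < 1 - A.
Proof. by case/andP: beta_mu_lt1 => b0 b1; have := hA; lra. Qed.
Let B1 : 0 < 1 - B.
Proof. by case/andP: eta_mu_lt1 => b0 b1; have := hB; lra. Qed.

Lemma weight_v_noise : wv * (1 - B) = 4 * L ^+ 2.
Proof. by rewrite /weight_v divfK ?gt_eqF. Qed.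

Lemma weight_v_le : wv <= 8 * L ^+ 2 * kap.
Proof.
rewrite /weight_v ler_pdivrMr//.
have h : (2 * kap)^-1 <= 1 - B by rewrite -eta_mu_kap; have := hB; lra.
have h2 : 0 <= 8 * L ^+ 2 * kap by nonneg.
have := ler_wpM2l h2 h; apply: le_trans.
rewrite le_eqVlt; apply/orP; left; apply/eqP; by field; rewrite kap_neq0.
Qed.

Lemma weight_v_ge0 : 0 <= wv.
Proof. by rewrite /weight_v; nonneg. Qed.

Definition weight_const : R := Cbar1_const ^+ 2 + 12 * L ^+ 2 * C1_const ^+ 2.

Let core_le : cb ^+ 2 + 12 * L ^+ 2 * c1 ^+ 2 <= weight_const * kap ^+ 4.
Proof.
rewrite /weight_const [leRHS]mulrDl; apply: lerD.
  have h1 : cb ^+ 2 <= Cbar1_const ^+ 2 * kap ^+ 2.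
    by rewrite -exprMn ler_sqr ?nnegrE ?Cbar1_le ?(ltW cb_gt0)//; nonneg.
  by apply: le_trans h1 _; apply: ler_wpM2l; [nonneg|exact: kap_pow].
by rewrite -[leRHS]mulrA; apply: ler_wpM2l; [nonneg|].
Qed.

(** The factor 1 - A by which the noise of the y-loop is damped cancels the
    denominator of its weight: the noise term does not depend on T. *)
Lemma weight_y_noise : wy * (1 - A) <= 2 * weight_const * kap ^+ 4.
Proof.
have -> : wy * (1 - A) = 2 * (cb ^+ 2 + 12 * L ^+ 2 * c1 ^+ 2).
  by rewrite /weight_y; field; rewrite gt_eqF.
by rewrite -[leRHS]mulrA; exact: ler_wpM2l.
Qed.

Lemma weight_y_ge0 : 0 <= wy.
Proof. by have a0 := ltW A1; rewrite /weight_y; nonneg. Qed.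

Lemma weight_y_le : wy <= 4 * weight_const * kap ^+ 5.
Proof.
have h : (2 * kap)^-1 <= 1 - A.
  have : (2 * kap)^-1 <= beta_ mu L * mu.
    rewrite beta_mu_kap -[leLHS]mul1r ler_pdivrMr; last by pos.
    rewrite mulrAC ler_pdivlMr; last by pos.
    by have := kap_ge1; lra.
  by have := hA; lra.
have h2 := ler_wpM2l weight_y_ge0 h.
have h3 := le_trans h2 weight_y_noise.
rewrite ler_pdivrMr in h3; last by pos.
by apply: le_trans h3 _; rewrite le_eqVlt; apply/orP; left; apply/eqP; ring.
Qed.

End Weights.

End Stepsize.

(** * Independence and product laws *)

Section MonotoneIntegral.
Local Open Scope ereal_scope.

(** The integral of a nonnegative function is a supremum over the simple
    functions below it, so it is monotone for arbitrary functions. The spectral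
    norm of a random matrix is compared in this way, without a measurability
    argument. *)
Lemma ge0_le_integral_setT d (T : measurableType d) (R : realType)
  (mu : {measure set T -> \bar R}) (f g : T -> \bar R) :
  (forall x, 0 <= f x) -> (forall x, f x <= g x) ->
  \int[mu]_x f x <= \int[mu]_x g x.
Proof.
move=> f0 fg; have g0 x : 0 <= g x := le_trans (f0 x) (fg x).
rewrite !ge0_integralTE//; apply: le_ereal_sup => _ [h hf <-].
by exists h => // x; exact: le_trans (hf x) (fg x).
Qed.

End MonotoneIntegral.

Section GeneratedIndependence.
Local Open Scope ereal_scope.
Variables (d : measure_display) (T : measurableType d) (R : realType).
Variable P : probability T R.

(** As functions of A, both sides are finite measures, which agree on the
    pi-system G. *)
Lemma independent_generated_l (G : set (set T)) (B : set T) :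
  G `<=` measurable -> setI_closed G -> G setT -> measurable B ->
  (forall A, G A -> P (A `&` B) = P A * P B) ->
  forall A, <<s G >> A -> P (A `&` B) = P A * P B.
Proof.
move=> Gm GI GT mB GB A sA.
have pB0 : (0 <= fine (P B))%R by rewrite fine_ge0.
have h := @g_sigma_algebra_measure_unique _ _ _ G Gm (fun=> setT) (fun=> GT) _
  (mrestr P mB) (mscale (NngNum pB0) P) GI.
have -> : P (A `&` B) = mrestr P mB A by [].
rewrite h//.
- change ((fine (P B))%:E * P A = P A * P B).
  by rewrite fineK ?fin_num_measure// muleC.
- by rewrite bigcup_const//; exists 0%N.
- move=> C GC; change (P (C `&` B) = (fine (P B))%:E * P C).
  by rewrite fineK ?fin_num_measure// GB// muleC.
- move=> _; change (P (setT `&` B) < +oo); rewrite setTI; exact: (le_lt_trans (probability_le1 _ mB) (ltry 1)).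
Qed.

Lemma independent_generated (G1 G2 : set (set T)) :
  G1 `<=` measurable -> setI_closed G1 -> G1 setT ->
  G2 `<=` measurable -> setI_closed G2 -> G2 setT ->
  (forall A B, G1 A -> G2 B -> P (A `&` B) = P A * P B) ->
  forall A B, <<s G1 >> A -> <<s G2 >> B -> P (A `&` B) = P A * P B.
Proof.
move=> m1 I1 T1 m2 I2 T2 h A B sA sB.
have mB : measurable B by apply: sB; split => //; exact: sigma_algebra_measurable.
apply: (independent_generated_l m1 I1 T1 mB _ sA) => C GC.
rewrite setIC muleC; apply: (independent_generated_l m2 I2 T2 _ _ sB); first exact: m1.
by move=> E GE; rewrite setIC muleC h.
Qed.

End GeneratedIndependence.

Section ProductLaw.
Local Open Scope ereal_scope.
Variables (d d1 d2 : measure_display).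
Variables (T : measurableType d) (T1 : measurableType d1) (T2 : measurableType d2).
Variables (R : realType) (P : probability T R).
Variables (X1 : {RV P >-> T1}) (X2 : {RV P >-> T2}).
Hypothesis X1X2 : forall A B, measurable A -> measurable B ->
  P (X1 @^-1` A `&` X2 @^-1` B) = P (X1 @^-1` A) * P (X2 @^-1` B).

Let m12 : measurable_fun setT (fun w => (X1 w, X2 w)).
Proof. exact: measurable_fun_pair. Qed.

Definition joint_rv : {RV P >-> (T1 * T2)%type} :=
  HB.pack (fun w => (X1 w, X2 w)) (isMeasurableFun.Build _ _ _ _ _ m12).

Let law12 : forall A, measurable A ->
  distribution P joint_rv A = (distribution P X1 \x distribution P X2) A.
Proof.
move=> A mA; rewrite (@product_measure_unique _ _ _ _ _ _ _ (distribution P joint_rv))//.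
Qed.

(** The joint law is the product of the laws, to which Tonelli's theorem applies:
    this is how fresh samples are averaged while the iterates are kept fixed. *)
Lemma integral_independent (f : T1 * T2 -> \bar R) :
  measurable_fun [set: (T1 * T2)%type] f -> (forall z, 0 <= f z) ->
  \int[P]_w f (X1 w, X2 w)
    = \int[distribution P X1]_a \int[distribution P X2]_b f (a, b).
Proof.
move=> mf f0; rewrite -(ge0_integral_distribution joint_rv mf f0).
rewrite (@eq_measure_integral _ _ _ _ (distribution P X1 \x distribution P X2)); last first.
  by move=> A mA _; exact: law12.
by rewrite fubini_tonelli1.
Qed.

(** The signed counterpart, by Fubini's theorem: the inner integral vanishes. *)
Lemma integral_independent_mul0 (a : T1 -> R) (b : T2 -> R) :
  measurable_fun setT a -> measurable_fun setT b ->
  P.-integrable setT (fun w => (a (X1 w) * b (X2 w))%:E) ->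
  (distribution P X2).-integrable setT (EFin \o b) ->
  \int[distribution P X2]_s (b s)%:E = 0 ->
  \int[P]_w (a (X1 w) * b (X2 w))%:E = 0.
Proof.
move=> ma mb iab ib b0.
pose f (z : T1 * T2) := (a z.1 * b z.2)%:E.
have mf : measurable_fun [set: (T1 * T2)%type] f.
  apply/measurable_EFinP; apply: measurable_funM; exact: measurableT_comp.
have -> : \int[P]_w (a (X1 w) * b (X2 w))%:E = \int[distribution P joint_rv]_z f z.
  by rewrite integral_distribution.
rewrite (@eq_measure_integral _ _ _ _ (distribution P X1 \x distribution P X2)); last first.
  by move=> A mA _; exact: law12.
rewrite -integral12_prod_meas1.
  apply: integral0_eq => s _; rewrite /fubini_F /f /=.
  under eq_integral do rewrite EFinM.
  by rewrite integralZl// b0 mule0.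
apply/integrableP; split => //.
rewrite -(@eq_measure_integral _ _ _ _ _ (distribution P joint_rv)); last first.
  by move=> A mA _; exact: law12.
rewrite ge0_integral_distribution//; last exact: measurableT_comp.
by case/integrableP : iab.
Qed.

End ProductLaw.

Section SubSigmaAlgebra.
Variables (d : measure_display) (T : measurableType d) (R : realType).
Variables (P : probability T R) (G : set (set T)).
Hypothesis Gm : G `<=` measurable.

Let mid : measurable_fun setT (fun w : T => w : g_sigma_algebraType G).
Proof.
move=> _ A sA; rewrite setTI preimage_id; apply: sA; split => //.
exact: sigma_algebra_measurable.
Qed.

(** The identity into the same space with a smaller sigma-algebra: functions
    that are measurable for the smaller one become functions of this variable. *)
Definition coarsen : {RV P >-> g_sigma_algebraType G} :=
  HB.pack (fun w : T => w : g_sigma_algebraType G)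
    (isMeasurableFun.Build _ _ _ _ _ mid).

End SubSigmaAlgebra.

(** * The sigma-algebras of disjoint groups of draws *)

HB.instance Definition _ := gen_eqMixin draw.

Section Draws.
Variables (R : realType) (p q : nat) (pb : bilevel_problem R p q).
Variables (d : measure_display) (Omega : measurableType d) (P : probability Omega R).
Variables (c : ssgd_config) (X : ssgd_samples pb P).

Definition draws (A : set draw) : set (set Omega) :=
  \bigcup_(a in A) draw_events X a.

Lemma draw_events_sigma_algebra a : [/\ draw_events X a `<=` measurable,
  draw_events X a setT & setI_closed (draw_events X a)].
Proof.
have H d' (S : measurableType d') (Y : {RV P >-> S}) : [/\ events_of Y `<=` measurable,
    events_of Y setT & setI_closed (events_of Y)].
  split => [_ [B mB <-]||_ _ [B mB <-] [C mC <-]].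
  - exact: measurable_funP.
  - by exists setT => //; rewrite preimage_setT setTI.
  - by exists (B `&` C); [exact: measurableI|rewrite preimage_setI setIACA setIid].
by case: a => *; exact: H.
Qed.

Lemma draws_measurable A : draws A `<=` measurable.
Proof. by move=> B [a _]; have [+ _ _] := draw_events_sigma_algebra a; exact. Qed.

Lemma mem_big_setI (s : seq draw) (C : draw -> set Omega) w :
  (\big[setI/setT]_(a <- s) C a) w <-> forall a, a \in s -> C a w.
Proof.
elim: s => [|b s IH]; first by rewrite big_nil.
rewrite big_cons; split => [[Cb /IH h] a|h].
  by rewrite inE => /predU1P[->//|]; exact: h.
split; first by apply: h; rewrite mem_head.
by apply/IH => a asb; apply: h; rewrite inE asb orbT.
Qed.

(** A pi-system that generates the sigma-algebra of a group of draws, and on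
    which mutual independence gives the probabilities as products. *)
Definition cylinders (A : set draw) : set (set Omega) :=
  [set B | exists (s : seq draw) (C : draw -> set Omega),
    [/\ forall a, a \in s -> A a, forall a, draw_events X a (C a),
        forall a, a \notin s -> C a = setT & B = \bigcap_a C a]].

Lemma cylinders_measurable A : cylinders A `<=` measurable.
Proof.
move=> _ [s [C [sA EC CT ->]]].
rewrite (_ : \bigcap_a C a = \big[setI/setT]_(a <- s) C a); last first.
  apply/seteqP; split => w; first by move=> h; apply/mem_big_setI => a _; exact: h.
  move/mem_big_setI => h a _; have [/h//|/CT->//] := boolP (a \in s).
apply: bigsetI_measurable => a _.
by have [+ _ _] := draw_events_sigma_algebra a; apply; exact: EC.
Qed.

Lemma cylindersI A : setI_closed (cylinders A).
Proof.
move=> _ _ [s [C [sA EC CT ->]]] [s' [C' [sA' EC' CT' ->]]].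
exists (s ++ s'), (fun a => C a `&` C' a); split.
- by move=> a; rewrite mem_cat => /orP[/sA|/sA'].
- by move=> a; have [_ _] := draw_events_sigma_algebra a; apply.
- by move=> a; rewrite mem_cat negb_or => /andP[/CT-> /CT'->]; rewrite setIid.
- apply/seteqP; split => w; first by move=> [h h'] a _; split; [exact: h|exact: h'].
  by move=> h; split=> a _; case: (h a I).
Qed.

Lemma cylindersT A : cylinders A setT.
Proof.
exists [::], (fun=> setT); split => // [a|]; first by have [] := draw_events_sigma_algebra a.
by apply/seteqP; split.
Qed.

Lemma draws_cylinders A : draws A `<=` cylinders A.
Proof.
move=> B [b Ab EB]; exists [:: b], (fun a => if a == b then B else setT); split.
- by move=> a; rewrite inE => /eqP->.
- by move=> a; case: eqP => [->//|_]; have [] := draw_events_sigma_algebra a.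
- by move=> a; rewrite inE => /negbTE->.
- apply/seteqP; split => w; first by move=> Bw a _; case: ifP.
  by move=> /(_ b I); rewrite eqxx.
Qed.

Hypothesis fresh : fresh_sampling c X.

Lemma prob_cylinder (s : seq draw) (C : draw -> set Omega) :
  (forall a, a \in s -> performed c a) -> uniq s ->
  (forall a, draw_events X a (C a)) -> (forall a, a \notin s -> C a = setT) ->
  P (\bigcap_a C a) = (\prod_(a <- s) P (C a))%E.
Proof.
move=> sc us EC CT; have [_ indep] := fresh.
have := indep (size s) (tnth (in_tuple s)) _ _ (fun i => C (tnth (in_tuple s) i)) _.
rewrite -(big_tnth _ _ s predT C) -(big_tnth _ _ s predT (fun a => P (C a))) => <- //.
- congr (P _); apply/seteqP; split => w.
    by move=> h; apply/mem_big_setI => a _; exact: h.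
  by move/mem_big_setI => h a _; have [/h//|/CT->//] := boolP (a \in s).
- exact/tuple_uniqP.
- by move=> i; apply: sc; exact: mem_tnth.
Qed.

(** On cylinders, merging two families of events of disjoint groups of draws
    gives one family of events of distinct draws. *)
Lemma draws_independent A B : A `<=` performed c -> B `<=` performed c ->
  (forall a, A a -> ~ B a) -> forall U V, <<s draws A >> U -> <<s draws B >> V ->
  P (U `&` V) = (P U * P V)%E.
Proof.
move=> Ac Bc AB U V sU sV.
apply: (independent_generated (@cylinders_measurable A) (@cylindersI A) (cylindersT A)
  (@cylinders_measurable B) (@cylindersI B) (cylindersT B)); last 2 first.
- exact: sub_sigma_algebra2 (@draws_cylinders A) _ sU.
- exact: sub_sigma_algebra2 (@draws_cylinders B) _ sV.
move=> _ _ [s1 [C1 [sA1 EC1 CT1 ->]]] [s2 [C2 [sA2 EC2 CT2 ->]]].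
have dis a : a \in s1 -> a \notin s2.
  by move=> /sA1 h; apply/negP => /sA2; exact: AB.
rewrite (_ : _ `&` _ = \bigcap_a (C1 a `&` C2 a)); last first.
  apply/seteqP; split => w; first by move=> [h h'] a _; split; [exact: h|exact: h'].
  by move=> h; split=> a _; case: (h a I).
rewrite (@prob_cylinder (undup s1 ++ undup s2)); first last.
- by move=> a; rewrite mem_cat negb_or !mem_undup => /andP[/CT1-> /CT2->]; rewrite setIid.
- by move=> a; have [_ _] := draw_events_sigma_algebra a; apply.
- rewrite cat_uniq !undup_uniq/= andbT; apply/hasPn => a; rewrite !mem_undup => as2.
  by apply/negP => /dis; rewrite as2.
- by move=> a; rewrite mem_cat !mem_undup => /orP[/sA1/Ac|/sA2/Bc].
rewrite (@prob_cylinder (undup s1)) ?undup_uniq//; first last.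
- by move=> a; rewrite mem_undup => /CT1.
- by move=> a; rewrite mem_undup => /sA1/Ac.
rewrite (@prob_cylinder (undup s2)) ?undup_uniq//; first last.
- by move=> a; rewrite mem_undup => /CT2.
- by move=> a; rewrite mem_undup => /sA2/Bc.
rewrite big_cat/=; congr (_ * _)%E; apply: eq_big_seq => a; rewrite mem_undup => as_.
  by rewrite (CT2 _ (dis _ as_)) setIT.
by rewrite (CT1 a) ?setTI//; apply/negP => /dis; rewrite as_.
Qed.

End Draws.

Lemma measurable_generated d (T : measurableType d) d' (S : measurableType d')
  (G : set (set T)) (f : T -> S) :
  events_of f `<=` G -> measurable_fun (setT : set (g_sigma_algebraType G)) f.
Proof.
move=> h _ B mB; apply: sub_sigma_algebra; apply: h; by exists B.
Qed.

(** * Mean square of the noise of a batch *)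

Section BatchVariance.
Variables (R : realType) (d d' : measure_display).
Variables (Omega : measurableType d) (P : probability Omega R).
Variables (S : measurableType d') (Q : probability S R).
Variables (m n : nat) (h : S -> 'cV[R]_m) (h0 : 'cV[R]_m) (s2 : R).
Variable zeta : nat -> {RV P >-> S}.
Hypothesis n_gt0 : (0 < n)%N.
Hypothesis unb : unbiased Q h h0.
Hypothesis ms : (\int[Q]_s (l2norm (h s - h0) ^+ 2)%:E <= s2%:E)%E.
Hypothesis law : forall i, (i < n)%N -> has_law (zeta i) Q.
Hypothesis indep : forall i j, (i < n)%N -> (j < n)%N -> i != j ->
  forall A B, measurable A -> measurable B ->
  P (zeta i @^-1` A `&` zeta j @^-1` B) = (P (zeta i @^-1` A) * P (zeta j @^-1` B))%E.

Let a (l : 'I_m) (s : S) : R := h s l 0 - h0 l 0.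
Let Y (l : 'I_m) (i : nat) (w : Omega) : R := a l (zeta i w).

Let int_a l : Q.-integrable setT (EFin \o a l).
Proof.
have [hl _] := unb l 0.
have -> : EFin \o a l = ((EFin \o (fun s => h s l 0%R)) \- cst (h0 l 0%R)%:E)%E by [].
apply: integrableB => //; exact: finite_measure_integrable_cst.
Qed.

Let m_a l : measurable_fun setT (a l).
Proof. by apply/measurable_EFinP; exact: measurable_int (int_a l). Qed.

Let mean_a l : (\int[Q]_s (a l s)%:E = 0)%E.
Proof.
have [hl El] := unb l 0.
rewrite /a; under eq_integral do rewrite EFinB.
rewrite integralB_EFin//; last exact: finite_measure_integrable_cst.
have -> : (\int[Q]_x (h0 l 0)%:E = (h0 l 0)%:E)%E.
  by have := expectation_cst Q (h0 l 0); rewrite unlock.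
by move: El; rewrite unlock => ->; rewrite subee.
Qed.

Let integral_law i (f : S -> \bar R) : (i < n)%N ->
  (\int[distribution P (zeta i)]_s f s = \int[Q]_s f s)%E.
Proof. by move=> ni; apply: eq_measure_integral => A mA _; exact: law. Qed.

Let sqr_sum s : l2norm (h s - h0) ^+ 2 = \sum_l a l s ^+ 2.
Proof.
rewrite /l2norm sqr_sqrtr; last by apply: sumr_ge0 => i _; exact: sqr_ge0.
by apply: eq_bigr => l _; rewrite !mxE.
Qed.

Let v l : R := fine (\int[Q]_s (a l s ^+ 2)%:E)%E.

Let m_sqr l : measurable_fun setT (fun s => (a l s ^+ 2)%:E).
Proof. by apply/measurable_EFinP; apply: measurable_funX; exact: m_a. Qed.

Let sum_a2 : (\sum_l \int[Q]_s (a l s ^+ 2)%:E <= s2%:E)%E.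
Proof.
apply: le_trans ms; rewrite -ge0_integral_sum//; last first.
  by move=> l s _; rewrite lee_fin sqr_ge0.
apply: ge0_le_integral_setT => s; last by rewrite sqr_sum sumEFin.
by apply: sume_ge0 => l _; rewrite lee_fin sqr_ge0.
Qed.

Let vE l : (\int[Q]_s (a l s ^+ 2)%:E = (v l)%:E)%E.
Proof.
rewrite fineK// ge0_fin_numE; last by apply: integral_ge0 => s _; rewrite lee_fin sqr_ge0.
apply: le_lt_trans (ltry s2); apply: le_trans sum_a2.
rewrite (bigD1 l)//= leeDl// sume_ge0// => k _.
by apply: integral_ge0 => s _; rewrite lee_fin sqr_ge0.
Qed.

Let sum_v : \sum_l v l <= s2.
Proof.
rewrite -lee_fin -sumEFin; apply: le_trans sum_a2.
by rewrite le_eqVlt; apply/orP; left; apply/eqP/eq_bigr => l _; rewrite vE.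
Qed.

Let mY l i : measurable_fun setT (Y l i).
Proof. by apply: measurableT_comp => //; exact: m_a. Qed.

Let sqrY l i : (i < n)%N -> (\int[P]_w (Y l i w ^+ 2)%:E = (v l)%:E)%E.
Proof.
move=> ni; rewrite -vE -(integral_law _ ni) ge0_integral_distribution//.
by move=> s; rewrite lee_fin sqr_ge0.
Qed.

Let int_sqrY l i : (i < n)%N -> P.-integrable setT (fun w => (Y l i w ^+ 2)%:E).
Proof.
move=> ni; apply/integrableP; split.
  by apply/measurable_EFinP; apply: measurable_funX.
under eq_integral => w _ do rewrite gee0_abs ?lee_fin ?sqr_ge0//.
by rewrite sqrY// ltry.
Qed.

Let int_YY l i j : (i < n)%N -> (j < n)%N ->
  P.-integrable setT (fun w => (Y l i w * Y l j w)%:E).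
Proof.
move=> ni nj; apply: (@le_integrable _ _ _ _ _ _ _
  (fun w => (Y l i w ^+ 2)%:E + (Y l j w ^+ 2)%:E)%E) => //.
- by apply/measurable_EFinP; exact: measurable_funM.
- move=> w _; rewrite lee_fin normrM [leRHS]ger0_norm; last by rewrite addr_ge0// sqr_ge0.
  rewrite -(real_normK (num_real (Y l i w))) -(real_normK (num_real (Y l j w))).
  by move: (normr_ge0 (Y l i w)) (normr_ge0 (Y l j w)); nra.
- by apply: integrableD => //; exact: int_sqrY.
Qed.

Let int_YY_eq l i j : (i < n)%N -> (j < n)%N ->
  (\int[P]_w (Y l i w * Y l j w)%:E = (if i == j then v l else 0)%:E)%E.
Proof.
move=> ni nj; have [<-|ij] := eqVneq i j; first by rewrite -(sqrY _ ni).
apply: (integral_independent_mul0 (indep ni nj ij)) => //.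
- exact: int_YY.
- apply/integrableP; split; first by apply/measurable_EFinP.
  by rewrite integral_law//; case/integrableP: (int_a l).
- by rewrite integral_law// mean_a.
Qed.

Let noise_sqr w : l2norm (noise [seq zeta i w | i <- iota 0 n] h h0) ^+ 2
  = n%:R ^- 2 * \sum_(t : 'I_m * ('I_n * 'I_n)) Y t.1 t.2.1 w * Y t.1 t.2.2 w.
Proof.
have nn : n%:R != 0 :> R by rewrite pnatr_eq0 -lt0n.
rewrite /l2norm sqr_sqrtr; last by apply: sumr_ge0 => i _; exact: sqr_ge0.
rewrite -(pair_big xpredT xpredT (fun l (ij : 'I_n * 'I_n) => Y l ij.1 w * Y l ij.2 w))/= mulr_sumr.
apply: eq_bigr => l _.
rewrite -(pair_big xpredT xpredT (fun i j : 'I_n => Y l i w * Y l j w))/=.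
rewrite -big_distrlr/= -expr2 -exprVn -exprMn; congr (_ ^+ 2).
rewrite /noise /batch_mean size_map size_iota big_map -{2}(subn0 n) -/(index_iota 0 n) big_mkord.
rewrite !mxE summxE /Y /a sumrB mulrBr; congr (_ - _).
by rewrite sumr_const card_ord -[h0 l 0 *+ n]mulr_natl mulrA mulVf ?mul1r//.
Qed.

(** Expand the square: the diagonal terms give the variance of one sample, and
    the others vanish since two distinct samples are independent and centred. *)
Lemma batch_variance :
  (\int[P]_w (l2norm (noise [seq zeta i w | i <- iota 0 n] h h0) ^+ 2)%:E
     <= (s2 / n%:R)%:E)%E.
Proof.
have nn : n%:R != 0 :> R by rewrite pnatr_eq0 -lt0n.
under eq_integral do rewrite noise_sqr EFinM -sumEFin.
rewrite integralZl//; last first.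
  by apply: integrable_sum => // t _; exact: int_YY.
rewrite integral_sum//; last by move=> t; exact: int_YY.
under eq_bigr do rewrite int_YY_eq//.
rewrite sumEFin -EFinM lee_fin.
rewrite -(pair_big xpredT xpredT (fun l (ij : 'I_n * 'I_n) => if ij.1 == ij.2 :> nat then v l else 0))/=.
under eq_bigr => l _.
  rewrite -(pair_big xpredT xpredT (fun i j : 'I_n => if i == j :> nat then v l else 0))/=.
  under eq_bigr => i _.
    rewrite -big_mkcond/= (big_pred1 i); last by move=> j; rewrite eq_sym.
    over.
  rewrite sumr_const card_ord -mulr_natl.
  over.
rewrite -mulr_sumr mulrA (_ : n%:R ^- 2 * n%:R = n%:R^-1); last by field.
by rewrite mulrC ler_pM2r// invr_gt0 ltr0n.
Qed.

End BatchVariance.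

Section FreshBatch.
Variables (R : realType) (d d' : measure_display).
Variables (Omega : measurableType d) (P : probability Omega R).
Variables (S : measurableType d') (Q : probability S R).
Variables (G1 G2 : set (set Omega)).
Hypotheses (G1m : G1 `<=` measurable) (G2m : G2 `<=` measurable).
Hypothesis G12 : forall A B, <<s G1 >> A -> <<s G2 >> B -> P (A `&` B) = (P A * P B)%E.
Variables (m n : nat) (H : Omega -> S -> 'cV[R]_m) (H0 : Omega -> 'cV[R]_m) (s2 : R).
Variable zeta : nat -> {RV P >-> S}.
Hypothesis n_gt0 : (0 < n)%N.
Local Notation T1 := (g_sigma_algebraType G1).
Local Notation T2 := (g_sigma_algebraType G2).
Hypothesis mH : forall l, measurable_fun [set: (T1 * S)%type] (fun z : T1 * S => H z.1 z.2 l 0).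
Hypothesis mH0 : forall l, measurable_fun [set: T1] (fun w => H0 w l 0).
Hypothesis mzeta : forall i, (i < n)%N -> measurable_fun [set: T2] (zeta i).
Hypothesis unb : forall w, unbiased Q (H w) (H0 w).
Hypothesis ms : forall w, (\int[Q]_s (l2norm (H w s - H0 w) ^+ 2)%:E <= s2%:E)%E.
Hypothesis law : forall i, (i < n)%N -> has_law (zeta i) Q.
Hypothesis indep : forall i j, (i < n)%N -> (j < n)%N -> i != j ->
  forall A B, measurable A -> measurable B ->
  P (zeta i @^-1` A `&` zeta j @^-1` B) = (P (zeta i @^-1` A) * P (zeta j @^-1` B))%E.

Let N (a b : Omega) : R :=
  l2norm (noise [seq zeta i b | i <- iota 0 n] (H a) (H0 a)) ^+ 2.

Let mN : measurable_fun [set: (T1 * T2)%type] (fun z : T1 * T2 => N z.1 z.2).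
Proof.
have -> : (fun z : T1 * T2 => N z.1 z.2) = fun z : T1 * T2 =>
    \sum_(l < m) (n%:R^-1 * (\sum_(i < n) H z.1 (zeta i z.2) l 0) - H0 z.1 l 0) ^+ 2.
  apply/funext => z; rewrite /N /l2norm sqr_sqrtr; last first.
    by apply: sumr_ge0 => i _; exact: sqr_ge0.
  apply: eq_bigr => l _; congr (_ ^+ 2); rewrite /noise /batch_mean size_map size_iota.
  by rewrite big_map -{2}(subn0 n) -/(index_iota 0 n) big_mkord !mxE summxE.
apply: measurable_sum => l; apply: measurable_funX; apply: measurable_funB; last first.
  exact: measurableT_comp (mH0 l) (@measurable_fst _ _ T1 T2).
apply: measurable_funM => //; apply: measurable_sum => i.
have hz : measurable_fun [set: (T1 * T2)%type] (fun z : T1 * T2 => (z.1, zeta i z.2) : T1 * S).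
  apply: measurable_fun_pair; first exact: measurable_fst.
  exact: measurableT_comp (mzeta (ltn_ord i)) (@measurable_snd _ _ T1 T2).
exact: measurableT_comp (mH l) hz.
Qed.

(** By independence the batch may be integrated first, with the point where its
    samples are evaluated kept fixed. *)
Lemma fresh_batch_variance :
  (\int[P]_w (l2norm (noise [seq zeta i w | i <- iota 0 n] (H w) (H0 w)) ^+ 2)%:E
     <= (s2 / n%:R)%:E)%E.
Proof.
have h := @integral_independent _ _ _ _ _ _ _ P (coarsen P G1m) (coarsen P G2m) _
  (fun z => (N z.1 z.2)%:E).
rewrite (_ : \int[P]_w _ = \int[P]_w (N (coarsen P G1m w) (coarsen P G2m w))%:E)%E//.
rewrite h/=; last 3 first.
- move=> A B sA sB; exact: G12.
- by apply/measurable_EFinP; exact: mN.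
- by move=> z; rewrite lee_fin sqr_ge0.
apply: (@le_trans _ _ (\int[distribution P (coarsen P G1m)]_a (s2 / n%:R)%:E)%E).
  apply: ge0_le_integral_setT => a.
    by apply: integral_ge0 => b _; rewrite lee_fin sqr_ge0.
  rewrite ge0_integral_distribution.
  - exact: (batch_variance n_gt0 (unb a) (ms a) law indep).
  - apply/measurable_EFinP.
    have hb : measurable_fun [set: T2] (fun b : T2 => (a, b) : T1 * T2).
      exact: measurable_fun_pair.
    exact: measurableT_comp mN hb.
  - by move=> b; rewrite lee_fin sqr_ge0.
by rewrite integral_cst//= probability_setT mule1.
Qed.

End FreshBatch.

(** * Measurability of the iterates *)

Section MeasurableMatrices.
Variable R : realType.

Definition measurable_mx d (T : measurableType d) m n (A : T -> 'M[R]_(m, n)) : Prop :=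
  forall i j, measurable_fun setT (fun w => A w i j).

Section Closure.
Variables (d : measure_display) (T : measurableType d).

Lemma measurable_mx_cst m n (A : 'M[R]_(m, n)) : measurable_mx (fun _ : T => A).
Proof. by move=> i j; exact: measurable_cst. Qed.

Lemma measurable_mxB m n (A B : T -> 'M[R]_(m, n)) :
  measurable_mx A -> measurable_mx B -> measurable_mx (fun w => A w - B w).
Proof.
move=> mA mB i j; under eq_fun do rewrite !mxE; exact: measurable_funB.
Qed.

Lemma measurable_mxD m n (A B : T -> 'M[R]_(m, n)) :
  measurable_mx A -> measurable_mx B -> measurable_mx (fun w => A w + B w).
Proof.
move=> mA mB i j; under eq_fun do rewrite !mxE; exact: measurable_funD.
Qed.

Lemma measurable_mxZ m n c (A : T -> 'M[R]_(m, n)) :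
  measurable_mx A -> measurable_mx (fun w => c *: A w).
Proof.
move=> mA i j; under eq_fun do rewrite !mxE; exact: measurable_funM.
Qed.

Lemma measurable_mxM m n r (A : T -> 'M[R]_(m, n)) (B : T -> 'M[R]_(n, r)) :
  measurable_mx A -> measurable_mx B -> measurable_mx (fun w => A w *m B w).
Proof.
move=> mA mB i j; under eq_fun do rewrite !mxE.
by apply: measurable_sum => k; exact: measurable_funM.
Qed.

Lemma measurable_mx_col m n (A : T -> 'cV[R]_m) (B : T -> 'cV[R]_n) :
  measurable_mx A -> measurable_mx B -> measurable_mx (fun w => col_mx (A w) (B w)).
Proof.
move=> mA mB i j; case: (split_ordP i) => k ->.
  by under eq_fun do rewrite col_mxEu; exact: mA.
by under eq_fun do rewrite col_mxEd; exact: mB.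
Qed.

Lemma measurable_l2norm_sqr n (u : T -> 'cV[R]_n) :
  measurable_mx u -> measurable_fun setT (fun w => l2norm (u w) ^+ 2).
Proof.
move=> mu; under eq_fun.
  move=> w; rewrite /l2norm sqr_sqrtr; first over.
  by apply: sumr_ge0 => i _; exact: sqr_ge0.
by apply: measurable_sum => i; apply: measurable_funX; exact: mu.
Qed.

Lemma measurable_batch_mean (S : Type) m n (H : T -> S -> 'M[R]_(m, n))
  (zeta : nat -> T -> S) N :
  (forall i, (i < N)%N -> measurable_mx (fun w => H w (zeta i w))) ->
  measurable_mx (fun w => batch_mean [seq zeta i w | i <- iota 0 N] (H w)).
Proof.
move=> mH i j.
rewrite (_ : (fun w => _) = fun w => N%:R^-1 * \sum_(k < N) H w (zeta k w) i j).
  apply: measurable_funM => //; apply: measurable_sum => k; exact: mH.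
apply/funext => w; rewrite /batch_mean size_map size_iota big_map -{2}(subn0 N).
by rewrite -/(index_iota 0 N) big_mkord mxE summxE.
Qed.

End Closure.

Lemma measurable_mx_comp d1 d2 (T1 : measurableType d1) (T2 : measurableType d2) m n
  (A : T2 -> 'M[R]_(m, n)) (f : T1 -> T2) :
  measurable_fun setT f -> measurable_mx A -> measurable_mx (fun w => A (f w)).
Proof. by move=> mf mA i j; exact: measurableT_comp (mA i j) mf. Qed.

Lemma measurable_countable_choice d (T : measurableType d) (I : countType)
  (k : T -> I) (F : I -> T -> R) :
  (forall i, measurable [set w | k w = i]) -> (forall i, measurable_fun setT (F i)) ->
  measurable_fun setT (fun w => F (k w) w).
Proof.
move=> mk mF _ B mB; rewrite setTI.
rewrite (_ : _ @^-1` B = \bigcup_(n : nat)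
    if unpickle n is Some i then [set w | k w = i] `&` F i @^-1` B else set0).
  apply: bigcupT_measurable => n; case: unpickle => // i; apply: measurableI => //.
  by rewrite -[X in measurable X]setTI; exact: mF.
apply/seteqP; split => w /=.
  by move=> h; exists (pickle (k w)) => //; rewrite pickleK.
by move=> [n _]; case: unpickle => // i [/= -> ].
Qed.

Section Caratheodory.
Variables (d : measure_display) (T : measurableType d) (N : nat).
Variables (Z : T -> 'cV[R]_N) (psi : 'cV[R]_N -> T -> R) (c : R).
Hypothesis mZ : measurable_mx Z.
Hypothesis mpsi : forall z, measurable_fun setT (psi z).
Hypothesis lpsi : forall z z' w, `|psi z w - psi z' w| <= c * l2norm (z - z').

Let cell (n : nat) (w : T) : 'cV[int]_N := \col_i Num.floor (n.+1%:R * Z w i 0).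
Let centre (n : nat) (v : 'cV[int]_N) : 'cV[R]_N := \col_i ((v i 0)%:~R / n.+1%:R).

Let measurable_cell n v : measurable [set w | cell n w = v].
Proof.
rewrite (_ : [set w | _] = \bigcap_(i in [set: 'I_N])
    (fun w => n.+1%:R * Z w i 0) @^-1` [set` `[(v i 0)%:~R, (v i 0 + 1)%:~R[]).
  apply: fin_bigcap_measurable => [|i _]; first exact: finite_finset.
  rewrite -[X in measurable X]setTI.
  have m : measurable_fun setT (fun w => n.+1%:R * Z w i 0) by apply: measurable_funM.
  by apply: m => //; exact: measurable_itv.
apply/seteqP; split => w /=.
  by move=> <- i _ /=; rewrite mxE in_itv/= floor_itv.
move=> h; apply/matrixP => i j; rewrite ord1 mxE.
by apply: floor_def; have := h i I; rewrite /= in_itv.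
Qed.

Let measurable_rounded n : measurable_fun setT (fun w => psi (centre n (cell n w)) w).
Proof.
exact: (measurable_countable_choice (F := fun v => psi (centre n v)) (measurable_cell n)).
Qed.

Let rounded_close n w : l2norm (centre n (cell n w) - Z w) <= N%:R * harmonic n.
Proof.
apply: le_trans (l2norm_le_sum _) _.
rewrite -[N in X in _ <= X]card_ord mulr_natl -sumr_const; apply: ler_sum => i _.
have n0 : 0 < n.+1%:R :> R by rewrite ltr0n.
rewrite !mxE /harmonic -(ler_pM2l n0) mulfV ?gt_eqF// -{1}(gtr0_norm n0) -normrM.
rewrite mulrBr mulrCA mulfV ?gt_eqF// mulr1 ler_norml.
have := floor_itv (n.+1%:R * Z w i 0); rewrite intrD; lra.
Qed.

(** The curve Z is rounded to the countably many centres of a grid, where only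
    the measurability of each psi z matters; the Lipschitz bound lets the mesh of
    the grid tend to 0. *)
Lemma measurable_caratheodory : measurable_fun setT (fun w => psi (Z w) w).
Proof.
apply: (measurable_fun_cvg measurable_rounded) => w _.
have c0 : 0 <= `|c| by [].
apply/cvgrPdist_le => e e0.
have K0 : 0 < `|c| * N%:R + 1 by rewrite ltr_pwDr// mulr_ge0.
have := @cvg_harmonic R => /cvgrPdist_le/(_ (e / (`|c| * N%:R + 1))); rewrite divr_gt0// => /(_ isT).
apply: filterS => n; rewrite sub0r normrN ger0_norm ?harmonic_ge0// => hn.
rewrite distrC (le_trans (lpsi _ _ _))//.
apply: (@le_trans _ _ (`|c| * (N%:R * harmonic n))).
  apply: le_trans (ler_wpM2r (l2norm_ge0 _) (ler_norm c)) _.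
  by rewrite ler_wpM2l.
rewrite ler_pdivlMr// in hn.
by have := harmonic_ge0 (R := R) n; move: hn; rewrite mulrA; nra.
Qed.

End Caratheodory.

(** The regularity of a sampled derivative that makes it jointly measurable in
    the sample and the point. *)
Definition oracle d (S : measurableType d) p q m n
    (H : S -> 'cV[R]_p -> 'cV[R]_q -> 'M[R]_(m, n)) : Prop :=
  (forall x y, measurable_mx (fun s => H s x y)) /\
  exists c, forall s x y x' y' i j,
    `|H s x y i j - H s x' y' i j| <= c * l2norm (col_mx (x - x') (y - y')).

Lemma oracle_measurable d d' (T : measurableType d) (S : measurableType d') p q m n
  (H : S -> 'cV[R]_p -> 'cV[R]_q -> 'M[R]_(m, n))
  (zeta : T -> S) (X : T -> 'cV[R]_p) (Y : T -> 'cV[R]_q) :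
  oracle H -> measurable_fun setT zeta -> measurable_mx X -> measurable_mx Y ->
  measurable_mx (fun w => H (zeta w) (X w) (Y w)).
Proof.
move=> [mH [c lH]] mz mX mY i j.
have := @measurable_caratheodory _ _ _ (fun w => col_mx (X w) (Y w))
  (fun z w => H (zeta w) (usubmx z) (dsubmx z) i j) c (measurable_mx_col mX mY).
rewrite (_ : (fun w => _) = fun w => H (zeta w) (X w) (Y w) i j); last first.
  by apply/funext => w; rewrite col_mxKu col_mxKd.
apply=> [z|z z' w]; first exact: measurableT_comp (mH _ _ _ _) mz.
by rewrite (le_trans (lH _ _ _ _ _ _ _))// -!linearB/= vsubmxK.
Qed.

End MeasurableMatrices.

Section Oracles.
Variables (R : realType) (p q : nat) (pb : bilevel_problem R p q).
Variables (L M tau rho mu : R).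
Hypotheses (L_gt0 : 0 < L) (M_ge0 : 0 <= M) (tau_ge0 : 0 <= tau) (rho_ge0 : 0 <= rho).
Hypotheses (mu_gt0 : 0 < mu) (q_gt0 : (0 < q)%N).
Hypothesis asm1 : assumption1 pb mu.
Hypothesis asm2 : assumption2 pb L M tau rho.
Variables (sf sg sg1 sg2 : R).
Hypothesis asm3 : assumption3 pb sf sg sg1 sg2.

Local Notation f := (f_ pb).
Local Notation g := (g_ pb).
Local Notation vstar := (vs f g (ystar pb)).

Lemma unbiased_measurable d (S : measurableType d) (Q : probability S R) m n
  (H : S -> 'M[R]_(m, n)) H0 : unbiased Q H H0 -> measurable_mx H.
Proof.
by move=> h i j; have [/measurable_int/measurable_EFinP] := h i j.
Qed.

Lemma unbiased_col d (S : measurableType d) (Q : probability S R) m n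
  (A : S -> 'cV[R]_m) (B : S -> 'cV[R]_n) A0 B0 :
  unbiased Q (fun s => col_mx (A s) (B s)) (col_mx A0 B0) ->
  unbiased Q A A0 /\ unbiased Q B B0.
Proof.
move=> h; split=> i j.
  have := h (lshift n i) j; rewrite col_mxEu.
  by rewrite (_ : (fun s => col_mx _ _ _ _) = fun s => A s i j)//; apply/funext => s; rewrite col_mxEu.
have := h (rshift m i) j; rewrite col_mxEd.
by rewrite (_ : (fun s => col_mx _ _ _ _) = fun s => B s i j)//; apply/funext => s; rewrite col_mxEd.
Qed.

Lemma unbiased_F x y :
  unbiased (xi_law pb) (fun xi => grad_x (F_ xi) x y) (grad_x f x y) /\
  unbiased (xi_law pb) (fun xi => grad_y (F_ xi) x y) (grad_y f x y).
Proof.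
have [[h _ _ _] _] := asm3 x y; apply: unbiased_col; move: h; rewrite gradE.
by under eq_fun do rewrite gradE.
Qed.

Lemma unbiased_G x y :
  unbiased (zeta_law pb) (fun zeta => grad_y (G_ zeta) x y) (grad_y g x y).
Proof.
have [[_ h _ _] _] := asm3 x y.
suff /unbiased_col[] : unbiased (zeta_law pb)
  (fun zeta => col_mx (grad_x (G_ zeta) x y) (grad_y (G_ zeta) x y))
  (col_mx (grad_x g x y) (grad_y g x y)) by [].
by move: h; rewrite gradE; under eq_fun do rewrite gradE.
Qed.

Lemma vector_lipschitz n (h : 'cV[R]_p -> 'cV[R]_q -> 'cV[R]_n) c x y x' y' (i : 'I_n) (j : 'I_1) :
  l2norm (h x y - h x' y') <= c * l2norm (col_mx (x - x') (y - y')) ->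
  `|h x y i j - h x' y' i j| <= c * l2norm (col_mx (x - x') (y - y')).
Proof.
apply: le_trans; rewrite ord1.
by have := coord_le_l2norm (h x y - h x' y') i; rewrite !mxE.
Qed.

Lemma matrix_lipschitz m (h : 'cV[R]_p -> 'cV[R]_q -> 'M[R]_(m, q)) c x y x' y' i j :
  (forall v, l2norm ((h x y - h x' y') *m v)
     <= c * l2norm (col_mx (x - x') (y - y')) * l2norm v) ->
  `|h x y i j - h x' y' i j| <= c * l2norm (col_mx (x - x') (y - y')).
Proof.
move=> /(_ (delta_mx j 0)); rewrite l2norm_delta mulr1; apply: le_trans.
by have := coord_le_l2norm ((h x y - h x' y') *m delta_mx j 0) i; rewrite -colE !mxE.
Qed.

Lemma oracle_Fx : oracle (fun xi : xi_space pb => grad_x (F_ xi)).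
Proof.
split=> [x y|]; first by have [/unbiased_measurable] := unbiased_F x y.
exists L => xi x y x' y' i j; apply: vector_lipschitz; apply: grad_x_lipschitz.
by have [] := Freg asm2 xi.
Qed.

Lemma oracle_Fy : oracle (fun xi : xi_space pb => grad_y (F_ xi)).
Proof.
split=> [x y|]; first by have [_ /unbiased_measurable] := unbiased_F x y.
exists L => xi x y x' y' i j; apply: vector_lipschitz; apply: grad_y_lipschitz.
by have [] := Freg asm2 xi.
Qed.

Lemma oracle_Gy : oracle (fun zeta : zeta_space pb => grad_y (G_ zeta)).
Proof.
split=> [x y|]; first exact: unbiased_measurable (unbiased_G x y).
exists L => zeta x y x' y' i j; apply: vector_lipschitz; apply: grad_y_lipschitz.
by have [] := Greg asm2 zeta.
Qed.

Lemma oracle_jac : oracle (fun zeta : zeta_space pb => jac_xy (G_ zeta)).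
Proof.
split=> [x y|]; first by have [[_ _ /unbiased_measurable]] := asm3 x y.
exists tau => zeta x y x' y' i j; apply: matrix_lipschitz.
exact: jac_xy_lipschitz (Greg asm2 zeta) x y x' y'.
Qed.

Lemma oracle_hess : oracle (fun zeta : zeta_space pb => hess_y (G_ zeta)).
Proof.
split=> [x y|]; first by have [[_ _ _ /unbiased_measurable]] := asm3 x y.
exists rho => zeta x y x' y' i j; apply: matrix_lipschitz.
exact: hess_y_lipschitz (Greg asm2 zeta) x y x' y'.
Qed.

Lemma lipschitz_measurable d (T : measurableType d) m n
  (h : 'cV[R]_p -> 'cV[R]_q -> 'M[R]_(m, n)) c (x : T -> 'cV[R]_p) (y : T -> 'cV[R]_q) :
  (forall x y x' y' i j, `|h x y i j - h x' y' i j| <= c * l2norm (col_mx (x - x') (y - y'))) ->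
  measurable_mx x -> measurable_mx y -> measurable_mx (fun w => h (x w) (y w)).
Proof.
move=> lh mx my.
apply: (@oracle_measurable _ _ _ T T _ _ _ _ (fun _ => h) id x y) => //.
by split=> [x' y'|]; [exact: measurable_mx_cst|exists c].
Qed.

Section Population.
Variables (d : measure_display) (T : measurableType d).
Variables (x : T -> 'cV[R]_p) (y : T -> 'cV[R]_q).
Hypotheses (mx : measurable_mx x) (my : measurable_mx y).

Lemma measurable_grad_x_f : measurable_mx (fun w => grad_x f (x w) (y w)).
Proof.
apply: (@lipschitz_measurable _ _ _ _ _ L) => // *; apply: vector_lipschitz.
by apply: grad_x_lipschitz; have [] := freg asm2.
Qed.

Lemma measurable_grad_y_f : measurable_mx (fun w => grad_y f (x w) (y w)).
Proof.
apply: (@lipschitz_measurable _ _ _ _ _ L) => // *; apply: vector_lipschitz.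
by apply: grad_y_lipschitz; have [] := freg asm2.
Qed.

Lemma measurable_grad_y_g : measurable_mx (fun w => grad_y g (x w) (y w)).
Proof.
apply: (@lipschitz_measurable _ _ _ _ _ L) => // *; apply: vector_lipschitz.
by apply: grad_y_lipschitz; have [] := greg asm2.
Qed.

Lemma measurable_jac_g : measurable_mx (fun w => jac_xy g (x w) (y w)).
Proof.
apply: (@lipschitz_measurable _ _ _ _ _ tau) => // *; apply: matrix_lipschitz.
exact: jac_xy_lipschitz (greg asm2) _ _ _ _.
Qed.

Lemma measurable_hess_g : measurable_mx (fun w => hess_y g (x w) (y w)).
Proof.
apply: (@lipschitz_measurable _ _ _ _ _ rho) => // *; apply: matrix_lipschitz.
exact: hess_y_lipschitz (greg asm2) _ _ _ _.
Qed.

Lemma measurable_of_x n (h : 'cV[R]_p -> 'cV[R]_n) c : 0 <= c ->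
  (forall x x', l2norm (h x' - h x) <= c * l2norm (x' - x)) ->
  measurable_mx (fun w => h (x w)).
Proof.
move=> c0 hh; apply: (@lipschitz_measurable _ _ _ _ (fun x _ => h x) c x y) => // *.
apply: (@vector_lipschitz _ (fun x _ => h x)); apply: le_trans (hh _ _) _.
rewrite ler_wpM2l//; set dx := _ - _; set dy := _ - _.
by have := l2norm_usubmx (col_mx dx dy); rewrite col_mxKu.
Qed.

Lemma measurable_vstar : measurable_mx (fun w => vstar (x w)).
Proof.
pose K := C1 mu L M rho ^+ 2 * (1 + (L / mu) ^+ 2).
have K0 : 0 <= K by rewrite mulr_ge0 ?addr_ge0 ?sqr_ge0.
apply: (@measurable_of_x _ _ (Num.sqrt K)); first exact: sqrtr_ge0.
move=> x1 x2; rewrite -ler_sqr ?nnegrE ?mulr_ge0 ?l2norm_ge0 ?sqrtr_ge0//.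
rewrite exprMn [Num.sqrt K ^+ 2]sqr_sqrtr//.
exact: (vs_lipschitz L_gt0 M_ge0 rho_ge0 mu_gt0 (mu_le_L q_gt0 asm1 asm2)
  (freg asm2) (greg asm2) (gsc asm1) (ystar_stationary L_gt0 mu_gt0 q_gt0 asm1 asm2) x1 x2).
Qed.

Lemma measurable_gradient_Phi : measurable_mx (fun w => gradient (Phi pb) (x w)).
Proof.
have [c c0 hc] := hyper_lipschitz L_gt0 M_ge0 tau_ge0 rho_ge0 mu_gt0
  (mu_le_L q_gt0 asm1 asm2) (freg asm2) (greg asm2) (gsc asm1)
  (ystar_stationary L_gt0 mu_gt0 q_gt0 asm1 asm2).
apply: (@measurable_of_x _ _ c) => // x1 x2.
by rewrite !(Phi_gradient L_gt0 M_ge0 tau_ge0 rho_ge0 mu_gt0 q_gt0 asm1 asm2).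
Qed.

End Population.

Section Iterates.
Variables (d : measure_display) (T : measurableType d) (c : ssgd_config).
Variables (alpha beta eta : R) (x0 : 'cV[R]_p) (y0 v0 : 'cV[R]_q).
Variables (DF : nat -> nat -> T -> xi_space pb) (DG : nat -> nat -> T -> zeta_space pb).
Variables (Sy Bv : nat -> nat -> nat -> T -> zeta_space pb).
Variable Fv : nat -> nat -> nat -> T -> xi_space pb.

Definition sets_of (w : T) : sample_sets (xi_space pb) (zeta_space pb) :=
  SampleSets
    (fun k => [seq DF k i w | i <- iota 0 (cDf c)])
    (fun k => [seq DG k i w | i <- iota 0 (cDg c)])
    (fun k t => [seq Sy k t i w | i <- iota 0 (cS c)])
    (fun k j => [seq Bv k j i w | i <- iota 0 (cD c)])
    (fun k j => [seq Fv k j i w | i <- iota 0 (cDf c)]).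

Local Notation st k w := (ssgd alpha beta eta (cT c) (cJ c) (sets_of w) x0 y0 v0 k).

Definition known_h k : Prop :=
  (forall i, (i < cDf c)%N -> measurable_fun setT (DF k i)) /\
  (forall i, (i < cDg c)%N -> measurable_fun setT (DG k i)).
Definition known_y k t : Prop :=
  forall t' i, (t' < t)%N -> (i < cS c)%N -> measurable_fun setT (Sy k t' i).
Definition known_v k j : Prop := forall j' i, (j' < j)%N ->
  ((i < cD c)%N -> measurable_fun setT (Bv k j' i)) /\
  ((i < cDf c)%N -> measurable_fun setT (Fv k j' i)).

Definition known_before k : Prop :=
  forall k', (k' < k)%N -> [/\ known_h k', known_y k' (cT c) & known_v k' (cJ c)].

Lemma measurable_y_loop k t (x : T -> 'cV[R]_p) (y : T -> 'cV[R]_q) :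
  known_y k t -> measurable_mx x -> measurable_mx y ->
  measurable_mx (fun w => y_loop beta (S_set (sets_of w) k) (x w) (y w) t).
Proof.
move=> kn mx my; elim: t kn => [//|t IH] kn /=.
have mt := IH (fun t' i ht => kn t' i (ltnW ht)).
apply: measurable_mxB => //; apply: measurable_mxZ.
apply: measurable_batch_mean => i ni.
by apply: (oracle_measurable oracle_Gy) => //; exact: kn.
Qed.

Lemma measurable_v_loop k j (x : T -> 'cV[R]_p) (y v : T -> 'cV[R]_q) :
  known_v k j -> measurable_mx x -> measurable_mx y -> measurable_mx v ->
  measurable_mx (fun w =>
    v_loop eta (B_set (sets_of w) k) (DFj_set (sets_of w) k) (x w) (y w) (v w) j).
Proof.
move=> kn mx my mv; elim: j kn => [//|j IH] kn /=.
have mj := IH (fun j' i hj => kn j' i (ltnW hj)).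
apply: measurable_mxD.
  apply: measurable_mxM => //; apply: measurable_mxB; first exact: measurable_mx_cst.
  apply: measurable_mxZ; apply: measurable_batch_mean => i ni.
  by apply: (oracle_measurable oracle_hess) => //; exact: (kn j i (ltnSn j)).1.
apply: measurable_mxZ; apply: measurable_batch_mean => i ni.
by apply: (oracle_measurable oracle_Fy) => //; exact: (kn j i (ltnSn j)).2.
Qed.

Lemma measurable_hypergrad k (x : T -> 'cV[R]_p) (y v : T -> 'cV[R]_q) :
  known_h k -> measurable_mx x -> measurable_mx y -> measurable_mx v ->
  measurable_mx (fun w =>
    hypergrad (DF_set (sets_of w) k) (DG_set (sets_of w) k) (x w) (y w) (v w)).
Proof.
move=> [kF kG] mx my mv; apply: measurable_mxB.
  apply: measurable_batch_mean => i ni.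
  by apply: (oracle_measurable oracle_Fx) => //; exact: kF.
apply: measurable_mxM => //; apply: measurable_batch_mean => i ni.
by apply: (oracle_measurable oracle_jac) => //; exact: kG.
Qed.

Lemma measurable_ssgd k : known_before k ->
  [/\ measurable_mx (fun w => (st k w).1.1), measurable_mx (fun w => (st k w).1.2) &
      measurable_mx (fun w => (st k w).2)].
Proof.
elim: k => [_|k IH kn]; first by split; exact: measurable_mx_cst.
have [mx my mv] := IH (fun k' h => kn k' (ltnW h)).
have [kh ky kv] := kn k (ltnSn k).
have mx1 : measurable_mx (fun w => (st k.+1 w).1.1).
  rewrite (_ : (fun w => _) = fun w => (st k w).1.1 - alpha *: hypergrad (DF_set (sets_of w) k)
    (DG_set (sets_of w) k) (st k w).1.1 (st k w).1.2 (st k w).2).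
    by apply: measurable_mxB => //; apply: measurable_mxZ; exact: measurable_hypergrad.
  by apply/funext => w; have [->] := ssgdS beta eta alpha (cT c) (cJ c) x0 y0 v0 (sets_of w) k.
have my1 : measurable_mx (fun w => (st k.+1 w).1.2).
  rewrite (_ : (fun w => _) = fun w => y_loop beta (S_set (sets_of w) k) (st k.+1 w).1.1 (st k w).1.2 (cT c)).
    exact: measurable_y_loop.
  by apply/funext => w; have [_ ->] := ssgdS beta eta alpha (cT c) (cJ c) x0 y0 v0 (sets_of w) k.
split => //.
rewrite (_ : (fun w => _) = fun w => v_loop eta (B_set (sets_of w) k) (DFj_set (sets_of w) k)
  (st k.+1 w).1.1 (st k.+1 w).1.2 (st k w).2 (cJ c)); first exact: measurable_v_loop.
by apply/funext => w; have [_ _ ->] := ssgdS beta eta alpha (cT c) (cJ c) x0 y0 v0 (sets_of w) k.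
Qed.

Lemma measurable_next_x k : known_before k -> known_h k ->
  measurable_mx (fun w => (st k.+1 w).1.1).
Proof.
move=> kn kh; have [mx my mv] := measurable_ssgd kn.
rewrite (_ : (fun w => _) = fun w => (st k w).1.1 - alpha *: hypergrad (DF_set (sets_of w) k)
  (DG_set (sets_of w) k) (st k w).1.1 (st k w).1.2 (st k w).2).
  by apply: measurable_mxB => //; apply: measurable_mxZ; exact: measurable_hypergrad.
by apply/funext => w; have [->] := ssgdS beta eta alpha (cT c) (cJ c) x0 y0 v0 (sets_of w) k.
Qed.

End Iterates.

End Oracles.

(** * Expected noise along the run *)

Section DrawBatch.
Variables (R : realType) (p q : nat) (pb : bilevel_problem R p q).
Variables (d : measure_display) (Omega : measurableType d) (P : probability Omega R).
Variables (c : ssgd_config) (X : ssgd_samples pb P).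

Lemma measurable_draw A a d' (S : measurableType d') (Y : {RV P >-> S}) :
  A a -> draw_events X a = events_of Y ->
  measurable_fun (setT : set (g_sigma_algebraType (draws X A))) Y.
Proof.
move=> Aa e; apply: measurable_generated; rewrite -e.
by move=> B EB; exists a.
Qed.

Hypothesis fresh : fresh_sampling c X.

Definition rest (b : nat -> draw) (N : nat) : set draw :=
  [set a | performed c a /\ forall i, (i < N)%N -> a <> b i].

(** The point where a batch is evaluated is a function of the other draws. *)
Lemma draw_batch_variance d' (S : measurableType d') (Q : probability S R) m N
  (b : nat -> draw) (zeta : nat -> {RV P >-> S})
  (H : Omega -> S -> 'cV[R]_m) (H0 : Omega -> 'cV[R]_m) s2 :
  let T1 := g_sigma_algebraType (draws X (rest b N)) in
  (0 < N)%N -> (forall i, (i < N)%N -> performed c (b i)) -> injective b ->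
  (forall i, draw_events X (b i) = events_of (zeta i)) ->
  (forall i, (i < N)%N -> has_law (zeta i) Q) ->
  measurable_mx (fun z : T1 * S => H z.1 z.2) ->
  measurable_mx (fun w : T1 => H0 w) ->
  (forall w, unbiased Q (H w) (H0 w)) ->
  (forall w, \int[Q]_s (l2norm (H w s - H0 w) ^+ 2)%:E <= s2%:E)%E ->
  (\int[P]_w (l2norm (noise [seq zeta i w | i <- iota 0 N] (H w) (H0 w)) ^+ 2)%:E
     <= (s2 / N%:R)%:E)%E.
Proof.
move=> T1 N0 pN inj eN law mH mH0 unb ms.
pose B := [set a | exists2 i, (i < N)%N & a = b i].
apply: (@fresh_batch_variance _ _ _ _ _ _ Q (draws X (rest b N)) (draws X B)) => //.
- exact: draws_measurable.
- exact: draws_measurable.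
- apply: (draws_independent fresh) => [a []//|a [i iN ->]|a [_ h] [i iN]]; first exact: pN.
  exact: h.
- by move=> i iN; apply: (@measurable_draw _ (b i)) => //; exists i.
- move=> i j iN jN ij C E mC mE.
  have gen k F : measurable F -> <<s draws X [set b k] >> (zeta k @^-1` F).
    move=> mF; apply: sub_sigma_algebra; exists (b k) => //; rewrite eN.
    by exists F => //; rewrite setTI.
  apply: (draws_independent fresh _ _ _ (gen _ _ mC) (gen _ _ mE)).
  + by move=> _ ->; exact: pN.
  + by move=> _ ->; exact: pN.
  + by move=> a -> /inj ji; rewrite ji eqxx in ij.
Qed.

Definition draw_time (a : draw) : nat :=
  match a with
  | Draw_DF k _ | Draw_DG k _ | Draw_S k _ _ | Draw_B k _ _ | Draw_DFj k _ _ => k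
  end.

Section Known.
Variables (b : nat -> draw) (N : nat).
Local Notation T1 := (g_sigma_algebraType (draws X (rest b N))).
Local Notation DF := (fun k i (w : T1) => DF_rv X k i w).
Local Notation DG := (fun k i (w : T1) => DG_rv X k i w).
Local Notation Sy := (fun k t i (w : T1) => S_rv X k t i w).
Local Notation Bv := (fun k j i (w : T1) => B_rv X k j i w).
Local Notation Fv := (fun k j i (w : T1) => DFj_rv X k j i w).

Lemma known_h_rest k : (k <= cK c)%N ->
  (forall i j, (i < N)%N -> b i <> Draw_DF k j /\ b i <> Draw_DG k j) ->
  known_h c DF DG k.
Proof.
move=> kK h; split=> i iN.
  apply: (@measurable_draw _ (Draw_DF k i)) => //; split => // j jN /esym.
  by case: (h j i jN).
apply: (@measurable_draw _ (Draw_DG k i)) => //; split => // j jN /esym.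
by case: (h j i jN).
Qed.

Lemma known_y_rest k t : (k < cK c)%N -> (t <= cT c)%N ->
  (forall i t' j, (i < N)%N -> (t' < t)%N -> b i <> Draw_S k t' j) ->
  known_y c Sy k t.
Proof.
move=> kK tT h t' i t't iN; apply: (@measurable_draw _ (Draw_S k t' i)) => //; split.
  by split => //; exact: leq_trans t't tT.
by move=> j jN /esym; exact: h.
Qed.

Lemma known_v_rest k : (k < cK c)%N ->
  (forall i j' j, (i < N)%N -> b i <> Draw_B k j' j /\ b i <> Draw_DFj k j' j) ->
  known_v c Bv Fv k (cJ c).
Proof.
move=> kK h j' i j'J; split=> iN.
  apply: (@measurable_draw _ (Draw_B k j' i)) => //; split => // j jN /esym.
  by case: (h j j' i jN).
apply: (@measurable_draw _ (Draw_DFj k j' i)) => //; split => // j jN /esym.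
by case: (h j j' i jN).
Qed.

Lemma known_before_rest k : (k <= cK c)%N ->
  (forall i, (i < N)%N -> (k <= draw_time (b i))%N) ->
  known_before c DF DG Sy Bv Fv k.
Proof.
move=> kK h k' k'k; have k'K := leq_trans k'k kK.
have no i a : (i < N)%N -> draw_time a = k' -> b i <> a.
  by move=> /h bk at_ ba; move: bk; rewrite ba at_ leqNgt k'k.
split.
- by apply: known_h_rest; [exact: ltnW|move=> i j iN; split; exact: no].
- by apply: known_y_rest => // i t' j iN _; exact: no.
- by apply: known_v_rest => // i j' j iN; split; exact: no.
Qed.

End Known.

End DrawBatch.

Section Moments.
Variables (R : realType) (d : measure_display) (S : measurableType d) (Q : probability S R).

Lemma unbiased_mulmx m n r (H : S -> 'M[R]_(m, n)) H0 (v : 'M[R]_(n, r)) :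
  unbiased Q H H0 -> unbiased Q (fun s => H s *m v) (H0 *m v).
Proof.
move=> h i j.
have hk k : Q.-integrable setT (fun s => (v k j)%:E * (H s i k)%:E)%E.
  by apply: integrableZl => //; exact: (h i k).1.
have E s : ((H s *m v) i j)%:E = (\sum_k (v k j)%:E * (H s i k)%:E)%E.
  by rewrite mxE -sumEFin; apply: eq_bigr => k _; rewrite -EFinM mulrC.
split.
  rewrite (_ : EFin \o _ = fun s => (\sum_k (v k j)%:E * (H s i k)%:E)%E).
    by apply: integrable_sum => // k _; exact: hk.
  by apply/funext => s; exact: E.
rewrite unlock; under eq_integral do rewrite E.
rewrite integral_sum// mxE -sumEFin; apply: eq_bigr => k _.
rewrite integralZl//; last exact: (h i k).1.
by have := (h i k).2; rewrite unlock => ->; rewrite -EFinM mulrC.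
Qed.

(** The spectral norm is a supremum over an uncountable family: the two integrals
    are compared through simple functions. *)
Lemma mean_square_mono (V : zmodType) (nrm : V -> R) (H : S -> V) H0 sigma
  (f : S -> R) k : mean_square_le Q nrm H H0 sigma -> measurable_fun setT f ->
  0 <= k -> (forall s, 0 <= f s <= k * nrm (H s - H0) ^+ 2) ->
  (\int[Q]_s (f s)%:E <= (k * sigma ^+ 2)%:E)%E.
Proof.
rewrite /mean_square_le unlock => ms mf; rewrite le_eqVlt => /predU1P[<-|k0] hf.
  rewrite mul0r integral0_eq// => s _; congr EFin; apply: le_anti.
  by have := hf s; rewrite mul0r andbC.
rewrite (_ : (fun s => (f s)%:E) = fun s => (k%:E * (k^-1 * f s)%:E)%E); last first.
  by apply/funext => s; rewrite -EFinM mulrA mulfV ?mul1r// gt_eqF.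
have f0 s : 0 <= f s by case/andP: (hf s).
have kf0 s : 0 <= k^-1 * f s by rewrite mulr_ge0// invr_ge0 ltW.
rewrite ge0_integralZl//; last 3 first.
- by apply/measurable_EFinP; exact: measurable_funM.
- by move=> s _; rewrite lee_fin.
- by rewrite lee_fin ltW.
rewrite [(k * _)%:E]EFinM; apply: lee_wpmul2l; first by rewrite lee_fin ltW.
apply: le_trans ms.
apply: ge0_le_integral_setT => s; rewrite lee_fin//.
by rewrite mulrC ler_pdivrMr// mulrC; case/andP: (hf s).
Qed.

End Moments.

Section ExpectedNoise.
Variables (R : realType) (p q : nat) (pb : bilevel_problem R p q).
Variables (L M tau rho mu : R).
Hypotheses (L_gt0 : 0 < L) (M_ge0 : 0 <= M) (tau_ge0 : 0 <= tau) (rho_ge0 : 0 <= rho).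
Hypotheses (mu_gt0 : 0 < mu) (q_gt0 : (0 < q)%N).
Hypothesis asm1 : assumption1 pb mu.
Hypothesis asm2 : assumption2 pb L M tau rho.
Variables (sf sg sg1 sg2 : R).
Hypothesis asm3 : assumption3 pb sf sg sg1 sg2.

Local Notation f := (f_ pb).
Local Notation g := (g_ pb).
Local Notation vstar := (vs f g (ystar pb)).

Let measurable_dev d (S : measurableType d) n (H : S -> 'cV[R]_n) H0 :
  measurable_mx H -> measurable_fun setT (fun s => l2norm (H s - H0) ^+ 2).
Proof.
move=> mH; apply: measurable_l2norm_sqr; exact: measurable_mxB.
Qed.

Lemma mean_square_Fx x y :
  (\int[xi_law pb]_s (l2norm (grad_x (F_ s) x y - grad_x f x y) ^+ 2)%:E <= (sf ^+ 2)%:E)%E.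
Proof.
have [_ [h _ _ _]] := asm3 x y; rewrite -[sf ^+ 2]mul1r.
apply: (mean_square_mono h) => // [|s].
  by apply: measurable_dev; case: (oracle_Fx asm2 asm3) => + _; exact.
rewrite sqr_ge0 mul1r ler_sqr ?nnegrE ?l2norm_ge0//= !gradE opp_col_mx add_col_mx.
by have := l2norm_usubmx (col_mx (grad_x (F_ s) x y - grad_x f x y) (grad_y (F_ s) x y - grad_y f x y)); rewrite col_mxKu.
Qed.

Lemma mean_square_Fy x y :
  (\int[xi_law pb]_s (l2norm (grad_y (F_ s) x y - grad_y f x y) ^+ 2)%:E <= (sf ^+ 2)%:E)%E.
Proof.
have [_ [h _ _ _]] := asm3 x y; rewrite -[sf ^+ 2]mul1r.
apply: (mean_square_mono h) => // [|s].
  by apply: measurable_dev; case: (oracle_Fy asm2 asm3) => + _; exact.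
rewrite sqr_ge0 mul1r ler_sqr ?nnegrE ?l2norm_ge0//= !gradE opp_col_mx add_col_mx.
by have := l2norm_dsubmx (col_mx (grad_x (F_ s) x y - grad_x f x y) (grad_y (F_ s) x y - grad_y f x y)); rewrite col_mxKd.
Qed.

Lemma mean_square_Gy x y :
  (\int[zeta_law pb]_s (l2norm (grad_y (G_ s) x y - grad_y g x y) ^+ 2)%:E <= (sg ^+ 2)%:E)%E.
Proof.
have [_ [_ h _ _]] := asm3 x y; rewrite -[sg ^+ 2]mul1r.
apply: (mean_square_mono h) => // [|s].
  by apply: measurable_dev; case: (oracle_Gy asm2 asm3) => + _; exact.
rewrite sqr_ge0 mul1r ler_sqr ?nnegrE ?l2norm_ge0//= !gradE opp_col_mx add_col_mx.
by have := l2norm_dsubmx (col_mx (grad_x (G_ s) x y - grad_x g x y) (grad_y (G_ s) x y - grad_y g x y)); rewrite col_mxKd.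
Qed.

Let spectral_sqr m n (A : 'M[R]_(m, n)) v r : l2norm v <= r ->
  0 <= l2norm (A *m v) ^+ 2 <= r ^+ 2 * spectral_norm A ^+ 2.
Proof.
move=> hv; rewrite sqr_ge0/= -exprMn ler_sqr ?nnegrE ?l2norm_ge0//.
  rewrite (le_trans (spectral_norm_le A v))// mulrC ler_wpM2r//.
  exact: spectral_norm_ge0.
by rewrite mulr_ge0 ?spectral_norm_ge0// (le_trans (l2norm_ge0 v)).
Qed.

Lemma mean_square_jac x y v r : l2norm v <= r ->
  (\int[zeta_law pb]_s (l2norm (jac_xy (G_ s) x y *m v - jac_xy g x y *m v) ^+ 2)%:E
    <= (r ^+ 2 * sg1 ^+ 2)%:E)%E.
Proof.
move=> hv; have [_ [_ _ h _]] := asm3 x y.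
apply: (mean_square_mono h) => [||s]; last by rewrite -mulmxBl; exact: spectral_sqr.
  apply: measurable_dev; apply: measurable_mxM; last exact: measurable_mx_cst.
  by case: (oracle_jac asm2 asm3) => + _; exact.
exact: sqr_ge0.
Qed.

Lemma mean_square_hess x y v r : l2norm v <= r ->
  (\int[zeta_law pb]_s (l2norm (hess_y (G_ s) x y *m v - hess_y g x y *m v) ^+ 2)%:E
    <= (r ^+ 2 * sg2 ^+ 2)%:E)%E.
Proof.
move=> hv; have [_ [_ _ _ h]] := asm3 x y.
apply: (mean_square_mono h) => [||s]; last by rewrite -mulmxBl; exact: spectral_sqr.
  apply: measurable_dev; apply: measurable_mxM; last exact: measurable_mx_cst.
  by case: (oracle_hess asm2 asm3) => + _; exact.
exact: sqr_ge0.
Qed.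

End ExpectedNoise.

Section RunNoise.
Variables (R : realType) (p q : nat) (pb : bilevel_problem R p q).
Variables (L M tau rho mu : R).
Hypotheses (L_gt0 : 0 < L) (M_ge0 : 0 <= M) (tau_ge0 : 0 <= tau) (rho_ge0 : 0 <= rho).
Hypotheses (mu_gt0 : 0 < mu) (q_gt0 : (0 < q)%N).
Hypothesis asm1 : assumption1 pb mu.
Hypothesis asm2 : assumption2 pb L M tau rho.
Variables (sf sg sg1 sg2 : R).
Hypothesis asm3 : assumption3 pb sf sg sg1 sg2.
Variables (d : measure_display) (Omega : measurableType d) (P : probability Omega R).
Variables (c : ssgd_config) (X : ssgd_samples pb P).
Hypothesis fresh : fresh_sampling c X.
Hypothesis cvalid : valid_config c.
Variables (alpha beta eta : R) (x0 : 'cV[R]_p) (y0 v0 : 'cV[R]_q).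
Hypotheses (eta_gt0 : 0 < eta) (eta_le : eta <= 2 / (mu + L)) (eta_mu : eta * mu <= 1).
Hypothesis v0_le : l2norm v0 <= M / mu.

Local Notation f := (f_ pb).
Local Notation g := (g_ pb).
Local Notation vstar := (vs f g (ystar pb)).
Local Notation D w := (realized_sets c X w).
Local Notation st k w := (ssgd alpha beta eta (cT c) (cJ c) (D w) x0 y0 v0 k).
Local Notation past b N := (g_sigma_algebraType (draws X (rest c b N))).

Lemma batches_nonempty w k j : (0 < size (B_set (D w) k j))%N.
Proof. by rewrite /= size_map size_iota; have [_ []] := cvalid. Qed.

Let kn b N k kK h : known_before c (T := past b N) _ _ _ _ _ k := known_before_rest X kK h.

Lemma expected_y_noise k t : (k < cK c)%N -> (t < cT c)%N ->
  (\int[P]_w (y_noise beta (S_set (D w) k) (st k.+1 w).1.1 (st k w).1.2 t)%:E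
     <= (sg ^+ 2 / (cS c)%:R)%:E)%E.
Proof.
move=> kK tT; pose b i := Draw_S k t i.
have [_ [S0 _ _ _]] := cvalid.
have kb := @kn b (cS c) k (ltnW kK) (fun i _ => leqnn k).
have bh i j : (i < cS c)%N -> b i <> Draw_DF k j /\ b i <> Draw_DG k j by [].
have by_ i t' j : (i < cS c)%N -> (t' < t)%N -> b i <> Draw_S k t' j.
  by move=> _ t't [tt' _]; rewrite tt' ltnn in t't.
have kh := known_h_rest X (ltnW kK) bh.
have ky := @known_y_rest _ _ _ _ _ _ P c X b (cS c) k t kK (ltnW tT) by_.
have mx := measurable_next_x asm2 asm3 alpha beta eta x0 y0 v0 kb kh.
have [_ my _] := measurable_ssgd asm2 asm3 alpha beta eta x0 y0 v0 kb.
have myt := measurable_y_loop asm2 asm3 beta (fun k i (w : past b (cS c)) => DF_rv X k i w)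
  (fun k i (w : past b (cS c)) => DG_rv X k i w) (fun k j i (w : past b (cS c)) => B_rv X k j i w) (fun k j i (w : past b (cS c)) => DFj_rv X k j i w) ky mx my.
apply: (@draw_batch_variance _ _ _ _ _ _ _ _ _ fresh _ _ (zeta_law pb) _ _ b
  (fun i => S_rv X k t i)
  (fun w s => grad_y (G_ s) (st k.+1 w).1.1 (y_loop beta (S_set (D w) k) (st k.+1 w).1.1 (st k w).1.2 t))
  (fun w => grad_y g (st k.+1 w).1.1 (y_loop beta (S_set (D w) k) (st k.+1 w).1.1 (st k w).1.2 t))) => //.
- by move=> i j [].
- by move=> i iN; exact: (fresh.1 (b i)).
- exact: (oracle_measurable (oracle_Gy asm2 asm3) (@measurable_snd _ _ _ _)
    (measurable_mx_comp (@measurable_fst _ _ _ _) mx)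
    (measurable_mx_comp (@measurable_fst _ _ _ _) myt)).
- exact: (measurable_grad_y_g asm2 mx myt).
- by move=> w; exact: unbiased_G.
- by move=> w; exact: (mean_square_Gy asm2 asm3).
Qed.

Section VNoise.
Variables (k j : nat).
Hypotheses (kK : (k < cK c)%N) (jJ : (j < cJ c)%N).

Let known_xy b N :
  (forall i, (i < N)%N -> (k <= draw_time (b i))%N) ->
  (forall i j, (i < N)%N -> b i <> Draw_DF k j /\ b i <> Draw_DG k j) ->
  (forall i t j, (i < N)%N -> b i <> Draw_S k t j) ->
  measurable_mx (fun w : past b N => (st k.+1 w).1.1) /\
  measurable_mx (fun w : past b N => (st k.+1 w).1.2).
Proof.
move=> h1 h2 h3.
have kb := @kn b N k (ltnW kK) h1.
have kh := known_h_rest X (ltnW kK) h2.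
have ky := @known_y_rest _ _ _ _ _ _ P c X b N k (cT c) kK (leqnn _)
  (fun i t' j' iN _ => h3 i t' j' iN).
have mx := measurable_next_x asm2 asm3 alpha beta eta x0 y0 v0 kb kh.
have [_ my _] := measurable_ssgd asm2 asm3 alpha beta eta x0 y0 v0 kb.
have myt := measurable_y_loop asm2 asm3 beta (fun k i (w : past b N) => DF_rv X k i w)
  (fun k i (w : past b N) => DG_rv X k i w) (fun k j i (w : past b N) => B_rv X k j i w) (fun k j i (w : past b N) => DFj_rv X k j i w) ky mx my.
split => //.
rewrite (_ : (fun w => (st k.+1 w).1.2) = fun w => y_loop beta (S_set (D w) k) (st k.+1 w).1.1 (st k w).1.2 (cT c)).
  exact: myt.
by apply/funext => w; have [_ ->] := ssgdS beta eta alpha (cT c) (cJ c) x0 y0 v0 (D w) k.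
Qed.

Lemma expected_Fy_noise :
  (\int[P]_w (l2norm (noise (DFj_set (D w) k j)
      (fun xi => grad_y (F_ xi) (st k.+1 w).1.1 (st k.+1 w).1.2)
      (grad_y f (st k.+1 w).1.1 (st k.+1 w).1.2)) ^+ 2)%:E
     <= (sf ^+ 2 / (cDf c)%:R)%:E)%E.
Proof.
pose b i := Draw_DFj k j i; have [_ [_ _ _ F0]] := cvalid.
have [||| mx my] := @known_xy b (cDf c) => //.
apply: (@draw_batch_variance _ _ _ _ _ _ _ _ _ fresh _ _ (xi_law pb) _ _ b
  (fun i => DFj_rv X k j i)
  (fun w s => grad_y (F_ s) (st k.+1 w).1.1 (st k.+1 w).1.2)
  (fun w => grad_y f (st k.+1 w).1.1 (st k.+1 w).1.2)) => //.
- by move=> i i' [].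
- by move=> i iN; exact: (fresh.1 (b i)).
- exact: (oracle_measurable (oracle_Fy asm2 asm3) (@measurable_snd _ _ _ _)
    (measurable_mx_comp (@measurable_fst _ _ _ _) mx)
    (measurable_mx_comp (@measurable_fst _ _ _ _) my)).
- exact: (measurable_grad_y_f asm2 mx my).
- by move=> w; exact: (unbiased_F asm3 _ _).2.
- by move=> w; exact: (mean_square_Fy asm2 asm3).
Qed.

(** The vector vstar is a function of the point, and bounded by M / mu. *)
Lemma expected_hess_noise :
  (\int[P]_w (l2norm (noise (B_set (D w) k j)
      (fun zeta => hess_y (G_ zeta) (st k.+1 w).1.1 (st k.+1 w).1.2)
      (hess_y g (st k.+1 w).1.1 (st k.+1 w).1.2) *m vstar (st k.+1 w).1.1) ^+ 2)%:E
     <= ((M / mu) ^+ 2 * sg2 ^+ 2 / (cD c)%:R)%:E)%E.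
Proof.
pose b i := Draw_B k j i; have [_ [_ D0 _ _]] := cvalid.
have [||| mx my] := @known_xy b (cD c) => //.
under eq_integral do rewrite noise_mulmx.
have mv := measurable_vstar L_gt0 M_ge0 rho_ge0 mu_gt0 q_gt0 asm1 asm2 mx my.
apply: (@draw_batch_variance _ _ _ _ _ _ _ _ _ fresh _ _ (zeta_law pb) _ _ b
  (fun i => B_rv X k j i)
  (fun w s => hess_y (G_ s) (st k.+1 w).1.1 (st k.+1 w).1.2 *m vstar (st k.+1 w).1.1)
  (fun w => hess_y g (st k.+1 w).1.1 (st k.+1 w).1.2 *m vstar (st k.+1 w).1.1)) => //.
- by move=> i i' [].
- by move=> i iN; exact: (fresh.1 (b i)).
- apply: measurable_mxM; last exact: (measurable_mx_comp (@measurable_fst _ _ _ _) mv).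
  exact: (oracle_measurable (oracle_hess asm2 asm3) (@measurable_snd _ _ _ _)
    (measurable_mx_comp (@measurable_fst _ _ _ _) mx)
    (measurable_mx_comp (@measurable_fst _ _ _ _) my)).
- by apply: measurable_mxM => //; exact: (measurable_hess_g asm2 mx my).
- by move=> w; apply: unbiased_mulmx; have [[]] := asm3 (st k.+1 w).1.1 (st k.+1 w).1.2.
- move=> w; apply: (mean_square_hess asm2 asm3).
  exact: (vstar_le L_gt0 M_ge0 mu_gt0 q_gt0 asm1 asm2).
Qed.

End VNoise.

Section HNoise.
Variable k : nat.
Hypothesis kK : (k < cK c)%N.

Lemma expected_Fx_noise :
  (\int[P]_w (l2norm (noise (DF_set (D w) k)
      (fun xi => grad_x (F_ xi) (st k w).1.1 (st k w).1.2)
      (grad_x f (st k w).1.1 (st k w).1.2)) ^+ 2)%:E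
     <= (sf ^+ 2 / (cDf c)%:R)%:E)%E.
Proof.
pose b i := Draw_DF k i; have [_ [_ _ _ F0]] := cvalid.
have kb := @kn b (cDf c) k (ltnW kK) (fun i _ => leqnn k).
have [mx my _] := measurable_ssgd asm2 asm3 alpha beta eta x0 y0 v0 kb.
apply: (@draw_batch_variance _ _ _ _ _ _ _ _ _ fresh _ _ (xi_law pb) _ _ b
  (fun i => DF_rv X k i)
  (fun w s => grad_x (F_ s) (st k w).1.1 (st k w).1.2)
  (fun w => grad_x f (st k w).1.1 (st k w).1.2)) => //.
- by move=> i iN; split => //; exact: ltnW.
- by move=> i i' [].
- by move=> i iN; apply: (fresh.1 (b i)); split => //; exact: ltnW.
- exact: (oracle_measurable (oracle_Fx asm2 asm3) (@measurable_snd _ _ _ _)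
    (measurable_mx_comp (@measurable_fst _ _ _ _) mx)
    (measurable_mx_comp (@measurable_fst _ _ _ _) my)).
- exact: (measurable_grad_x_f asm2 mx my).
- by move=> w; exact: (unbiased_F asm3 _ _).1.
- by move=> w; exact: (mean_square_Fx asm2 asm3).
Qed.

(** The iterate v is a function of earlier draws, and bounded by M / mu. *)
Lemma expected_jac_noise :
  (\int[P]_w (l2norm (noise (DG_set (D w) k)
      (fun zeta => jac_xy (G_ zeta) (st k w).1.1 (st k w).1.2)
      (jac_xy g (st k w).1.1 (st k w).1.2) *m (st k w).2) ^+ 2)%:E
     <= ((M / mu) ^+ 2 * sg1 ^+ 2 / (cDg c)%:R)%:E)%E.
Proof.
pose b i := Draw_DG k i; have [_ [_ _ G0 _]] := cvalid.
have kb := @kn b (cDg c) k (ltnW kK) (fun i _ => leqnn k).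
have [mx my mv] := measurable_ssgd asm2 asm3 alpha beta eta x0 y0 v0 kb.
under eq_integral do rewrite noise_mulmx.
apply: (@draw_batch_variance _ _ _ _ _ _ _ _ _ fresh _ _ (zeta_law pb) _ _ b
  (fun i => DG_rv X k i)
  (fun w s => jac_xy (G_ s) (st k w).1.1 (st k w).1.2 *m (st k w).2)
  (fun w => jac_xy g (st k w).1.1 (st k w).1.2 *m (st k w).2)) => //.
- by move=> i iN; split => //; exact: ltnW.
- by move=> i i' [].
- by move=> i iN; apply: (fresh.1 (b i)); split => //; exact: ltnW.
- apply: measurable_mxM; last exact: (measurable_mx_comp (@measurable_fst _ _ _ _) mv).
  exact: (oracle_measurable (oracle_jac asm2 asm3) (@measurable_snd _ _ _ _)
    (measurable_mx_comp (@measurable_fst _ _ _ _) mx)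
    (measurable_mx_comp (@measurable_fst _ _ _ _) my)).
- by apply: measurable_mxM => //; exact: (measurable_jac_g asm2 mx my).
- by move=> w; apply: unbiased_mulmx; have [[]] := asm3 (st k w).1.1 (st k w).1.2.
- move=> w; apply: (mean_square_jac asm2 asm3).
  exact: (vk_le L_gt0 M_ge0 mu_gt0 asm1 asm2 beta eta_gt0 eta_le eta_mu alpha (cT c) (cJ c)
    x0 y0 (batches_nonempty w) v0_le).
Qed.

End HNoise.

End RunNoise.

(** * Expectation of the run bound *)

Section MeanBound.
Variables (R : realType) (d : measure_display) (T : measurableType d) (P : probability T R).

(** A bound on the mean that is stable under sums and nonnegative scalings,
    which requires the integrands to be measurable. *)
Definition mean_bound (Z : T -> R) (s : R) : Prop :=
  [/\ measurable_fun setT Z, forall w, 0 <= Z w & (\int[P]_w (Z w)%:E <= s%:E)%E].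

Lemma mean_bound_cst (r : R) : 0 <= r -> mean_bound (fun=> r) r.
Proof.
move=> r0; split => //.
by have := expectation_cst P r; rewrite unlock => ->.
Qed.

Lemma mean_boundD Z1 Z2 s1 s2 : mean_bound Z1 s1 -> mean_bound Z2 s2 ->
  mean_bound (fun w => Z1 w + Z2 w) (s1 + s2).
Proof.
move=> [m1 p1 b1] [m2 p2 b2]; split; first exact: measurable_funD.
  by move=> w; rewrite addr_ge0.
under eq_integral do rewrite EFinD.
rewrite ge0_integralD//; first by rewrite EFinD leeD.
- by move=> w _; rewrite lee_fin.
- exact/measurable_EFinP.
- by move=> w _; rewrite lee_fin.
- exact/measurable_EFinP.
Qed.

Lemma mean_boundZ r Z s : 0 <= r -> mean_bound Z s ->
  mean_bound (fun w => r * Z w) (r * s).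
Proof.
move=> r0 [m p b]; split; first exact: measurable_funM.
  by move=> w; rewrite mulr_ge0.
under eq_integral do rewrite EFinM.
rewrite ge0_integralZl//; last 2 first.
- exact/measurable_EFinP.
- by move=> w _; rewrite lee_fin.
by rewrite EFinM; apply: lee_wpmul2l => //; rewrite lee_fin.
Qed.

Lemma mean_bound_sum n (Z : nat -> T -> R) (s : nat -> R) :
  (forall k, (k < n)%N -> mean_bound (Z k) (s k)) ->
  mean_bound (fun w => \sum_(k < n) Z k w) (\sum_(k < n) s k).
Proof.
elim: n => [|n IH] h.
  rewrite big_ord0; have := mean_bound_cst (lexx 0).
  by rewrite (_ : (fun w => \sum_(k < 0) Z k w) = fun=> 0)//; apply/funext => w; rewrite big_ord0.
rewrite big_ord_recr/=.
rewrite (_ : (fun w => _) = fun w => \sum_(k < n) Z k w + Z n w); last first.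
  by apply/funext => w; rewrite big_ord_recr.
by apply: mean_boundD; [apply: IH => k kn; apply: h; exact: ltnW|exact: h].
Qed.

Lemma mean_bound_geometric a n (Z : nat -> T -> R) s : 0 <= a <= 1 ->
  (forall t, (t < n)%N -> mean_bound (Z t) s) ->
  mean_bound (fun w => geometric_average a n (fun t => Z t w)) ((1 - a ^+ n) * s).
Proof.
move=> /andP[a0 a1] h; rewrite -geometric_average_cst /geometric_average.
apply: (@mean_bound_sum n (fun i w => (1 - a) * a ^+ (n.-1 - i) * Z i w)
  (fun i => (1 - a) * a ^+ (n.-1 - i) * s)) => k kn.
by apply: mean_boundZ; [rewrite mulr_ge0 ?exprn_ge0 ?subr_ge0|exact: h].
Qed.

End MeanBound.

Section ExpectedRun.
Variables (R : realType) (p q : nat) (pb : bilevel_problem R p q).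
Variables (L M tau rho mu : R).
Hypotheses (L_gt0 : 0 < L) (M_ge0 : 0 <= M) (tau_ge0 : 0 <= tau) (rho_ge0 : 0 <= rho).
Hypotheses (mu_gt0 : 0 < mu) (q_gt0 : (0 < q)%N).
Hypothesis asm1 : assumption1 pb mu.
Hypothesis asm2 : assumption2 pb L M tau rho.
Variables (sf sg sg1 sg2 : R).
Hypothesis asm3 : assumption3 pb sf sg sg1 sg2.
Variables (d : measure_display) (Omega : measurableType d) (P : probability Omega R).
Variables (c : ssgd_config) (X : ssgd_samples pb P).
Hypothesis cvalid : valid_config c.
Variables (alpha beta eta : R) (x0 : 'cV[R]_p) (y0 v0 : 'cV[R]_q).
Hypotheses (alpha_gt0 : 0 < alpha) (beta_gt0 : 0 < beta) (eta_gt0 : 0 < eta).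
Hypotheses (beta_le : beta <= 2 / (mu + L)) (eta_le : eta <= 2 / (mu + L)).
Hypotheses (beta_mu : beta * mu < 1) (eta_mu : eta * mu < 1).
Hypothesis v0_le : l2norm v0 <= M / mu.

Local Notation f := (f_ pb).
Local Notation g := (g_ pb).
Local Notation vstar := (vs f g (ystar pb)).
Local Notation D w := (realized_sets c X w).
Local Notation st k w := (ssgd alpha beta eta (cT c) (cJ c) (D w) x0 y0 v0 k).
Local Notation a := (1 - beta * mu).
Local Notation b := (1 - eta * mu).

Let a01 : 0 <= a <= 1.
Proof. by rewrite subr_ge0 ltW//= gerBl mulr_ge0// ltW. Qed.
Let b01 : 0 <= b <= 1.
Proof. by rewrite subr_ge0 ltW//= gerBl mulr_ge0// ltW. Qed.

Let known k : known_before c (T := Omega) (fun k i w => DF_rv X k i w)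
  (fun k i w => DG_rv X k i w) (fun k t i w => S_rv X k t i w)
  (fun k j i w => B_rv X k j i w) (fun k j i w => DFj_rv X k j i w) k.
Proof.
by move=> k' _; split; [split|move=> t i _ _|move=> j i _; split].
Qed.

Lemma measurable_state k : [/\ measurable_mx (fun w => (st k w).1.1),
  measurable_mx (fun w => (st k w).1.2) & measurable_mx (fun w => (st k w).2)].
Proof.
by have [mx my mv] := measurable_ssgd asm2 asm3 alpha beta eta x0 y0 v0 (@known k); split.
Qed.

Lemma measurable_noise d' (S : measurableType d') m n
  (H : S -> 'cV[R]_p -> 'cV[R]_q -> 'M[R]_(m, n)) H0 (zeta : nat -> {RV P >-> S}) N
  (x : Omega -> 'cV[R]_p) (y : Omega -> 'cV[R]_q) :
  oracle H -> measurable_mx x -> measurable_mx y ->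
  measurable_mx (fun w => H0 (x w) (y w)) ->
  measurable_mx (fun w => noise [seq zeta i w | i <- iota 0 N]
    (fun s => H s (x w) (y w)) (H0 (x w) (y w) : 'M[R]_(m, n))).
Proof.
move=> oH mx my mH0; apply: measurable_mxB => //.
apply: measurable_batch_mean => i _; exact: (oracle_measurable oH).
Qed.

Lemma measurable_gradient_sqr k :
  measurable_fun setT (fun w => l2norm (gradient (Phi pb) (st k w).1.1) ^+ 2).
Proof.
have [mx my _] := measurable_state k; apply: measurable_l2norm_sqr.
exact: (measurable_gradient_Phi L_gt0 M_ge0 tau_ge0 rho_ge0 mu_gt0 q_gt0 asm1 asm2 mx my).
Qed.

Hypothesis fresh : fresh_sampling c X.

Lemma mean_h_noise k : (k < cK c)%N ->
  mean_bound P (fun w => h_noise_at beta eta alpha (cT c) (cJ c) x0 y0 v0 (D w) k)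
    (sf ^+ 2 / (cDf c)%:R + (M / mu) ^+ 2 * sg1 ^+ 2 / (cDg c)%:R).
Proof.
move=> kK; have [mx my mv] := measurable_state k; apply: mean_boundD; split.
- apply: measurable_l2norm_sqr; exact: (measurable_noise (DF_rv X k) (cDf c)
    (oracle_Fx asm2 asm3) mx my (measurable_grad_x_f asm2 mx my)).
- by move=> w; exact: sqr_ge0.
- exact: (expected_Fx_noise asm2 asm3 fresh cvalid).
- apply: measurable_l2norm_sqr; apply: measurable_mxM => //.
  exact: (measurable_noise (DG_rv X k) (cDg c)
    (oracle_jac asm2 asm3) mx my (measurable_jac_g asm2 mx my)).
- by move=> w; exact: sqr_ge0.
- exact: (expected_jac_noise L_gt0 M_ge0 mu_gt0 asm1 asm2 asm3 fresh cvalid alpha beta x0 y0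
    eta_gt0 eta_le (ltW eta_mu) v0_le).
Qed.

Lemma mean_y_noise k : (k < cK c)%N ->
  mean_bound P (fun w => y_noise_at mu beta eta alpha (cT c) (cJ c) x0 y0 v0 (D w) k)
    ((1 - a ^+ cT c) * (mu ^- 2 * (sg ^+ 2 / (cS c)%:R))).
Proof.
move=> kK; have [mx1 _ _] := measurable_state k.+1; have [_ my _] := measurable_state k.
apply: (mean_bound_geometric (Z := fun t w =>
  y_noise beta (S_set (D w) k) (st k.+1 w).1.1 (st k w).1.2 t / mu ^+ 2)) => // t tT.
under eq_fun do rewrite mulrC.
apply: mean_boundZ; first by rewrite invr_ge0 sqr_ge0.
split; last exact: (expected_y_noise asm2 asm3 fresh cvalid).
  have myt : measurable_mx (fun w => y_loop beta (S_set (D w) k) (st k.+1 w).1.1 (st k w).1.2 t).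
    exact: (measurable_y_loop asm2 asm3 beta (fun k i w => DF_rv X k i w)
      (fun k i w => DG_rv X k i w) (Sy := fun k t i w => S_rv X k t i w)
      (fun k j i w => B_rv X k j i w) (fun k j i w => DFj_rv X k j i w)).
  apply: measurable_l2norm_sqr; exact: (measurable_noise (S_rv X k t) (cS c)
    (oracle_Gy asm2 asm3) mx1 myt (measurable_grad_y_g asm2 mx1 myt)).
by move=> w; exact: sqr_ge0.
Qed.

Lemma mean_v_noise k : (k < cK c)%N ->
  mean_bound P (fun w => v_noise_at mu beta eta alpha (cT c) (cJ c) x0 y0 v0 (D w) k)
    ((1 - b ^+ cJ c) *
     (mu ^- 2 * (sf ^+ 2 / (cDf c)%:R + (M / mu) ^+ 2 * sg2 ^+ 2 / (cD c)%:R))).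
Proof.
move=> kK; have [mx my _] := measurable_state k.+1.
apply: (mean_bound_geometric (Z := fun j w => v_noise (B_set (D w) k) (DFj_set (D w) k)
  (st k.+1 w).1.1 (st k.+1 w).1.2 j / mu ^+ 2)) => // j jJ.
under eq_fun do rewrite mulrC.
apply: mean_boundZ; first by rewrite invr_ge0 sqr_ge0.
apply: mean_boundD; split.
- apply: measurable_l2norm_sqr; exact: (measurable_noise (DFj_rv X k j) (cDf c)
    (oracle_Fy asm2 asm3) mx my (measurable_grad_y_f asm2 mx my)).
- by move=> w; exact: sqr_ge0.
- exact: (expected_Fy_noise asm2 asm3 fresh cvalid).
- apply: measurable_l2norm_sqr; apply: measurable_mxM.
    exact: (measurable_noise (B_rv X k j) (cD c)
      (oracle_hess asm2 asm3) mx my (measurable_hess_g asm2 mx my)).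
  exact: (measurable_vstar L_gt0 M_ge0 rho_ge0 mu_gt0 q_gt0 asm1 asm2 mx my).
- by move=> w; exact: sqr_ge0.
- exact: (expected_hess_noise L_gt0 M_ge0 rho_ge0 mu_gt0 q_gt0 asm1 asm2 asm3 fresh cvalid).
Qed.

Variable lo : R.
Hypothesis lo_le : forall x, lo <= Phi pb x.
Local Notation A := (a ^+ cT c).
Local Notation B := (b ^+ cJ c).
Local Notation wy := (weight_y L M tau rho mu beta (cT c)).
Local Notation wv := (weight_v L mu eta (cJ c)).
Hypothesis small_steps :
  wy * (2 * A / (1 - A)) * (L / mu) ^+ 2 * alpha ^+ 2
    + wv * (2 * B / (1 - B)) * (C1 mu L M rho ^+ 2 * (1 + (L / mu) ^+ 2)) * alpha ^+ 2
    + curvature L M tau rho mu * alpha <= 1 / 2.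
Hypotheses (wy_ge0 : 0 <= wy) (wv_ge0 : 0 <= wv).

Lemma expected_run_bound :
  (\sum_(k < cK c) 'E_P[fun w => (l2norm (gradient (Phi pb)
       (ssgd_x alpha beta eta c X x0 y0 v0 k w)) ^+ 2)%R]
   <= (2 / alpha * (Phi pb x0 - lo) + 2 * wy * l2norm (y0 - ystar pb x0) ^+ 2
        + 2 * wv * l2norm (v0 - vstar x0) ^+ 2
       + (cK c)%:R *
         (8 * (sf ^+ 2 / (cDf c)%:R + (M / mu) ^+ 2 * sg1 ^+ 2 / (cDg c)%:R)
          + 2 * wy * ((1 - A) * (mu ^- 2 * (sg ^+ 2 / (cS c)%:R)))
          + 6 * wv * ((1 - B) * (mu ^- 2 *
              (sf ^+ 2 / (cDf c)%:R + (M / mu) ^+ 2 * sg2 ^+ 2 / (cD c)%:R)))))%:E)%E.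
Proof.
have [[K0 T0 J0] _] := cvalid.
set c0 := (2 / alpha * _ + _ + _); set c1 := (8 * _ + _ + _).
have c00 : 0 <= c0.
  have h1 : 0 <= 2 / alpha * (Phi pb x0 - lo).
    by rewrite mulr_ge0 ?subr_ge0 ?lo_le// divr_ge0// ltW.
  have h2 : 0 <= 2 * wy * l2norm (y0 - ystar pb x0) ^+ 2.
    exact: mulr_ge0 (mulr_ge0 (ler0n _ 2) wy_ge0) (sqr_ge0 _).
  have h3 : 0 <= 2 * wv * l2norm (v0 - vstar x0) ^+ 2.
    exact: mulr_ge0 (mulr_ge0 (ler0n _ 2) wv_ge0) (sqr_ge0 _).
  exact: addr_ge0 (addr_ge0 h1 h2) h3.
have noise_le : mean_bound P (fun w => c0 + \sum_(k < cK c)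
   (8 * h_noise_at beta eta alpha (cT c) (cJ c) x0 y0 v0 (D w) k
    + 2 * wy * y_noise_at mu beta eta alpha (cT c) (cJ c) x0 y0 v0 (D w) k
    + 6 * wv * v_noise_at mu beta eta alpha (cT c) (cJ c) x0 y0 v0 (D w) k))
   (c0 + \sum_(k < cK c) c1).
  apply: mean_boundD; first exact: mean_bound_cst.
  apply: (@mean_bound_sum _ _ _ P (cK c) (fun k w =>
   (8 * h_noise_at beta eta alpha (cT c) (cJ c) x0 y0 v0 (D w) k
    + 2 * wy * y_noise_at mu beta eta alpha (cT c) (cJ c) x0 y0 v0 (D w) k
    + 6 * wv * v_noise_at mu beta eta alpha (cT c) (cJ c) x0 y0 v0 (D w) k))
    (fun=> c1)) => k kK.
  apply: mean_boundD; first apply: mean_boundD.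
  - by apply: mean_boundZ => //; exact: mean_h_noise.
  - by apply: mean_boundZ; [rewrite mulr_ge0|exact: mean_y_noise].
  - by apply: mean_boundZ; [rewrite mulr_ge0|exact: mean_v_noise].
under eq_bigr do rewrite unlock.
rewrite -ge0_integral_sum//; last 2 first.
- by move=> k; apply/measurable_EFinP; exact: measurable_gradient_sqr.
- by move=> k w _; rewrite lee_fin sqr_ge0.
rewrite mulr_natl -[cK c in X in (_ <= X)%E]card_ord -sumr_const.
have [_ _] := noise_le; apply: le_trans.
apply: ge0_le_integral_setT => w; first by apply: sume_ge0 => k _; rewrite lee_fin sqr_ge0.
rewrite sumEFin lee_fin.
exact: (run_bound L_gt0 M_ge0 tau_ge0 rho_ge0 mu_gt0 q_gt0 asm1 asm2 beta_gt0 beta_le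
  (ltW beta_mu) eta_gt0 eta_le (ltW eta_mu) x0 y0 v0 alpha_gt0 T0 J0
  (batches_nonempty X cvalid w) (cK c) beta_mu eta_mu lo_le small_steps).
Qed.

End ExpectedRun.

(** * A random output index *)

Section RandomIndex.
Variables (R : realType) (p q : nat) (pb : bilevel_problem R p q).
Variables (d : measure_display) (Omega : measurableType d) (P : probability Omega R).
Variables (c : ssgd_config) (X : ssgd_samples pb P) (out : {RV P >-> nat}).
Hypothesis unif : uniform_index c X out.
Hypothesis K_gt0 : (0 < cK c)%N.
Variables (A : set draw) (f : nat -> Omega -> R).
Hypothesis Ac : A `<=` performed c.
Local Notation T1 := (g_sigma_algebraType (draws X A)).
Hypothesis mf1 : forall k, (k < cK c)%N -> measurable_fun [set: T1] (f k).
Hypothesis mf : forall k, measurable_fun [set: Omega] (f k).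
Hypothesis f_ge0 : forall k w, 0 <= f k w.

Let measurable_out (B : set nat) : measurable [set w | B (out w)].
Proof. by rewrite -[X in measurable X]setTI; exact: measurable_funP. Qed.

Let prob_out_lt n : (n <= cK c)%N ->
  P [set w | (out w < n)%N] = (n%:R / (cK c)%:R)%:E.
Proof.
elim: n => [_|n IH nK].
  by rewrite mul0r (_ : [set w | _] = set0) ?measure0//; apply/seteqP; split => w.
rewrite (_ : [set w | _] = [set w | (out w < n)%N] `|` [set w | out w = n]); last first.
  apply/seteqP; split => w /=; first by rewrite ltnS leq_eqVlt => /predU1P[->|]; [right|left].
  by rewrite ltnS; case=> [/ltnW|->].
have -> : P ([set w | (out w < n)%N] `|` [set w | out w = n])
    = (P [set w | (out w < n)%N] + P [set w | out w = n])%E.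
  apply: measureU; [exact: (measurable_out [set k | (k < n)%N])|exact: (measurable_out [set n])|].
  by apply/seteqP; split => w //= -[h e]; rewrite e ltnn in h.
rewrite IH; last exact: ltnW.
have -> : P [set w | out w = n] = ((cK c)%:R^-1)%:E by exact: unif.1.
by rewrite -EFinD -natr1 mulrDl mul1r.
Qed.

Let measurable_pick k : measurable_fun [set: nat] (fun n => (n == k)%:R : R).
Proof. by []. Qed.

Let term k (w : Omega) : R := f k w * (out w == k)%:R.

Let measurable_term k : measurable_fun setT (term k).
Proof.
apply: measurable_funM => //; exact: measurableT_comp (measurable_pick k) _.
Qed.

Let integral_term k : (k < cK c)%N ->
  (\int[P]_w (term k w)%:E = ((cK c)%:R^-1)%:E * \int[P]_w (f k w)%:E)%E.
Proof.
move=> kK; pose X1 := coarsen P (@draws_measurable _ _ _ _ _ _ _ X A).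
pose F (z : T1 * nat) := (f k z.1 * (z.2 == k)%:R)%:E.
have mF : measurable_fun [set: (T1 * nat)%type] F.
  apply/measurable_EFinP; apply: measurable_funM.
    exact: measurableT_comp (mf1 kK) (@measurable_fst _ _ _ _).
  exact: measurableT_comp (measurable_pick k) (@measurable_snd _ _ _ _).
rewrite (_ : \int[P]_w _ = \int[P]_w F (X1 w, out w))%E//.
rewrite (@integral_independent _ _ _ _ _ _ _ P X1 out)//; last 2 first.
- move=> B C mB mC; apply: unif.2; last by exists C => //; rewrite setTI.
  by apply: sub_sigma_algebra2 mB; exact: bigcup_subset.
- by move=> z; rewrite lee_fin mulr_ge0.
transitivity (\int[distribution P X1]_a (((cK c)%:R^-1)%:E * (f k a)%:E))%E.
  apply: eq_integral => a _; rewrite /F/=.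
  under eq_integral do rewrite EFinM.
  rewrite ge0_integralZl//; last by rewrite lee_fin.
  rewrite muleC; congr (_ * _)%E.
  under eq_integral => n _.
    rewrite (_ : (n == k)%:R = \1_[set k] n); last first.
      by rewrite indicE; case: eqP => [->|h]; [rewrite mem_set|rewrite memNset].
    over.
  by rewrite integral_indic// setIT; exact: unif.1.
rewrite ge0_integralZl//; last 2 first.
- by apply/measurable_EFinP; exact: mf1.
- by move=> a _; rewrite lee_fin.
congr (_ * _)%E; rewrite ge0_integral_distribution//.
- by apply/measurable_EFinP; exact: mf1.
- by move=> a; rewrite lee_fin.
Qed.

(** Split according to the value k of the index: the event out = k has
    probability 1 / K and is independent of f k, and the values beyond K have
    probability 0. *)
Lemma mean_at_random_index :
  (\int[P]_w (f (out w) w)%:E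
     <= ((cK c)%:R^-1)%:E * \sum_(k < cK c) \int[P]_w (f k w)%:E)%E.
Proof.
apply: (@le_trans _ _ (\int[P]_w (\sum_(k < cK c) term k w)%:E)%E).
  apply: ae_ge0_le_integral => //.
  - by move=> w _; rewrite lee_fin.
  - apply/measurable_EFinP; apply: measurable_countable_choice => // n.
    exact: (measurable_out [set n]).
  - by move=> w _; rewrite lee_fin sumr_ge0// => k _; rewrite mulr_ge0.
  - by apply/measurable_EFinP; apply: measurable_sum => k; exact: measurable_term.
  exists (~` [set w | (out w < cK c)%N]); split.
  - by apply: measurableC; exact: (measurable_out [set k | (k < cK c)%N]).
  - transitivity (1 - P [set w | (out w < cK c)%N])%E.
      by apply: probability_setC; exact: (measurable_out [set k | (k < cK c)%N]).
    by rewrite prob_out_lt// divff ?subee// pnatr_eq0 -lt0n.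
  move=> w /= h oK; apply: h => _.
  rewrite lee_fin (bigD1 (Ordinal oK))//= /term eqxx mulr1 lerDl.
  by apply: sumr_ge0 => k _; rewrite mulr_ge0.
under eq_integral do rewrite -sumEFin.
rewrite ge0_integral_sum//; last 2 first.
- by move=> k; apply/measurable_EFinP; exact: measurable_term.
- by move=> k w _; rewrite lee_fin mulr_ge0.
rewrite ge0_sume_distrr; last first.
  by move=> k _; apply: integral_ge0 => w _; rewrite lee_fin.
by apply: lee_sum => k _; rewrite integral_term.
Qed.

End RandomIndex.

(** * Rate and complexity *)

Section RateConstants.
Variables (R : realType) (L M tau rho k1 k2 DPhi Dy : R).

Definition initial_const : R :=
  2 * inv_alpha_const L M tau rho k1 k2 * `|DPhi| + 8 * weight_const L M tau rho * Dy ^+ 2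
    + 64 * M ^+ 2.

(** Each summand dominates one contribution: the initial errors, the gradients
    of f, the Jacobian, the gradient of g and the Hessian. *)
Definition rate_const : R :=
  initial_const + 32 + 8 * (M ^+ 2 / L ^+ 2) + 4 * weight_const L M tau rho / L ^+ 2
    + 24 * (M ^+ 2 / L ^+ 2).

Hypotheses (L_gt0 : 0 < L) (M_ge0 : 0 <= M) (tau_ge0 : 0 <= tau) (rho_ge0 : 0 <= rho).
Hypotheses (k1_gt0 : 0 < k1) (k12 : k1 <= k2).

Let L0 : 0 <= L := ltW L_gt0.

Lemma weight_const_ge0 : 0 <= weight_const L M tau rho.
Proof. by rewrite /weight_const; nonneg. Qed.

Lemma inv_alpha_const_ge0 : 0 <= inv_alpha_const L M tau rho k1 k2.
Proof.
have k20 : 0 < k2 := lt_le_trans k1_gt0 k12.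
have e1 : 1 = L / L by rewrite divff ?gt_eqF.
apply/ltW/(inv_alpha_const_gt0 L_gt0 M_ge0 tau_ge0 rho_ge0 L_gt0 k20 e1 k1_gt0).
by rewrite expr1n divr1.
Qed.

Lemma initial_const_ge0 : 0 <= initial_const.
Proof.
have h := weight_const_ge0; have i := inv_alpha_const_ge0.
by rewrite /initial_const; nonneg.
Qed.

Lemma rate_const_ge : [/\ initial_const <= rate_const, 32 <= rate_const,
  24 * (M ^+ 2 / L ^+ 2) <= rate_const & 4 * weight_const L M tau rho / L ^+ 2 <= rate_const].
Proof.
have h := weight_const_ge0; have i := initial_const_ge0.
have Li : 0 <= L^-1 by rewrite invr_ge0.
have m0 : 0 <= M ^+ 2 / L ^+ 2 by nonneg.
have w0 : 0 <= 4 * weight_const L M tau rho / L ^+ 2 by nonneg.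
rewrite /rate_const; move: m0 w0 i; move: (M ^+ 2 / L ^+ 2) (_ / L ^+ 2) initial_const => m w i0.
by split; lra.
Qed.

End RateConstants.

Section Rate.
Variables (R : realType) (L M tau rho k1 k2 DPhi Dy : R).
Hypotheses (L_gt0 : 0 < L) (M_ge0 : 0 <= M) (tau_ge0 : 0 <= tau) (rho_ge0 : 0 <= rho).
Hypotheses (k1_gt0 : 0 < k1) (k12 : k1 <= k2).
Variables (p q : nat) (pb : bilevel_problem R p q) (mu sf sg sg1 sg2 rho2 : R).
Variables (x0 : 'cV[R]_p) (y0 v0 : 'cV[R]_q).
Hypotheses (q_gt0 : (0 < q)%N) (mu_gt0 : 0 < mu).
Hypothesis Phi_lb : has_lbound (range (Phi pb)).
Hypothesis asm1 : assumption1 pb mu.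
Hypothesis asm2 : assumption2 pb L M tau rho.
Hypothesis asm3 : assumption3 pb sf sg sg1 sg2.
Local Notation kap := (kappa mu L).
Hypothesis rho2_order : k1 / kap ^+ 4 <= rho2 <= k2 / kap ^+ 4.
Hypothesis Phi0 : Phi pb x0 - inf (range (Phi pb)) <= DPhi.
Hypothesis y0_le : l2norm (y0 - ystar pb x0) <= Dy.
Hypothesis v0_le : l2norm v0 <= M / mu.

Let mu_le : mu <= L := mu_le_L q_gt0 asm1 asm2.
Let kap1 : 1 <= kap := kap_ge1 mu_gt0 q_gt0 asm1 asm2.

Let kap_pow m n : (m <= n)%N -> kap ^+ m <= kap ^+ n.
Proof. by move=> h; exact: ler_weXn2l. Qed.

Lemma rho2_gt0 : 0 < rho2.
Proof.
case/andP: rho2_order => + _; apply: lt_le_trans.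
by rewrite divr_gt0// exprn_gt0// (lt_le_trans ltr01).
Qed.

Let r0 := rho2_gt0.
Let r_lo : k1 / kap ^+ 4 <= rho2. Proof. by case/andP: rho2_order. Qed.
Let r_hi : rho2 <= k2 / kap ^+ 4. Proof. by case/andP: rho2_order. Qed.

Lemma orders :
  [/\ beta_ mu L <= 3 / (2 * L), r_v mu L <= 2 / kap,
      Cbar1 mu L M tau <= Cbar1_const L M tau * kap &
      L_Phi mu L M tau rho <= L_Phi_const L M tau rho * kap ^+ 3].
Proof.
have k0 : 0 < kap := lt_le_trans ltr01 kap1.
split.
- rewrite /beta_ ler_wpM2l// lef_pV2 ?posrE ?mulr_gt0 ?addr_gt0//.
  by rewrite ler_pM2l// lerDl ltW.
- rewrite (r_v_kap L_gt0 mu_gt0 (erefl kap)).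
  rewrite ler_pdivrMr; last by rewrite ltr_wpDl ?sqr_ge0.
  rewrite mulrAC ler_pdivlMr//; have := sqr_ge0 kap; lra.
- exact: (Cbar1_le M tau L_gt0 mu_gt0 mu_le (erefl kap)).
- exact: (L_Phi_le L_gt0 M_ge0 tau_ge0 rho_ge0 mu_gt0 mu_le (erefl kap)).
Qed.

Section Expectation.
Variables (c : ssgd_config) (d : measure_display) (Omega : measurableType d).
Variables (P : probability Omega R) (X : ssgd_samples pb P).
Hypotheses (cvalid : valid_config c) (fresh : fresh_sampling c X).
Local Notation al := (alpha_ mu L M tau rho rho2).
Local Notation x := (ssgd_x al (beta_ mu L) (eta_ L) c X x0 y0 v0).
Local Notation wy := (weight_y L M tau rho mu (beta_ mu L) (cT c)).
Local Notation wv := (weight_v L mu (eta_ L) (cJ c)).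
Local Notation vstar := (vs (f_ pb) (g_ pb) (ystar pb)).
Local Notation wc := (weight_const L M tau rho).

Let T0 : (0 < cT c)%N. Proof. by case: cvalid => [[]]. Qed.
Let J0 : (0 < cJ c)%N. Proof. by case: cvalid => [[]]. Qed.

Let lo_le x1 : inf (range (Phi pb)) <= Phi pb x1.
Proof. by apply: inf_lbound => //; exists x1. Qed.

Lemma initial_bound :
  2 / al * (Phi pb x0 - inf (range (Phi pb))) + 2 * wy * l2norm (y0 - ystar pb x0) ^+ 2
    + 2 * wv * l2norm (v0 - vstar x0) ^+ 2 <= initial_const L M tau rho k1 k2 DPhi Dy * kap ^+ 5.
Proof.
have k0 : 0 <= kap := le_trans ler01 kap1.
have a0 := alpha_gt0 L_gt0 M_ge0 tau_ge0 rho_ge0 mu_gt0 mu_le r0 (erefl kap).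
have ia := inv_alpha_le L_gt0 M_ge0 tau_ge0 rho_ge0 mu_gt0 mu_le r0 (erefl kap) k1_gt0 r_lo r_hi.
have ic := inv_alpha_const_ge0 L_gt0 M_ge0 tau_ge0 rho_ge0 k1_gt0 k12.
have w0 := weight_const_ge0 L M tau rho.
rewrite /initial_const [leRHS]mulrDl [X in _ <= X + _]mulrDl; apply: lerD; first apply: lerD.
- have -> : 2 * inv_alpha_const L M tau rho k1 k2 * `|DPhi| * kap ^+ 5
     = 2 * (inv_alpha_const L M tau rho k1 k2 * kap ^+ 5) * `|DPhi| by ring.
  apply: ler_pM.
  + by rewrite divr_ge0// ltW.
  + by rewrite subr_ge0 lo_le.
  + by rewrite (_ : 2 / al = 2 * (1 / al)) ?mul1r// ler_wpM2l// -[al^-1]mul1r.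
  + exact: le_trans Phi0 (ler_norm _).
- have -> : 8 * wc * Dy ^+ 2 * kap ^+ 5 = 2 * (4 * wc * kap ^+ 5) * Dy ^+ 2 by ring.
  apply: ler_pM.
  + by apply: mulr_ge0 => //; exact: (weight_y_ge0 M tau rho L_gt0 mu_gt0 mu_le (erefl kap) T0).
  + exact: sqr_ge0.
  + rewrite ler_wpM2l//.
    exact: (weight_y_le L_gt0 M_ge0 tau_ge0 rho_ge0 mu_gt0 mu_le (erefl kap) T0).
  + by rewrite ler_sqr ?nnegrE ?l2norm_ge0// (le_trans _ y0_le)// l2norm_ge0.
- have hv : l2norm (v0 - vstar x0) <= 2 * (M / mu).
    rewrite (le_trans (l2normB _ _))//.
    have := vstar_le L_gt0 M_ge0 mu_gt0 q_gt0 asm1 asm2 x0; have := v0_le; lra.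
  apply: (@le_trans _ _ (2 * (8 * L ^+ 2 * kap) * (2 * (M / mu)) ^+ 2)).
    apply: ler_pM.
    + by apply: mulr_ge0 => //; exact: (weight_v_ge0 L_gt0 mu_gt0 mu_le (erefl kap) J0).
    + exact: sqr_ge0.
    + by rewrite ler_wpM2l//; exact: (weight_v_le L_gt0 mu_gt0 mu_le (erefl kap) J0).
    + by rewrite ler_sqr ?nnegrE ?l2norm_ge0// (le_trans _ hv)// l2norm_ge0.
  have -> : 2 * (8 * L ^+ 2 * kap) * (2 * (M / mu)) ^+ 2 = 64 * M ^+ 2 * kap ^+ 3.
    by rewrite /kappa; field; rewrite gt_eqF.
  by rewrite ler_wpM2l ?kap_pow//; nonneg.
Qed.

Lemma noise_bound (F G S D : R) : 0 <= F -> 0 <= G -> 0 <= S -> 0 <= D ->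
  8 * (F + (M / mu) ^+ 2 * G)
  + 2 * wy * ((1 - (1 - beta_ mu L * mu) ^+ cT c) * (mu ^- 2 * S))
  + 6 * wv * ((1 - (1 - eta_ L * mu) ^+ cJ c) * (mu ^- 2 * (F + (M / mu) ^+ 2 * D)))
  <= rate_const L M tau rho k1 k2 DPhi Dy *
     (kap ^+ 2 * F + kap ^+ 2 * G + kap ^+ 8 * S + kap ^+ 4 * D).
Proof.
move=> F0 G0 S0 D0; have k0 : 0 <= kap := le_trans ler01 kap1.
have wyn := weight_y_noise L_gt0 M_ge0 tau_ge0 rho_ge0 mu_gt0 mu_le (erefl kap) T0.
have wvn := weight_v_noise L_gt0 mu_gt0 mu_le (erefl kap) J0.
have [_ h32 hm hw] := rate_const_ge DPhi Dy L_gt0 M_ge0 tau_ge0 rho_ge0 k1_gt0 k12.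
have w0 := weight_const_ge0 L M tau rho.
have muE : mu ^- 2 = kap ^+ 2 / L ^+ 2.
  by rewrite /kappa; field; rewrite !gt_eqF.
have MmuE : (M / mu) ^+ 2 = M ^+ 2 / L ^+ 2 * kap ^+ 2.
  by rewrite /kappa; field; rewrite !gt_eqF.
have re (n w u z : R) : n * w * (u * z) = n * (w * u) * z by ring.
rewrite (re 2 wy) (re 6 wv) wvn MmuE muE.
have Li : 0 <= L^-1 by rewrite invr_ge0 ltW.
have z0 : 0 <= kap ^+ 2 / L ^+ 2 * S by nonneg.
have e1 := ler_wpM2r z0 (ler_wpM2l (ler0n R 2) wyn).
have m0 : 0 <= M ^+ 2 / L ^+ 2 by nonneg.
set m := M ^+ 2 / L ^+ 2 in hm m0 *.
have C0 : 0 <= rate_const L M tau rho k1 k2 DPhi Dy by apply: le_trans h32.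
set C := rate_const _ _ _ _ _ _ _ _ in h32 hm hw C0 *.
have e2 : 8 * F <= 8 * (kap ^+ 2 * F) by rewrite ler_wpM2l// ler_peMl// exprn_ege1.
have e3 : 32 * (kap ^+ 2 * F) <= C * (kap ^+ 2 * F) by rewrite ler_wpM2r//; nonneg.
have e4 : 24 * m * (kap ^+ 2 * G) <= C * (kap ^+ 2 * G) by rewrite ler_wpM2r//; nonneg.
have e4' : 0 <= m * (kap ^+ 2 * G) by nonneg.
have e5 : 24 * m * (kap ^+ 4 * D) <= C * (kap ^+ 4 * D) by rewrite ler_wpM2r//; nonneg.
have e6 : 4 * wc / L ^+ 2 * (kap ^+ 6 * S) <= C * (kap ^+ 8 * S).
  apply: ler_pM => //; [nonneg|nonneg|].
  by rewrite ler_wpM2r// kap_pow.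
have E1 : 2 * (2 * wc * kap ^+ 4) * (kap ^+ 2 / L ^+ 2 * S) = 4 * wc / L ^+ 2 * (kap ^+ 6 * S) by ring.
have E2 : 6 * (4 * L ^+ 2) * (kap ^+ 2 / L ^+ 2 * (F + m * kap ^+ 2 * D))
  = 24 * (kap ^+ 2 * F) + 24 * m * (kap ^+ 4 * D).
  by field; rewrite gt_eqF.
rewrite E1 in e1; rewrite E2; lra.
Qed.

Lemma convergence_rate :
  (((cK c)%:R^-1)%:E *
     (\sum_(k < cK c) 'E_P[fun w => (l2norm (gradient (Phi pb) (x k w)) ^+ 2)%R])
   <= (rate_const L M tau rho k1 k2 DPhi Dy *
        (kap ^+ 5 / (cK c)%:R
         + kap ^+ 2 * (sf ^+ 2 / (cDf c)%:R)
         + kap ^+ 2 * (sg1 ^+ 2 / (cDg c)%:R)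
         + kap ^+ 8 * (1 / (cS c)%:R) * sg ^+ 2
         + kap ^+ 4 * (sg2 ^+ 2 / (cD c)%:R)))%:E)%E.
Proof.
have [[K0 _ _] _] := cvalid.
have k0 : 0 < kap := lt_le_trans ltr01 kap1.
have K0' : 0 < (cK c)%:R :> R by rewrite ltr0n.
have a0 := alpha_gt0 L_gt0 M_ge0 tau_ge0 rho_ge0 mu_gt0 mu_le r0 (erefl kap).
have /andP[b0 b1] := beta_mu_lt1 L_gt0 mu_gt0 mu_le (erefl kap).
have /andP[e0 e1] := eta_mu_lt1 L_gt0 mu_gt0 mu_le (erefl kap).
have be0 : 0 < beta_ mu L by move: b0; rewrite pmulr_lgt0.
have et0 : 0 < eta_ L by move: e0; rewrite pmulr_lgt0.
have muL : 0 < mu + L by rewrite addr_gt0.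
have be_le : beta_ mu L <= 2 / (mu + L).
  by rewrite /beta_ (addrC L mu) invfM mulrA ler_wpM2r ?invr_ge0 ?ltW//; lra.
have et_le : eta_ L <= 2 / (mu + L).
  rewrite /eta_ ler_pdivrMr ?mulr_gt0// mulrAC ler_pdivlMr//; have := mu_le; lra.
have small := stepsize_condition L_gt0 M_ge0 tau_ge0 rho_ge0 mu_gt0 mu_le r0 (erefl kap) T0 J0.
have wy0 := weight_y_ge0 M tau rho L_gt0 mu_gt0 mu_le (erefl kap) T0.
have wv0 := weight_v_ge0 L_gt0 mu_gt0 mu_le (erefl kap) J0.
have run := expected_run_bound L_gt0 M_ge0 tau_ge0 rho_ge0 mu_gt0 q_gt0 asm1 asm2 asm3
  cvalid x0 y0 a0 be0 et0 be_le et_le b1 e1 v0_le fresh lo_le small wy0 wv0.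
have Ki0 : (0 <= ((cK c)%:R^-1 : R)%:E)%E by rewrite lee_fin invr_ge0.
apply: le_trans (lee_wpmul2l Ki0 run) _.
rewrite -EFinM lee_fin mulrDr (mulKf (lt0r_neq0 K0')).
have sq (s : R) n : 0 <= s ^+ 2 / n%:R by rewrite divr_ge0 ?sqr_ge0.
have nb := noise_bound (sq sf (cDf c)) (sq sg1 (cDg c)) (sq sg (cS c)) (sq sg2 (cD c)).
have [hi _ _ _] := rate_const_ge DPhi Dy L_gt0 M_ge0 tau_ge0 rho_ge0 k1_gt0 k12.
have ib := ler_wpM2r (exprn_ge0 5 (ltW k0)) hi.
have ib2 := le_trans initial_bound ib.
have Ki : 0 <= (cK c)%:R^-1 :> R by rewrite invr_ge0.
have ib3 := ler_wpM2l Ki ib2.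
rewrite -!(mulrA ((M / mu) ^+ 2)).
apply: le_trans (lerD ib3 nb) _; rewrite le_eqVlt; apply/orP; left; apply/eqP; ring.
Qed.

Lemma random_output_rate (out : {RV P >-> nat}) (eps : R) : uniform_index c X out ->
  (((cK c)%:R^-1)%:E *
     (\sum_(k < cK c) 'E_P[fun w => (l2norm (gradient (Phi pb) (x k w)) ^+ 2)%R])
    <= eps%:E)%E ->
  stationary P eps (Phi pb) (fun w => x (out w) w).
Proof.
move=> unif; apply: le_trans; have [[K0 _ _] _] := cvalid.
rewrite unlock.
pose b (i : nat) := Draw_DF 0 i.
apply: (@mean_at_random_index _ _ _ _ _ _ _ _ _ _ unif K0 (rest c b 0)
  (fun k w => l2norm (gradient (Phi pb) (x k w)) ^+ 2)).
- by move=> a [].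
- move=> k kK; apply: measurable_l2norm_sqr.
  have kb := @known_before_rest _ _ _ _ _ _ P c X b 0 k (ltnW kK) (fun i h => ltac:(by [])).
  have [mx my _] := measurable_ssgd asm2 asm3 al (beta_ mu L) (eta_ L) x0 y0 v0 kb.
  exact: (measurable_gradient_Phi L_gt0 M_ge0 tau_ge0 rho_ge0 mu_gt0 q_gt0 asm1 asm2 mx my).
- move=> k.
  exact: (measurable_gradient_sqr L_gt0 M_ge0 tau_ge0 rho_ge0 mu_gt0 q_gt0 asm1 asm2 asm3 c X).
- by move=> k w; exact: sqr_ge0.
Qed.

End Expectation.

End Rate.

Section BatchSizes.
Variable R : realType.

(** Rounding the real solution 5 a kap ^+ n / eps up to an integer costs at
    most 1, hence at most kap ^+ n / eps. *)
Lemma batch_size_exists (a kap eps : R) n : 0 <= a -> 1 <= kap -> 0 < eps -> eps <= 1 ->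
  exists N : nat, [/\ (0 < N)%N, a * kap ^+ n / N%:R <= eps / 5 &
    N%:R <= (5 * a + 1) * (kap ^+ n / eps)].
Proof.
move=> a0 k1 e0 e1.
have u1 : 1 <= kap ^+ n / eps by rewrite ler_pdivlMr// mul1r (le_trans e1)// exprn_ege1.
set u := kap ^+ n / eps in u1 *; pose y := 5 * a * u.
have u0 : 0 <= u := le_trans ler01 u1.
have y0 : 0 <= y by rewrite /y mulr_ge0// mulr_ge0.
have /andP[h1 h2] := trunc_itv y0.
exists (Num.trunc y).+1; split => //; last by rewrite -natr1; move: h1; rewrite /y; lra.
rewrite ler_pdivrMr ?ltr0n// -(ler_pM2r (ltr0n R 5)).
have -> : a * kap ^+ n * 5 = y * eps by rewrite /y /u; field; rewrite gt_eqF.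
rewrite [leRHS]mulrAC divfK ?pnatr_eq0// [leRHS]mulrC ler_pM2r//; exact: ltW.
Qed.

Lemma cost_bound (K T J S D Dg Df : nat) (b : R) : (0 < K)%N -> (0 < T)%N ->
  S%:R <= b -> D%:R <= b -> Dg%:R <= b -> Df%:R <= b ->
  (ssgd_cost (SsgdConfig K T J S D Dg Df))%:R <= 7 * K%:R * (maxn T J)%:R * b.
Proof.
move=> K0 T0 hS hD hG hF.
rewrite /ssgd_cost /= !sum_nat_const !card_ord.
set m : R := (maxn T J)%:R.
have hT : T%:R <= m by rewrite ler_nat leq_maxl.
have hJ : J%:R <= m by rewrite ler_nat leq_maxr.
have b0 : 0 <= b := le_trans (ler0n R S) hS.
have K1 : 1 <= K%:R :> R by rewrite ler1n.
have m1 : 1 <= m by rewrite (le_trans _ hT)// ler1n.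
have e1 : T%:R * S%:R <= m * b by apply: ler_pM.
have e2 : J%:R * (D + Df)%N%:R <= m * (2 * b) by apply: ler_pM => //; rewrite natrD; lra.
have mb : b <= m * b by rewrite ler_peMl.
have inner : T%:R * S%:R + J%:R * (D + Df)%N%:R + (Df + Dg)%N%:R <= 5 * (m * b).
  by rewrite [(Df + Dg)%N%:R]natrD; lra.
have outer : K%:R * (T%:R * S%:R + J%:R * (D + Df)%N%:R + (Df + Dg)%N%:R) <= K%:R * (5 * (m * b)).
  by rewrite ler_wpM2l.
have Kmb : m * b <= K%:R * (m * b) by rewrite ler_peMl// mulr_ge0// (le_trans ler01).
rewrite natrD [(K * _)%:R]natrM [(T * S + _ + _)%:R]natrD [(T * S + _)%:R]natrD [(T * S)%:R]natrM [(J * _)%:R]natrM.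
have -> : 7 * K%:R * m * b = 2 * (K%:R * (m * b)) + K%:R * (5 * (m * b)) by ring.
by apply: lerD => //; rewrite natrD; lra.
Qed.

End BatchSizes.

Theorem theorem1 (R : realType) (L M tau rho c1 c2 DPhi Dy : R)
  (hL : 0 < L) (hM : 0 <= M) (htau : 0 <= tau) (hrho : 0 <= rho)
  (hc1 : 0 < c1) (hc2 : c1 <= c2) :
  (* convergence rate; the constant C also witnesses the orders of beta, r_v,
     Cbar1 and L_Phi *)
  (exists C : R, 0 < C /\
    forall (p q : nat) (pb : bilevel_problem R p q)
      (mu sf sg sg1 sg2 rho2 : R)
      (x0 : 'cV[R]_p) (y0 v0 : 'cV[R]_q),
    (0 < p)%N -> (0 < q)%N -> 0 < mu ->
    0 < sf -> 0 < sg -> 0 < sg1 -> 0 < sg2 ->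
    well_defined pb ->
    has_lbound (range (Phi pb)) ->
    assumption1 pb mu ->
    assumption2 pb L M tau rho ->
    assumption3 pb sf sg sg1 sg2 ->
    c1 / kappa mu L ^+ 4 <= rho2 <= c2 / kappa mu L ^+ 4 ->
    Phi pb x0 - inf (range (Phi pb)) <= DPhi ->
    l2norm (y0 - ystar pb x0) <= Dy ->
    l2norm v0 <= M / mu ->
    [/\ beta_ mu L <= C,
        r_v mu L <= C / kappa mu L,
        Cbar1 mu L M tau <= C * kappa mu L &
        L_Phi mu L M tau rho <= C * kappa mu L ^+ 3] /\
    forall c : ssgd_config, valid_config c ->
    forall (d : measure_display) (Omega : measurableType d)
      (P : probability Omega R) (X : ssgd_samples pb P),
    fresh_sampling c X ->
    let x := ssgd_x (alpha_ mu L M tau rho rho2) (beta_ mu L) (eta_ L) c X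
               x0 y0 v0 in
    (((cK c)%:R^-1)%:E *
       (\sum_(k < cK c) 'E_P[fun w => (l2norm (gradient (Phi pb) (x k w)) ^+ 2)%R])
     <= (C * (kappa mu L ^+ 5 / (cK c)%:R
              + kappa mu L ^+ 2 * (sf ^+ 2 / (cDf c)%:R)
              + kappa mu L ^+ 2 * (sg1 ^+ 2 / (cDg c)%:R)
              + kappa mu L ^+ 8 * (1 / (cS c)%:R) * sg ^+ 2
              + kappa mu L ^+ 4 * (sg2 ^+ 2 / (cD c)%:R)))%:E)%E) /\
  (* computational complexity *)
  (forall sf sg sg1 sg2 : R, 0 < sf -> 0 < sg -> 0 < sg1 -> 0 < sg2 ->
   exists C : R, 0 < C /\
    forall (p q : nat) (pb : bilevel_problem R p q) (mu rho2 : R)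
      (x0 : 'cV[R]_p) (y0 v0 : 'cV[R]_q),
    (0 < p)%N -> (0 < q)%N -> 0 < mu ->
    well_defined pb ->
    has_lbound (range (Phi pb)) ->
    assumption1 pb mu ->
    assumption2 pb L M tau rho ->
    assumption3 pb sf sg sg1 sg2 ->
    c1 / kappa mu L ^+ 4 <= rho2 <= c2 / kappa mu L ^+ 4 ->
    Phi pb x0 - inf (range (Phi pb)) <= DPhi ->
    l2norm (y0 - ystar pb x0) <= Dy ->
    l2norm v0 <= M / mu ->
    forall (T J : nat) (eps : R),
    (0 < T)%N -> (0 < J)%N -> 0 < eps -> eps <= 1 ->
    exists K S D Dg Df : nat,
      let c := SsgdConfig K T J S D Dg Df in
      [/\ valid_config c,
          (ssgd_cost c)%:R
            <= C * kappa mu L ^+ 13 * eps ^- 2 * (maxn T J)%:R &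
          forall (d : measure_display) (Omega : measurableType d)
            (P : probability Omega R) (X : ssgd_samples pb P)
            (out : {RV P >-> nat}),
          fresh_sampling c X -> uniform_index c X out ->
          let x := ssgd_x (alpha_ mu L M tau rho rho2) (beta_ mu L) (eta_ L)
                     c X x0 y0 v0 in
          stationary P eps (Phi pb) (fun w => x (out w) w)]).
Proof.
have rc := rate_const_ge DPhi Dy hL hM htau hrho hc1 hc2.
set C := rate_const L M tau rho c1 c2 DPhi Dy in rc.
have C32 : 32 <= C by case: rc.
have C0 : 0 <= C := le_trans (ler0n R 32) C32.
split.
- have Li : 0 <= L^-1 by rewrite invr_ge0 ltW.
  have L0 := ltW hL.
  have b0 : 0 <= 3 / (2 * L) by rewrite invfM; nonneg.
  have cb0 : 0 <= Cbar1_const L M tau by rewrite /Cbar1_const; nonneg.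
  have lp0 : 0 <= L_Phi_const L M tau rho by rewrite /L_Phi_const; nonneg.
  exists (C + 3 / (2 * L) + 2 + Cbar1_const L M tau + L_Phi_const L M tau rho).
  split; first by lra.
  move=> p q pb mu sf sg sg1 sg2 rho2 x0 y0 v0 p0 q0 mu0 sf0 sg0 sg10 sg20 wd lb a1 a2 a3 hr hP hy hv.
  have kap1 : 1 <= kappa mu L := kap_ge1 mu0 q0 a1 a2.
  have kap0 : 0 <= kappa mu L := le_trans ler01 kap1.
  have [h1 h2 h3 h4] := orders hL hM htau hrho q0 mu0 a1 a2.
  split; first split.
  + by apply: le_trans h1 _; lra.
  + by apply: le_trans h2 _; rewrite ler_wpM2r ?invr_ge0//; lra.
  + by apply: le_trans h3 _; rewrite ler_wpM2r//; lra.
  + by apply: le_trans h4 _; rewrite ler_wpM2r ?exprn_ge0//; lra.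
  move=> c cv d Omega P X fr; cbv zeta.
  apply: le_trans (convergence_rate hL hM htau hrho hc1 hc2 q0 mu0 lb a1 a2 a3 hr hP hy hv cv fr) _.
  rewrite lee_fin ler_wpM2r//; last by rewrite -/C; lra.
  by nonneg.
move=> sf sg sg1 sg2 sf0 sg0 sg10 sg20.
pose aB := 5 * (C * (sf ^+ 2 + sg ^+ 2 + sg1 ^+ 2 + sg2 ^+ 2)) + 1.
have q1 := sqr_ge0 sf; have q2 := sqr_ge0 sg; have q3 := sqr_ge0 sg1; have q4 := sqr_ge0 sg2.
have aB1 : 1 <= aB.
  rewrite lerDr; apply: mulr_ge0 => //; apply: mulr_ge0 => //; lra.
exists (7 * (5 * C + 1) * aB); split.
  by apply: mulr_gt0 (lt_le_trans ltr01 aB1); lra.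
move=> p q pb mu rho2 x0 y0 v0 p0 q0 mu0 wd lb a1 a2 a3 hr hP hy hv T J eps T0 J0 e0 e1.
have kap1 : 1 <= kappa mu L := kap_ge1 mu0 q0 a1 a2.
have kap0 : 0 <= kappa mu L := le_trans ler01 kap1.
have [K [K0 K1 K2]] := batch_size_exists 5 C0 kap1 e0 e1.
have [Df [Df0 Df1 Df2]] := batch_size_exists 2 (mulr_ge0 C0 q1) kap1 e0 e1.
have [S [S0 S1 S2]] := batch_size_exists 8 (mulr_ge0 C0 q2) kap1 e0 e1.
have [Dg [Dg0 Dg1 Dg2]] := batch_size_exists 2 (mulr_ge0 C0 q3) kap1 e0 e1.
have [D [D0 D1 D2]] := batch_size_exists 4 (mulr_ge0 C0 q4) kap1 e0 e1.
exists K, S, D, Dg, Df => c.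
have cv : valid_config c by split.
split => //.
- pose b := aB * (kappa mu L ^+ 8 / eps).
  have size_le (s : R) n N : (n <= 8)%N -> 0 <= s -> C * s <= C * (sf ^+ 2 + sg ^+ 2 + sg1 ^+ 2 + sg2 ^+ 2) ->
      N%:R <= (5 * (C * s) + 1) * (kappa mu L ^+ n / eps) -> N%:R <= b.
    move=> n8 s0 hs /le_trans; apply; apply: ler_pM.
    + by rewrite addr_ge0// mulr_ge0// mulr_ge0.
    + by rewrite divr_ge0 ?exprn_ge0// ltW.
    + by rewrite /aB lerD2r ler_wpM2l.
    + by apply: ler_wpM2r; [rewrite invr_ge0 ltW|exact: ler_weXn2l].
  have bS : S%:R <= b by apply: size_le S2 => //; rewrite ler_wpM2l//; lra.
  have bD : D%:R <= b by apply: size_le D2 => //; rewrite ler_wpM2l//; lra.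
  have bG : Dg%:R <= b by apply: size_le Dg2 => //; rewrite ler_wpM2l//; lra.
  have bF : Df%:R <= b by apply: size_le Df2 => //; rewrite ler_wpM2l//; lra.
  apply: le_trans (cost_bound J K0 T0 bS bD bG bF) _.
  have b0 : 0 <= b := le_trans (ler0n R S) bS.
  have h : K%:R * b <= (5 * C + 1) * (kappa mu L ^+ 5 / eps) * b by rewrite ler_wpM2r.
  have -> : 7 * (5 * C + 1) * aB * kappa mu L ^+ 13 * eps ^- 2 * (maxn T J)%:R
    = 7 * (maxn T J)%:R * ((5 * C + 1) * (kappa mu L ^+ 5 / eps) * b).
    by rewrite /b; field; rewrite gt_eqF.
  rewrite (_ : 7 * K%:R * (maxn T J)%:R * b = 7 * (maxn T J)%:R * (K%:R * b)); last by ring.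
  by rewrite ler_wpM2l// mulr_ge0.
- move=> d Omega P X out fr un; cbv zeta.
  apply: (random_output_rate hL hM htau hrho q0 mu0 a1 a2 a3 cv un).
  apply: le_trans (convergence_rate hL hM htau hrho hc1 hc2 q0 mu0 lb a1 a2 a3 hr hP hy hv cv fr) _.
  rewrite lee_fin /= -/C !mulrDr.
  rewrite [leRHS](_ : eps = eps / 5 + eps / 5 + eps / 5 + eps / 5 + eps / 5); last by field.
  have reorder (a s t n : R) : a * (s * (t / n)) = a * t * s / n by ring.
  have reorder' (a s t n : R) : a * (s * (1 / n) * t) = a * t * s / n by ring.
  rewrite (reorder C _ (sf ^+ 2) Df%:R) (reorder C _ (sg1 ^+ 2) Dg%:R) (reorder C _ (sg2 ^+ 2) D%:R).
  rewrite (reorder' C _ (sg ^+ 2) S%:R) [X in X + _ + _ + _ + _ <= _]mulrA.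
  exact: lerD (lerD (lerD (lerD K1 Df1) Dg1) S1) D1.
Qed.
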